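(* Let $S$ be a closed orientable surface of genus $g \ge 2$. Then the fundamental group $\pi_1(S)$ is flexibly stable in permutations.
   Context: For $N\in\mathbb{N}$ let $\mathrm{S}_N$ be the symmetric group on $\{1,\dots,N\}$, with the normalized Hamming metric $\mathrm{d}_N(\sigma_1,\sigma_2)=\frac1N|\{i\in\{1,\dots,N\}:\sigma_1(i)\neq\sigma_2(i)\}|$. For a finite set $\Sigma$ let $F_\Sigma$ be the free group with basis $\Sigma$, and equip $\mathrm{Hom}(F_\Sigma,\mathrm{S}_N)$ with the metric $\mathrm{d}_N(\rho_1,\rho_2)=\sum_{\sigma\in\Sigma}\mathrm{d}_N(\rho_1(\sigma),\rho_2(\sigma))$. For $N\le M$ let $\mathcal{E}_N^M:\mathrm{Hom}(F_\Sigma,\mathrm{S}_N)\to\mathrm{Hom}(F_\Sigma,\mathrm{S}_M)$ be the map extending a given permutation representation so that it acts trivially on the extra $M-N$ points. A finitely presented group $G$ is flexibly stable in permutations if it admits a finite presentation $G=\langle\Sigma\mid R\rangle$, with quotient map $\pi_\Sigma:F_\Sigma\to G$, having the following property: for every $\varepsilon>0$ there is $\delta=\delta(\varepsilon)>0$ such that for every $N\in\mathbb{N}$ and every $\rho\in\mathrm{Hom}(F_\Sigma,\mathrm{S}_N)$ with $\mathrm{d}_N(\rho(r),\mathrm{id}_N)<\delta$ for all $r\in R$, there exist $M\in\mathbb{N}$ with $N\le M\le(1+\varepsilon)N$ and $\rho'\in\mathrm{Hom}(F_\Sigma,\mathrm{S}_M)$ that factors through $\pi_\Sigma$ and satisfies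 $\mathrm{d}_M(\mathcal{E}_N^M(\rho),\rho')<\varepsilon$. *)

(* Defs.v *)
From HB Require Import structures.
From mathcomp Require Import all_boot all_order all_algebra all_fingroup.
From mathcomp Require Import generic_quotient.
From mathcomp Require Import all_classical all_reals all_analysis.
From mathcomp Require Import homotopy lra.
From Stdlib Require Import Relation_Operators.

Set Implicit Arguments.
Unset Strict Implicit.
Unset Printing Implicit Defensive.

Import Order.TTheory GRing.Theory Num.Theory.
Import numFieldNormedType.Exports.

Local Open Scope classical_set_scope.
Local Open Scope ring_scope.
Local Open Scope quotient_scope.

Section ReducedWords.
Variable Sigma : choiceType.

(* The letter [(x, false)] is the generator x, and [(x, true)] its inverse. *)
Definition letter : Type := (Sigma * bool)%type.
Implicit Types (a : letter) (u v w : seq letter).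

Definition inv_letter a : letter := (a.1, ~~ a.2).

Definition reduced w : bool := sorted (fun a b => b != inv_letter a) w.

Definition cons_reduce a w : seq letter :=
  if w is b :: w' then if b == inv_letter a then w' else a :: w else [:: a].

Definition reduce w : seq letter := foldr cons_reduce [::] w.

Definition inv_word w : seq letter := rev (map inv_letter w).

Lemma inv_letterK : involutive inv_letter.
Proof. by case=> x b; rewrite /inv_letter /= negbK. Qed.

Lemma cons_reduce_reduced a w : reduced w -> reduced (cons_reduce a w).
Proof.
case: w => [//|b w] rw /=; case: ifPn => [_|nba]; first exact: path_sorted rw.
by rewrite /reduced /= nba.
Qed.

Lemma foldr_reduced u w : reduced w -> reduced (foldr cons_reduce w u).
Proof. by move=> rw; elim: u => //= a u; exact: cons_reduce_reduced. Qed.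

Lemma cons_reduceK a w :
  reduced w -> cons_reduce (inv_letter a) (cons_reduce a w) = w.
Proof.
case: w => [|b w] rw /=; first by rewrite inv_letterK eqxx.
case: eqP rw => [->|_ _] /=; last by rewrite inv_letterK eqxx.
case: w => [//|c w]; rewrite /reduced /= inv_letterK => /andP[ca _].
by rewrite (negPf ca).
Qed.

Lemma reduce_id w : reduced w -> reduce w = w.
Proof.
elim: w => //= a w IHw raw; rewrite IHw; last exact: path_sorted raw.
by case: w raw {IHw} => //= b w /andP[/negPf ->].
Qed.

Lemma foldr_cons_reduce u a w : reduced w ->
  foldr cons_reduce w (cons_reduce a u) = cons_reduce a (foldr cons_reduce w u).
Proof.
case: u => [//|b u] rw /=; case: eqP => [->|//].
have := @cons_reduceK (inv_letter a) _ (foldr_reduced u rw).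
by rewrite inv_letterK => ->.
Qed.

Lemma foldr_reduce u w : reduced w ->
  foldr cons_reduce w (reduce u) = foldr cons_reduce w u.
Proof.
by move=> rw; elim: u => //= a u IHu; rewrite foldr_cons_reduce // IHu.
Qed.

Lemma reduce_catr u v : reduce (u ++ reduce v) = reduce (u ++ v).
Proof.
by rewrite /reduce !foldr_cat -/(reduce _) -/(reduce v) reduce_id ?foldr_reduced.
Qed.

Lemma reduce_catl u v : reduce (reduce u ++ v) = reduce (u ++ v).
Proof. by rewrite /reduce !foldr_cat foldr_reduce // foldr_reduced. Qed.

Lemma reduce_reduced w : reduced (reduce w).
Proof. exact: foldr_reduced. Qed.

Lemma inv_wordK : involutive inv_word.
Proof.
by move=> w; rewrite /inv_word map_rev revK mapK //; exact: inv_letterK.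
Qed.

Lemma inv_word_reduced w : reduced w -> reduced (inv_word w).
Proof.
rewrite /reduced /inv_word rev_sorted sorted_map; apply: sub_sorted => a b /=.
by rewrite (can_eq inv_letterK); apply: contraNneq => ->; rewrite inv_letterK.
Qed.

Lemma reduce_inv_word w : reduce (inv_word w ++ w) = [::].
Proof.
elim: w => //= a w IHw; rewrite /inv_word /= rev_cons cat_rcons -reduce_catr /=.
by rewrite cons_reduceK ?reduce_reduced // reduce_catr.
Qed.

Definition free_group : Type := {w : seq letter | reduced w}.

HB.instance Definition _ := SubChoice.on free_group.

Definition fg_of (w : seq letter) : free_group :=
  exist _ (reduce w) (reduce_reduced w).
Definition fg_one : free_group := fg_of [::].
Definition fg_mul (x y : free_group) : free_group := fg_of (val x ++ val y).
Definition fg_inv (x : free_group) : free_group := fg_of (inv_word (val x)).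
Definition generator (s : Sigma) : free_group := fg_of [:: (s, false)].

Lemma fg_mulA : associative fg_mul.
Proof.
by move=> x y z; apply: val_inj; rewrite /= reduce_catr reduce_catl catA.
Qed.

Lemma fg_mul1 : left_id fg_one fg_mul.
Proof. by move=> x; apply: val_inj; rewrite /= reduce_id //; exact: valP. Qed.

Lemma fg_mulr1 : right_id fg_one fg_mul.
Proof.
by move=> x; apply: val_inj; rewrite /= cats0 reduce_id //; exact: valP.
Qed.

Lemma fg_mulV : left_inverse fg_one fg_inv fg_mul.
Proof.
by move=> x; apply: val_inj; rewrite /= reduce_catl reduce_inv_word.
Qed.

Lemma fg_mulrV : right_inverse fg_one fg_inv fg_mul.
Proof.
move=> x; apply: val_inj; rewrite /= reduce_catr -{1}[val x]inv_wordK.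
exact: reduce_inv_word.
Qed.

HB.instance Definition _ :=
  isGroup.Build free_group fg_mulA fg_mul1 fg_mulr1 fg_mulV fg_mulrV.

End ReducedWords.

Section Presentations.
Variables (Sigma : choiceType) (G : groupType).

Definition normal_subgroup (H : groupType) (A : set H) : Prop :=
  [/\ A 1%g, (forall x y, A x -> A y -> A (x * y)%g),
      (forall x, A x -> A x^-1%g) & forall x y, A x -> A (x ^ y)%g].

Definition normal_closure (H : groupType) (B : set H) : set H :=
  \bigcap_(A in [set A | normal_subgroup A /\ B `<=` A]) A.

Definition is_presentation (rels : set (free_group Sigma))
    (p : {multiplicative free_group Sigma -> G}) : Prop :=
  (forall x, exists w, p w = x) /\ [set w | p w = 1%g] = normal_closure rels.

End Presentations.

(* The product of 'S_N is [(s * t) i = t (s i)]. Composing with inversion turns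
   homomorphisms for one order of composition into homomorphisms for the other,
   and preserves all the distances below. *)
Definition hamming (R : realType) (N : nat) (s t : 'S_N) : R :=
  #|[set i : 'I_N | s i != t i]%SET|%:R / N%:R.

Definition hom_dist (R : realType) (Sigma : finType) (N : nat)
    (rho1 rho2 : {multiplicative free_group Sigma -> 'S_N}) : R :=
  \sum_(s : Sigma) hamming R (rho1 (generator s)) (rho2 (generator s)).

Section Extension.
Variables (N M : nat) (le_NM : (N <= M)%N).

(* The identity on the points of 'I_M that do not come from 'I_N. *)
Definition extend_fun (s : 'S_N) (i : 'I_M) : 'I_M :=
  if insub (val i) is Some j then widen_ord le_NM (s j) else i.

Lemma extend_fun_inj (s : 'S_N) : injective (extend_fun s).
Proof.
move=> i j; rewrite /extend_fun.
case: insubP => [i' _ vi|ni]; case: insubP => [j' _ vj|nj] //=.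
- move=> /(congr1 val) /= /val_inj /perm_inj ij.
  by apply: val_inj; rewrite -vi -vj ij.
- by move=> E; rewrite -E /= ltn_ord in nj.
- by move=> E; rewrite E /= ltn_ord in ni.
Qed.

Definition extend_perm (s : 'S_N) : 'S_M := perm (@extend_fun_inj s).

Lemma extend_permM : {morph extend_perm : s t / (s * t)%g}.
Proof.
move=> s t; apply/permP => i; rewrite permM !permE /extend_fun.
case: insubP => [j _ vj|ni] /=; last by rewrite insubN.
by rewrite insubT //= => lt; rewrite permM; congr (widen_ord _ (t _)); apply: val_inj.
Qed.

HB.instance Definition _ := isMultiplicative.Build 'S_N 'S_M extend_perm extend_permM.

Definition extend_hom (F : groupType) (rho : {multiplicative F -> 'S_N}) :
  {multiplicative F -> 'S_M} := extend_perm \o rho.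

End Extension.

Definition flexibly_stable (R : realType) (G : groupType) : Prop :=
  exists (Sigma : finType) (rels : seq (free_group Sigma))
         (p : {multiplicative free_group Sigma -> G}),
    is_presentation [set` rels] p /\
    forall eps : R, 0 < eps -> exists2 delta : R, 0 < delta &
      forall (N : nat) (rho : {multiplicative free_group Sigma -> 'S_N}),
        (0 < N)%N ->
        (forall r, r \in rels -> hamming R (rho r) 1%g < delta) ->
        exists (M : nat) (le_NM : (N <= M)%N)
               (rho' : {multiplicative free_group Sigma -> 'S_M}),
          [/\ M%:R <= (1 + eps) * N%:R,
              exists rhobar : {multiplicative G -> 'S_M}, rho' =1 rhobar \o p
            & hom_dist R (extend_hom le_NM rho) rho' < eps].

Section UnitInterval.
Variable R : realType.

Definition unit_interval : Type := set_type [set` `[0 : R, 1]].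

HB.instance Definition _ := Choice.on unit_interval.
HB.instance Definition _ := SubType.on unit_interval.
HB.instance Definition _ := Topological.on unit_interval.

Definition clamp (x : R) : R := Num.max 0 (Num.min x 1).

Lemma clamp_in x : clamp x \in [set` `[0 : R, 1]].
Proof.
by rewrite /clamp inE /= in_itv /= le_max lexx /= ge_max ler01 ge_min lexx orbT.
Qed.

Definition to_I (x : R) : unit_interval := exist _ (clamp x) (clamp_in x).

Lemma val_I_itv (s : unit_interval) : 0 <= val s <= 1.
Proof. by have := valP s; rewrite inE /= in_itv. Qed.

Lemma clamp_id x : 0 <= x <= 1 -> clamp x = x.
Proof. by move=> /andP[x0 x1]; rewrite /clamp min_l // max_r. Qed.

Lemma clamp0 : clamp 0 = 0.
Proof. by rewrite clamp_id // lexx ler01. Qed.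

Lemma clamp1 : clamp 1 = 1.
Proof. by rewrite clamp_id // lexx ler01. Qed.

Lemma to_I_continuous : continuous to_I.
Proof.
apply: continuous_comp_initial => x.
have -> : set_val \o to_I = (cst 0 : R -> R^o) \max (id \min cst 1) by [].
apply: continuous_max; first exact: cvg_cst.
by apply: continuous_min; [exact: cvg_id|exact: cvg_cst].
Qed.

Lemma val_I_continuous : continuous (val : unit_interval -> R).
Proof. exact: initial_continuous. Qed.

Fact zero_I_neq : to_I 0 != to_I 1.
Proof.
apply/eqP => /(congr1 val) /=; rewrite !clamp_id; lra.
Qed.

HB.instance Definition _ := isBiPointed.Build unit_interval zero_I_neq.

Lemma val_zero : val (zero : unit_interval) = 0.
Proof. by rewrite /= clamp_id //; lra. Qed.

Lemma val_one : val (one : unit_interval) = 1.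
Proof. by rewrite /= clamp_id //; lra. Qed.

Lemma to_I_val (s : unit_interval) : to_I (val s) = s.
Proof. by apply: val_inj; rewrite /= clamp_id // val_I_itv. Qed.

End UnitInterval.

Lemma continuous_if_le (R : realType) (T X : topologicalType) (k : T -> R)
    (F G : T -> X) :
  continuous k -> continuous F -> continuous G ->
  (forall x, k x = 2^-1 -> F x = G x) ->
  continuous (fun x => if k x <= 2^-1 then F x else G x).
Proof.
move=> kc Fc Gc FG x A /=.
set E := (fun y => _); rewrite -[X in X -> _]/(nbhs (E x) A).
rewrite -[X in _ -> X]/(nbhs x (E @^-1` A)) /E.
have [kx|kx|kx] := ltgtP (k x) 2^-1 => nA.
- have kn : nbhs x (k @^-1` [set r | r < 2^-1]).
    exact: kc x _ (open_nbhs_nbhs (conj (@open_lt R 2^-1) kx)).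
  have Fn : nbhs x (F @^-1` A) := Fc x _ nA.
  by apply: filterS (filterI kn Fn) => y /= [/ltW ->].
- have kn : nbhs x (k @^-1` [set r | 2^-1 < r]).
    exact: kc x _ (open_nbhs_nbhs (conj (@open_gt R 2^-1) kx)).
  have Gn : nbhs x (G @^-1` A) := Gc x _ nA.
  apply: filterS (filterI kn Gn) => y /= [+ ?].
  by rewrite ltNge => /negPf ->.
have Fn : nbhs x (F @^-1` A) := Fc x _ nA.
rewrite FG // in nA; have Gn : nbhs x (G @^-1` A) := Gc x _ nA.
by apply: filterS (filterI Fn Gn) => y /= [? ?]; case: ifP.
Qed.

Section FundamentalGroup.
Variables (R : realType) (X : topologicalType) (x0 : X).
Local Notation I := (unit_interval R).

Definition loop : Type := {path I from x0 to x0}.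

HB.instance Definition _ := Choice.on loop.

Definition loop_homotopic (f g : loop) : Prop :=
  exists H : I * I -> X,
    [/\ continuous H,
        forall s, H (s, zero) = f s, forall s, H (s, one) = g s,
        forall t, H (zero, t) = x0 & forall t, H (one, t) = x0].

Definition cst_loop : loop := cst x0.

Definition cat_fun (f g : loop) (s : I) : X :=
  if val s <= 2^-1 then f (to_I (2 * val s)) else g (to_I (2 * val s - 1)).

Definition rev_fun (f : loop) (s : I) : X := f (to_I (1 - val s)).

Lemma to_I_comp_continuous (T : topologicalType) (k : T -> R) :
  continuous k -> continuous (fun x => to_I (k x)).
Proof.
by move=> kc x; apply: continuous_comp; [exact: kc|exact: to_I_continuous].
Qed.

Lemma loop_continuous (f : loop) : continuous f.
Proof. exact: cts_fun. Qed.

Lemma comp_continuous (T U V : topologicalType) (f : U -> V) (g : T -> U) :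
  continuous f -> continuous g -> continuous (fun x => f (g x)).
Proof. by move=> fc gc x; apply: continuous_comp; [exact: gc|exact: fc]. Qed.

Lemma affine_continuous (T : topologicalType) (k : T -> R) (a b : R) :
  continuous k -> continuous (fun x => a * k x + b).
Proof.
move=> kc x; apply: cvgD; last exact: cvg_cst.
by apply: cvgM; [exact: cvg_cst|exact: kc].
Qed.

Lemma scale_continuous (T : topologicalType) (k : T -> R) (a : R) :
  continuous k -> continuous (fun x => a * k x).
Proof. by move=> kc x; apply: cvgM; [exact: cvg_cst|exact: kc]. Qed.

Lemma opp1_continuous (T : topologicalType) (k : T -> R) :
  continuous k -> continuous (fun x => 1 - k x).
Proof. by move=> kc x; apply: cvgB; [exact: cvg_cst|exact: kc]. Qed.

Lemma snd_val_continuous : continuous (fun st : I * I => val st.2).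
Proof. by apply: (comp_continuous (@val_I_continuous R)) => ?; exact: cvg_snd. Qed.

Lemma fst_val_continuous : continuous (fun st : I * I => val st.1).
Proof. by apply: (comp_continuous (@val_I_continuous R)) => ?; exact: cvg_fst. Qed.

Lemma pair_continuous (T U V : topologicalType) (f : T -> U) (g : T -> V) :
  continuous f -> continuous g -> continuous (fun x => (f x, g x)).
Proof. by move=> fc gc x; apply: cvg_pair; [exact: fc|exact: gc]. Qed.

Lemma fst_continuous : continuous (fst : I * I -> I).
Proof. by move=> ?; exact: cvg_fst. Qed.

Lemma snd_continuous : continuous (snd : I * I -> I).
Proof. by move=> ?; exact: cvg_snd. Qed.

Lemma maxr_continuous (T : topologicalType) (f g : T -> R) :
  continuous f -> continuous g -> continuous (fun x => Num.max (f x) (g x)).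
Proof. by move=> fc gc x; exact: (@continuous_max R T f g x (fc x) (gc x)). Qed.

Lemma minr_continuous (T : topologicalType) (f g : T -> R) :
  continuous f -> continuous g -> continuous (fun x => Num.min (f x) (g x)).
Proof. by move=> fc gc x; exact: (@continuous_min R T f g x (fc x) (gc x)). Qed.

Lemma to_I0 x : x <= 0 -> to_I x = zero :> I.
Proof.
move=> xle0; apply: val_inj; rewrite /= (@clamp_id _ 0) ?lexx ?ler01 //.
by rewrite /clamp max_l // ge_min xle0.
Qed.

Lemma to_I1 x : 1 <= x -> to_I x = one :> I.
Proof.
move=> x1; apply: val_inj; rewrite /= (@clamp_id _ 1) ?lexx ?ler01 //.
by rewrite /clamp min_r // max_r.
Qed.

Lemma cat_fun_continuous f g : continuous (cat_fun f g).
Proof.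
apply: continuous_if_le; first exact: val_I_continuous.
- apply: comp_continuous; first exact: loop_continuous.
  apply: to_I_comp_continuous; apply: scale_continuous.
  exact: val_I_continuous.
- apply: comp_continuous; first exact: loop_continuous.
  by apply: to_I_comp_continuous; apply: affine_continuous; exact: val_I_continuous.
- by move=> s ->; rewrite to_I1 ?to_I0 ?path_one ?path_zero //; lra.
Qed.

Lemma cat_fun0 f g : cat_fun f g zero = x0.
Proof. by rewrite /cat_fun val_zero ifT ?to_I0 ?path_zero //; lra. Qed.

Lemma cat_fun1 f g : cat_fun f g one = x0.
Proof. by rewrite /cat_fun val_one ifF ?to_I1 ?path_one //; lra. Qed.

Definition cat_loop (f g : loop) : loop :=
  mk_path (@cat_fun_continuous f g) (cat_fun0 f g) (cat_fun1 f g).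

Lemma cat_loopE f g s : cat_loop f g s =
  if val s <= 2^-1 then f (to_I (2 * val s)) else g (to_I (2 * val s - 1)).
Proof. by []. Qed.

Lemma rev_fun_continuous f : continuous (rev_fun f).
Proof.
apply: comp_continuous; first exact: loop_continuous.
apply: to_I_comp_continuous; apply: opp1_continuous.
exact: val_I_continuous.
Qed.

Lemma rev_fun0 f : rev_fun f zero = x0.
Proof. by rewrite /rev_fun val_zero to_I1 ?path_one //; lra. Qed.

Lemma rev_fun1 f : rev_fun f one = x0.
Proof. by rewrite /rev_fun val_one to_I0 ?path_zero //; lra. Qed.

Definition rev_loop (f : loop) : loop :=
  mk_path (@rev_fun_continuous f) (rev_fun0 f) (rev_fun1 f).

Lemma rev_loopE f s : rev_loop f s = f (to_I (1 - val s)).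
Proof. by []. Qed.

Lemma loop_homotopic_refl f : loop_homotopic f f.
Proof.
exists (fun st => f st.1); split => //= [|t|t]; rewrite ?path_zero ?path_one //.
by apply: comp_continuous; [exact: loop_continuous|move=> ?; exact: cvg_fst].
Qed.

Lemma loop_homotopic_sym f g : loop_homotopic f g -> loop_homotopic g f.
Proof.
move=> [H [Hc Hf Hg H0 H1]].
exists (fun st => H (st.1, to_I (1 - val st.2))); split => //= [|s|s].
- apply: comp_continuous => //; apply: pair_continuous; first exact: fst_continuous.
  apply: (@to_I_comp_continuous _ (fun st : I * I => 1 - val st.2)).
  exact/opp1_continuous/snd_val_continuous.
- by rewrite ?val_zero ?clamp0 to_I1 ?Hg //; lra.
- by rewrite ?val_one ?clamp1 to_I0 ?Hf //; lra.
Qed.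

Lemma loop_homotopic_trans f g h :
  loop_homotopic f g -> loop_homotopic g h -> loop_homotopic f h.
Proof.
move=> [H [Hc Hf Hg H0 H1]] [K [Kc Kg Kh K0 K1]].
exists (fun st => if val st.2 <= 2^-1 then H (st.1, to_I (2 * val st.2))
                  else K (st.1, to_I (2 * val st.2 - 1))).
split => /= [|s|s|t|t]; rewrite ?H0 ?K0 ?H1 ?K1 ?if_same //.
- apply: continuous_if_le; first exact: snd_val_continuous.
  + apply: comp_continuous => //; apply: pair_continuous; first exact: fst_continuous.
    apply: (@to_I_comp_continuous _ (fun st : I * I => 2 * val st.2)).
    exact/scale_continuous/snd_val_continuous.
  + apply: comp_continuous => //; apply: pair_continuous; first exact: fst_continuous.
    apply: (@to_I_comp_continuous _ (fun st : I * I => 2 * val st.2 - 1)).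
    exact/affine_continuous/snd_val_continuous.
  + by move=> st ->; rewrite to_I1 ?to_I0 ?Hg ?Kg //; lra.
- by rewrite ?val_zero ?clamp0 ifT ?to_I0 ?Hf //; lra.
- by rewrite ?val_one ?clamp1 ifF ?to_I1 ?Kh //; lra.
Qed.

Lemma reparam_homotopic (f g : loop) (p : I -> X) (phi psi : I -> R) :
  continuous p -> continuous phi -> continuous psi ->
  phi zero = psi zero -> phi one = psi one ->
  (forall s, f s = p (to_I (phi s))) -> (forall s, g s = p (to_I (psi s))) ->
  loop_homotopic f g.
Proof.
move=> pc phic psic e0 e1 fE gE.
exists (fun st => p (to_I ((1 - val st.2) * phi st.1 + val st.2 * psi st.1))).
split => /= [|s|s|t|t].
- apply: comp_continuous => //; apply: to_I_comp_continuous => st.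
  have fsts : continuous (fst : I * I -> I) by move=> ?; exact: cvg_fst.
  apply: cvgD; apply: cvgM.
  + by apply: cvgB; [exact: cvg_cst|exact: snd_val_continuous].
  + exact: (comp_continuous phic fsts).
  + exact: snd_val_continuous.
  + exact: (comp_continuous psic fsts).
- by rewrite ?val_zero ?clamp0 fE subr0 mul1r mul0r addr0.
- by rewrite ?val_one ?clamp1 gE subrr mul1r mul0r add0r.
- by rewrite e0 -mulrDl subrK mul1r -gE path_zero.
- by rewrite e1 -mulrDl subrK mul1r -gE path_one.
Qed.

Lemma val_to_I (x : R) : 0 <= x <= 1 -> val (to_I x) = x.
Proof. by move=> ?; rewrite /= clamp_id. Qed.

Lemma cat_loopA f g h :
  loop_homotopic (cat_loop f (cat_loop g h)) (cat_loop (cat_loop f g) h).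
Proof.
pose phi (s : I) : R := Num.max (val s / 2) (Num.max (val s - 4^-1) (2 * val s - 1)).
apply: (@reparam_homotopic _ _ (cat_loop (cat_loop f g) h) phi val).
- exact: loop_continuous.
- move=> s.
  have c a b : {for s, continuous (fun s : I => a * val s + b)}.
    exact: affine_continuous (@val_I_continuous R) s.
  have -> : phi = ((fun s : I => 2^-1 * val s + 0) : I -> R^o) \max
      ((fun s : I => 1 * val s + - 4^-1) \max (fun s : I => 2 * val s + -1)).
    by apply/funext => r; rewrite /phi /= mul1r addr0 mulrC.
  by apply: continuous_max => //; apply: continuous_max.
- exact: val_I_continuous.
- by rewrite /phi val_zero mul0r !sub0r mulr0 sub0r; rewrite max_l // ge_max; lra.
- by rewrite /phi val_one; rewrite max_r // ?max_r; lra.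
- move=> s; have /andP[s0 s1] := val_I_itv s; rewrite !cat_loopE.
  have [s2|s2] := leP (val s) 2^-1.
    have -> : phi s = val s / 2 by rewrite /phi max_l // ge_max; lra.
    have -> : val (to_I (val s / 2)) = val s / 2.
      by apply: val_to_I; apply/andP; split; lra.
    have -> : 2 * (val s / 2) = val s by lra.
    by rewrite to_I_val ifT ?s2 //; lra.
  have -> : val (to_I (2 * val s - 1)) = 2 * val s - 1.
    by apply: val_to_I; apply/andP; split; lra.
  have [s3|s3] := leP (2 * val s - 1) 2^-1.
    have -> : phi s = val s - 4^-1 by rewrite /phi max_r ?max_l //; lra.
    have -> : val (to_I (val s - 4^-1)) = val s - 4^-1.
      by apply: val_to_I; apply/andP; split; lra.
    have -> : val (to_I (2 * (val s - 4^-1))) = 2 * (val s - 4^-1).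
      by apply: val_to_I; apply/andP; split; lra.
    rewrite ifT ?ifF; first (by congr (g (to_I _)); lra); last by lra.
    by apply/negbTE; rewrite -ltNge; lra.
  have -> : phi s = 2 * val s - 1.
    by rewrite /phi [X in Num.max _ X]max_r ?max_r //; lra.
  have -> : val (to_I (2 * val s - 1)) = 2 * val s - 1.
    by apply: val_to_I; apply/andP; split; lra.
  by rewrite ifF //; apply/negbTE; rewrite -ltNge; lra.
- by move=> s; rewrite to_I_val.
Qed.

Lemma cat_loop1 f : loop_homotopic (cat_loop cst_loop f) f.
Proof.
pose phi (s : I) : R := Num.max 0 (2 * val s - 1).
apply: (@reparam_homotopic _ _ f phi val).
- exact: loop_continuous.
- apply: maxr_continuous; first exact: cst_continuous.
  exact: affine_continuous (@val_I_continuous R).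
- exact: val_I_continuous.
- by rewrite /phi val_zero max_l //; lra.
- by rewrite /phi val_one max_r //; lra.
- move=> s; rewrite cat_loopE /phi.
  have [s2|s2] := leP (val s) 2^-1; last by rewrite max_r //; lra.
  by rewrite max_l ?(@to_I0 0) ?path_zero //; lra.
- by move=> s; rewrite to_I_val.
Qed.

Lemma cat_loopr1 f : loop_homotopic (cat_loop f cst_loop) f.
Proof.
pose phi (s : I) : R := Num.min 1 (2 * val s).
apply: (@reparam_homotopic _ _ f phi val).
- exact: loop_continuous.
- apply: minr_continuous; first exact: cst_continuous.
  exact: scale_continuous (@val_I_continuous R).
- exact: val_I_continuous.
- by rewrite /phi val_zero min_r //; lra.
- by rewrite /phi val_one min_l //; lra.
- move=> s; rewrite cat_loopE /phi.
  have [s2|s2] := leP (val s) 2^-1; first by rewrite min_r //; lra.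
  by rewrite min_l ?(@to_I1 1) ?path_one //; lra.
- by move=> s; rewrite to_I_val.
Qed.

Lemma cat_loopV f : loop_homotopic (cat_loop (rev_loop f) f) cst_loop.
Proof.
pose phi (s : I) : R := Num.max (1 - 2 * val s) (2 * val s - 1).
apply: (@reparam_homotopic _ _ f phi (cst 1)).
- exact: loop_continuous.
- apply: maxr_continuous; last exact: affine_continuous (@val_I_continuous R).
  exact/opp1_continuous/scale_continuous/val_I_continuous.
- exact: cst_continuous.
- by rewrite /phi /cst val_zero max_l //; lra.
- by rewrite /phi /cst val_one max_r //; lra.
- move=> s; have /andP[s0 s1] := val_I_itv s; rewrite cat_loopE /phi.
  have [s2|s2] := leP (val s) 2^-1; last by rewrite max_r //; lra.
  by rewrite rev_loopE val_to_I ?max_l //; (lra || (apply/andP; split; lra)).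
- by move=> s; rewrite to_I1 ?path_one.
Qed.

Lemma cat_looprV f : loop_homotopic (cat_loop f (rev_loop f)) cst_loop.
Proof.
pose phi (s : I) : R := Num.min (2 * val s) (1 - (2 * val s - 1)).
apply: (@reparam_homotopic _ _ f phi (cst 0)).
- exact: loop_continuous.
- apply: minr_continuous; first exact: scale_continuous (@val_I_continuous R).
  exact/opp1_continuous/affine_continuous/val_I_continuous.
- exact: cst_continuous.
- by rewrite /phi /cst val_zero min_l //; lra.
- by rewrite /phi /cst val_one min_r //; lra.
- move=> s; have /andP[s0 s1] := val_I_itv s; rewrite cat_loopE /phi.
  have [s2|s2] := leP (val s) 2^-1; first by rewrite min_l //; lra.
  by rewrite rev_loopE val_to_I ?min_r //; (lra || (apply/andP; split; lra)).
- by move=> s; rewrite to_I0 ?path_zero.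
Qed.

Lemma cat_loop_homotopic f f' g g' : loop_homotopic f f' ->
  loop_homotopic g g' -> loop_homotopic (cat_loop f g) (cat_loop f' g').
Proof.
move=> [H [Hc Hf Hg H0 H1]] [K [Kc Kf Kg K0 K1]].
exists (fun st => if val st.1 <= 2^-1 then H (to_I (2 * val st.1), st.2)
                  else K (to_I (2 * val st.1 - 1), st.2)).
split=> [|s|s|t|t].
- apply: continuous_if_le; first exact: fst_val_continuous.
  + apply: comp_continuous => //; apply: pair_continuous; last exact: snd_continuous.
    apply: (@to_I_comp_continuous _ (fun st : I * I => 2 * val st.1)).
    exact/scale_continuous/fst_val_continuous.
  + apply: comp_continuous => //; apply: pair_continuous; last exact: snd_continuous.
    apply: (@to_I_comp_continuous _ (fun st : I * I => 2 * val st.1 - 1)).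
    exact/affine_continuous/fst_val_continuous.
  + by move=> st ->; rewrite to_I1 ?to_I0 ?H1 ?K0 //; lra.
- by rewrite cat_loopE Hf Kf.
- by rewrite cat_loopE Hg Kg.
- by rewrite val_zero ifT ?to_I0 ?H0 //; lra.
- by rewrite val_one ifF ?to_I1 ?K1 //; lra.
Qed.

Lemma rev_loop_homotopic f f' :
  loop_homotopic f f' -> loop_homotopic (rev_loop f) (rev_loop f').
Proof.
move=> [H [Hc Hf Hg H0 H1]].
exists (fun st => H (to_I (1 - val st.1), st.2)).
split=> [|s|s|t|t].
- apply: comp_continuous => //; apply: pair_continuous; last exact: snd_continuous.
  apply: (@to_I_comp_continuous _ (fun st : I * I => 1 - val st.1)).
  exact/opp1_continuous/fst_val_continuous.
- by rewrite rev_loopE Hf.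
- by rewrite rev_loopE Hg.
- by rewrite /= ?clamp0 to_I1 ?H1 //; lra.
- by rewrite /= ?clamp1 to_I0 ?H0 //; lra.
Qed.

Definition homotopicb (f g : loop) : bool := `[< loop_homotopic f g >].

Lemma homotopicb_refl : reflexive homotopicb.
Proof. by move=> f; apply/asboolP; exact: loop_homotopic_refl. Qed.

Lemma homotopicb_sym : symmetric homotopicb.
Proof.
by move=> f g; apply/asboolP/asboolP; exact: loop_homotopic_sym.
Qed.

Lemma homotopicb_trans : transitive homotopicb.
Proof.
move=> g f h /asboolP fg /asboolP gh; apply/asboolP.
exact: loop_homotopic_trans fg gh.
Qed.

Definition loop_homotopy : equiv_rel loop :=
  EquivRel homotopicb homotopicb_refl homotopicb_sym homotopicb_trans.

Definition pi1 : Type := {eq_quot loop_homotopy}.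

HB.instance Definition _ := Choice.on pi1.
HB.instance Definition _ := EqQuotient.on pi1.

Definition pi1_one : pi1 := \pi_pi1 cst_loop.
Definition pi1_mul (a b : pi1) : pi1 := \pi_pi1 (cat_loop (repr a) (repr b)).
Definition pi1_inv (a : pi1) : pi1 := \pi_pi1 (rev_loop (repr a)).

Lemma eq_pi1 f g : \pi_pi1 f = \pi_pi1 g <-> loop_homotopic f g.
Proof.
split=> [/eqmodP /asboolP //|fg].
by apply/eqmodP/asboolP.
Qed.

Lemma repr_pi1 f : loop_homotopic (repr (\pi_pi1 f)) f.
Proof. by apply/eq_pi1; rewrite reprK. Qed.

Lemma pi1_mulE f g :
  pi1_mul (\pi_pi1 f) (\pi_pi1 g) = \pi_pi1 (cat_loop f g).
Proof. by apply/eq_pi1/cat_loop_homotopic; exact: repr_pi1. Qed.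

Lemma pi1_invE f : pi1_inv (\pi_pi1 f) = \pi_pi1 (rev_loop f).
Proof. by apply/eq_pi1/rev_loop_homotopic; exact: repr_pi1. Qed.

Lemma pi1_mulA : associative pi1_mul.
Proof.
elim/quotW=> a; elim/quotW=> b; elim/quotW=> c.
rewrite (pi1_mulE b c) (pi1_mulE a b) !pi1_mulE.
apply/eq_pi1; exact: cat_loopA.
Qed.

Lemma pi1_mul1 : left_id pi1_one pi1_mul.
Proof.
by elim/quotW=> a; rewrite pi1_mulE; apply/eq_pi1; exact: cat_loop1.
Qed.

Lemma pi1_mulr1 : right_id pi1_one pi1_mul.
Proof.
by elim/quotW=> a; rewrite pi1_mulE; apply/eq_pi1; exact: cat_loopr1.
Qed.

Lemma pi1_mulV : left_inverse pi1_one pi1_inv pi1_mul.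
Proof.
by elim/quotW=> a; rewrite pi1_invE pi1_mulE; apply/eq_pi1; exact: cat_loopV.
Qed.

Lemma pi1_mulrV : right_inverse pi1_one pi1_inv pi1_mul.
Proof.
by elim/quotW=> a; rewrite pi1_invE pi1_mulE; apply/eq_pi1; exact: cat_looprV.
Qed.

HB.instance Definition _ :=
  isGroup.Build pi1 pi1_mulA pi1_mul1 pi1_mulr1 pi1_mulV pi1_mulrV.

End FundamentalGroup.

Definition homeomorphic (S T : topologicalType) : Prop :=
  exists (f : S -> T) (h : T -> S),
    [/\ continuous f, continuous h, cancel f h & cancel h f].

(* The closed orientable surface of genus g is the quotient of a 4g-gon whose
   sides are identified in pairs according to the boundary word
   a_0 b_0 a_0^-1 b_0^-1 ... a_(g-1) b_(g-1) a_(g-1)^-1 b_(g-1)^-1,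
   equivalently the connected sum of g tori. The 4g-gon is the closed unit
   disk: [boundary_point g t], for t between k and k + 1, runs through its
   k-th side (k < 4g). This is only meaningful for g >= 1. *)
Section Surface.
Variables (R : realType) (g : nat).

Definition disk : Type := set_type [set z : R * R | z.1 ^+ 2 + z.2 ^+ 2 <= 1].

HB.instance Definition _ := Choice.on disk.
HB.instance Definition _ := SubType.on disk.
HB.instance Definition _ := Topological.on disk.

Definition angle (t : R) : R := 2 * pi * t / (4 * g)%N%:R.

Fact boundary_point_subproof (t : R) : (cos (angle t), sin (angle t)) \in
  [set z : R * R | z.1 ^+ 2 + z.2 ^+ 2 <= 1].
Proof. by rewrite inE /= cos2Dsin2. Qed.

Definition boundary_point (t : R) : disk :=
  exist _ (cos (angle t), sin (angle t)) (boundary_point_subproof t).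

Definition side_pairing (z w : disk) : Prop :=
  exists (i : nat) (s : R), [/\ (i < g)%N, 0 <= s <= 1 &
    (z = boundary_point ((4 * i)%N%:R + s) /\
     w = boundary_point ((4 * i)%N%:R + 3 - s)) \/
    (z = boundary_point ((4 * i)%N%:R + 1 + s) /\
     w = boundary_point ((4 * i)%N%:R + 4 - s))].

Definition gluedb (z w : disk) : bool :=
  `[< clos_refl_sym_trans disk side_pairing z w >].

Lemma gluedb_refl : reflexive gluedb.
Proof. by move=> z; apply/asboolP; exact: rst_refl. Qed.

Lemma gluedb_sym : symmetric gluedb.
Proof. by move=> z w; apply/asboolP/asboolP => ?; exact: rst_sym. Qed.

Lemma gluedb_trans : transitive gluedb.
Proof.
move=> w z v /asboolP zw /asboolP wv; apply/asboolP.
exact: rst_trans zw wv.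
Qed.

Definition side_gluing : equiv_rel disk :=
  EquivRel gluedb gluedb_refl gluedb_sym gluedb_trans.

Definition genus_surface : topologicalType :=
  quotient_topology {eq_quot side_gluing}.

Definition is_closed_orientable_surface (S : topologicalType) : Prop :=
  homeomorphic S genus_surface.

End Surface.

(* Main.v *)
(* Presentation. The polygon gives a homomorphism from the free group to pi_1(S)
   that kills the relator. It is onto: a loop is a product of pieces contained in
   a chart, and the charts contract to the centre of the polygon, the midpoint of
   a side or the vertex. Conversely, elements a_i, b_i of a group H that satisfy
   the relation give an H-valued cocycle on S, constant near each point, and the
   holonomy of this cocycle is a homomorphism from pi_1(S) to H sending the
   generators to a_i, b_i. With H the quotient of the free group by the normal
   closure of the relator, this shows that there are no other relations.

   Stability. Permutations a_i, b_i of N points define a complex with a 4g-gon at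
   each point, whose corners are the pairs (x, k) of a point x and a position k in
   the relator. A corner is bad when the 4g turns around its vertex do not lead
   back to it; there are m = 4g * #{x | relator x <> x} bad corners. Cut the
   complex along edges containing the bad corners such that every cut corner
   meets another cut within 4g - 2 turns: when the cuts are extended from the
   defective corners, these triple at each step unless a cut is met, so
   O(sqrt (m N)) cuts are enough. New points glued along the cuts in fans close
   the corners at all old points. The remaining partial action is completed on more
   new points: all handles but one are chosen arbitrarily, and the last one solves
   [a, b] = pi for an even permutation pi, a commutator by Ore's theorem. *)
From mathcomp Require Import all_boot all_fingroup.
From mathcomp Require Import zify.
Set Implicit Arguments.
Unset Strict Implicit.
Unset Printing Implicit Defensive.

(** * Cutting the polygonal complex *)

(** A vertex can be repaired only if each stretch of old polygons between two cuts leaves room for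
    at least two new ones: one behind each of the two cuts. A single cut, or two neighbouring cuts,
    at a regular vertex therefore has to be continued across the next edge, and this is what makes
    cuts long. Near a bad vertex nothing limits their length except that they must eventually meet.
    With [j] loose ends, about [log_3 (#|D| / j)] triplings exhaust all corners, so the last few
    loose ends are the expensive ones; the sum over [j] is nevertheless of order [sqrt (k * #|D|)]
    for [k] bad corners. A defect of proportion [eta ^+ 2] thus costs a proportion [eta] of changes,
    whence a quadratic [delta].

    Genus at least 2 enters twice: tripling needs three further directions at a vertex, non-adjacent
    to each other and to the incoming cut, hence 8 turns; and cancelling the defect of the last
    handle needs another handle, which is unconstrained on the points added last. The cancellation
    is possible because a commutator is even, and so are the other factors. *)

Section Cut.
Variables (D : finType) (n : nat) (th tau : D -> D).
Hypotheses (n8 : 8 <= n) (th_inj : injective th) (tauK : involutive tau).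

Definition bad : pred D := [pred d | iter n th d != d].

Definition tau_closed (H : {set D}) := forall d, d \in H -> tau d \in H.

(** The bounds on [j] make the two cuts non-adjacent around their vertex. On an orbit shorter than
    [n] both may be the same corner. *)
Definition two_cuts (H : {set D}) : pred D :=
  [pred e | [exists d in H, fconnect th e d &&
    [exists j : 'I_n, (2 <= j <= n - 2) && (iter j th d \in H)]]].

(** The loose ends of a cut. Bad corners are exempt: their whole orbits will be cut. *)
Definition deficient (H : {set D}) : {set D} :=
  [set e in H | ~~ bad e & ~~ two_cuts H e].

Lemma iter_th_inj j : injective (iter j th).
Proof. by elim: j => //= j IHj x y /th_inj /IHj. Qed.

Lemma two_cutsS (H K : {set D}) e : H \subset K -> two_cuts H e -> two_cuts K e.
Proof.
move=> sHK /existsP[d /andP[dH /andP[ed /existsP[j /andP[jn jH]]]]].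
apply/existsP; exists d; rewrite (subsetP sHK) // ed /=.
by apply/existsP; exists j; rewrite jn (subsetP sHK).
Qed.

Lemma two_cuts_connect (H : {set D}) e e' :
  fconnect th e e' -> two_cuts H e' -> two_cuts H e.
Proof.
move=> ee' /existsP[d /andP[dH /andP[ed jj]]].
by apply/existsP; exists d; rewrite dH (connect_trans ee' ed).
Qed.

Lemma two_cuts_intro (H : {set D}) d j e : d \in H -> 2 <= j <= n - 2 ->
  iter j th d \in H -> fconnect th e d -> two_cuts H e.
Proof.
move=> dH jn jH ed; apply/existsP; exists d; rewrite dH ed /=.
have ltj : j < n by lia.
by apply/existsP; exists (Ordinal ltj); rewrite jn jH.
Qed.

Lemma connect_iter_th j d : fconnect th (iter j th d) d.
Proof. by rewrite fconnect_sym // fconnect_iter. Qed.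

Lemma bad_th d : bad (th d) = bad d.
Proof. by rewrite /bad /= -iterSr iterS (inj_eq th_inj). Qed.

Section Step.
Variable H : {set D}.
Hypothesis H_tau : tau_closed H.

(** Extensions of the loose ends. The turns 0, 2, 4, 6 differ pairwise by at least 2 and, as
    [8 <= n], by at most [n - 2], so a cut in any of these directions forms an admissible pair with
    the incoming one. *)
Fixpoint reached r : {set D} :=
  if r is r'.+1 then
    let T := reached r' in
    T :|: tau @: (iter 2 th @: T :|: iter 4 th @: T :|: iter 6 th @: T)
  else deficient H.

(** The three ways in which an extension can stop: at a bad vertex, at a vertex with two cuts, or at
    a vertex that extensions reach twice. *)
Definition collision (T : {set D}) := [exists d in T,
  [|| bad d, two_cuts H d |
      [exists j : 'I_n, (2 <= j <= n - 2) && (iter j th d \in T)]]].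

(* The directions 2, 4, 6 at [d] and at its neighbour [th d] are pairwise
   distinct, so without collision each step at least triples the set. *)
Lemma reached_triple r :
  ~~ collision (reached r) -> 3 * #|reached r| <= #|reached r.+1|.
Proof.
set T := reached r => noT.
have disj i j : i < j -> 2 <= j - i <= 4 -> 
    [disjoint iter i th @: T & iter j th @: T].
  move=> ij jin; rewrite -setI_eq0; apply: contraNT noT => /set0Pn[x].
  rewrite inE => /andP[/imsetP[d dT ->] /imsetP[e eT]].
  rewrite -(subnKC (ltnW ij)) iterD => /iter_th_inj de.
  apply/existsP; exists e; rewrite eT /=; apply/orP; right; apply/orP; right.
  have ltj : j - i < n by lia.
  by apply/existsP; exists (Ordinal ltj) => /=; rewrite -de dT andbT; lia.
have cardI i : #|iter i th @: T| = #|T| by rewrite card_imset //; exact: iter_th_inj.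
rewrite /= -/T; apply: leq_trans (subset_leq_card (subsetUr _ _)).
rewrite card_imset; last exact: inv_inj tauK.
rewrite cardsU (_ : (_ :|: _) :&: _ = set0) ?cards0 ?subn0; last first.
  by apply/eqP; rewrite setIUl setU_eq0 !setI_eq0 !disj.
rewrite cardsU (_ : _ :&: _ = set0) ?cards0 ?subn0 ?cardI; first lia.
by apply/eqP; rewrite setI_eq0 disj.
Qed.

(** [E] is a path of extra cuts from the loose end [e0] to [d]; all its corners are settled except
    possibly its end [d]. Each step spends two corners, the two sides of one edge. *)
Definition track r d (E : {set D}) :=
  [/\ tau_closed E, #|E| <= 2 * r, d \in H :|: E,
      forall e, e \in E -> e = d \/ two_cuts (H :|: E) e &
      exists2 e0, e0 \in deficient H & e0 = d \/ two_cuts (H :|: E) e0].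

Lemma track_mono r r' d E : r <= r' -> track r d E -> track r' d E.
Proof. by move=> rr' [? Er *]; split=> //; apply: leq_trans Er _; lia. Qed.

(** The cut at [d1] is the second one at the vertex of [d] and settles both [d] and [d1]; only the
    other side [d2] of the edge stays loose. *)
Lemma track_step r d E j : 2 <= j <= n - 2 -> track r d E ->
  exists E', track r.+1 (tau (iter j th d)) E'.
Proof.
move=> jn [Et Er dE Ev [e0 e0H e0v]]; set d1 := iter j th d; set d2 := tau d1.
exists (E :|: [set d1; d2]).
have sE : H :|: E \subset H :|: (E :|: [set d1; d2]) by rewrite setUA subsetUl.
have d1E : d1 \in H :|: (E :|: [set d1; d2]) by rewrite !inE eqxx !orbT.
have vd e : fconnect th e d -> two_cuts (H :|: (E :|: [set d1; d2])) e.
  by apply: two_cuts_intro jn d1E; rewrite (subsetP sE).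
have vs e : e = d \/ two_cuts (H :|: E) e ->
    two_cuts (H :|: (E :|: [set d1; d2])) e.
  by case=> [->|]; [exact/vd/connect0|exact: two_cutsS].
split.
- move=> e; rewrite !inE => /orP[/Et ->|/orP[]/eqP->] //; rewrite ?eqxx ?orbT //.
  by rewrite /d2 tauK eqxx orbT.
- apply: leq_trans (leq_card_setU _ _) _; rewrite cards2; lia.
- by rewrite !inE eqxx !orbT.
- move=> e; rewrite !inE => /orP[eE|/orP[]/eqP->]; [|right|by left].
    by right; apply/vs/Ev.
  exact/vd/connect_iter_th.
- by exists e0 => //; right; exact: vs.
Qed.

Lemma track_reached r : (forall r', r' < r -> ~~ collision (reached r')) ->
  forall d, d \in reached r -> exists E, track r d E.
Proof.
elim: r => [_ d dT|r IHr noc d].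
  exists set0; split=> //; rewrite ?cards0 ?setU0 //.
  - by move=> e; rewrite inE.
  - by move: dT; rewrite inE; case/andP.
  - by move=> e; rewrite inE.
  - by exists d => //; left.
have {}IHr := IHr (fun r' lt => noc r' (ltnW lt)).
rewrite /= !inE => /orP[/IHr[E trE]|].
  by exists E; exact: track_mono trE.
move=> /imsetP[e + ->]; rewrite !inE => /orP[/orP[]|] /imsetP[d' /IHr[E trE] ->];
  by apply: track_step trE; lia.
Qed.

Lemma deficient_decrease (E : {set D}) e0 :
  e0 \in deficient H -> two_cuts (H :|: E) e0 ->
  (forall e, e \in E -> bad e \/ two_cuts (H :|: E) e) ->
  #|deficient (H :|: E)| < #|deficient H|.
Proof.
move=> e0H e0E EE; apply: proper_card; apply/properP; split.
  apply/subsetP => e; rewrite inE => /andP[eHE /andP[nb ntc]].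
  rewrite inE nb (contra _ ntc) ?andbT; last exact/two_cutsS/subsetUl.
  move: eHE; rewrite inE => /orP[//|/EE[]]; first by rewrite (negPf nb).
  by rewrite (negPf ntc).
by exists e0 => //; rewrite inE e0E !andbF.
Qed.

(** Adding the track that ends at the collision, or both tracks that meet there, settles the origin
    [e0] and creates no loose end, since the collision takes care of the ends. Two tracks of at most
    [2 * r] corners give [4 * r]. *)
Lemma collision_repair r : (forall r', r' < r -> ~~ collision (reached r')) ->
  collision (reached r) ->
  exists K : {set D}, [/\ H \subset K, tau_closed K, #|K| <= #|H| + 4 * r
    & #|deficient K| < #|deficient H|].
Proof.
move=> noc /existsP[d /andP[dT cold]].
have [E [Et Er dE Ev [e0 e0H e0v]]] := track_reached noc dT.
have clU A B : tau_closed A -> tau_closed B -> tau_closed (A :|: B).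
  by move=> cA cB x; rewrite !inE => /orP[/cA|/cB] ->; rewrite ?orbT.
case/orP: cold => [bd|/orP[vd|/existsP[j /andP[jn jT]]]].
- exists (H :|: E); split; [exact: subsetUl|exact: clU| |].
    by apply: leq_trans (leq_card_setU _ _) _; lia.
  apply: (deficient_decrease e0H); last by move=> e /Ev[->|]; [left|right].
  by case: e0v => [e0d|//]; move: e0H; rewrite e0d inE bd andbF.
- exists (H :|: E); split; [exact: subsetUl|exact: clU| |].
    by apply: leq_trans (leq_card_setU _ _) _; lia.
  have vd' := two_cutsS (subsetUl H E) vd.
  by apply: (deficient_decrease e0H); [case: e0v => [->|]|
    move=> e /Ev[->|]; right].
have [E' [Et' Er' dE' Ev' _]] := track_reached noc jT.
exists (H :|: (E :|: E')).
have sE : H :|: E \subset H :|: (E :|: E') by rewrite setUA subsetUl.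
have sE' : H :|: E' \subset H :|: (E :|: E') by rewrite setUCA subsetUr.
have vd : two_cuts (H :|: (E :|: E')) d.
  apply: (@two_cuts_intro _ d j) => //; first by rewrite (subsetP sE).
  by rewrite (subsetP sE').
split; [exact: subsetUl|by apply: (clU) => //; exact: clU| |].
  apply: leq_trans (leq_card_setU _ _) _; rewrite leq_add2l.
  by apply: leq_trans (leq_card_setU _ _) _; lia.
apply: (deficient_decrease e0H).
  by case: e0v => [->//|]; exact: two_cutsS.
move=> e; rewrite inE => /orP[/Ev[->|ve]|/Ev'[->|ve]]; right=> //.
- exact: two_cutsS ve.
- exact: two_cuts_connect (connect_iter_th _ _) vd.
- exact: two_cutsS ve.
Qed.

(** [r] triplings would overfill [D], so some step before [r] collides. The earliest collision is
    repaired, because tracks are available only after collision-free steps. *)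
Lemma deficient_step r : #|D| < 3 ^ r * #|deficient H| ->
  exists K : {set D}, [/\ H \subset K, tau_closed K, #|K| <= #|H| + 4 * r
    & #|deficient K| < #|deficient H|].
Proof.
move=> ltr.
have [ex|nex] := boolP [exists i : 'I_r, collision (reached i)].
  have exr : exists i, (i < r) && collision (reached i).
    by case/existsP: ex => i ci; exists i; rewrite ltn_ord.
  case: (ex_minnP exr) => i /andP[ir ci] mini.
  have noc i' : i' < i -> ~~ collision (reached i').
    move=> i'i; apply/negP => c; have := mini i'.
    by rewrite c (ltn_trans i'i ir) leqNgt i'i => /(_ isT).
  have [K [? ? cK ?]] := collision_repair noc ci.
  by exists K; split=> //; apply: leq_trans cK _; lia.
suff : 3 ^ r * #|deficient H| <= #|reached r|.
  by move=> /(leq_trans ltr); rewrite ltnNge max_card.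
have noc i : i < r -> ~~ collision (reached i).
  by move=> ir; move: nex; rewrite negb_exists => /forallP /(_ (Ordinal ir)).
have: r <= r by [].
elim: {1 3 4}r => [|i IHi] ir; first by rewrite mul1n.
have := reached_triple (noc i ir); have := IHi (ltnW ir); rewrite expnS; lia.
Qed.

End Step.

(** Loose ends are removed one at a time; the summand [j] is the price of a removal while [j] of
    them are left. *)
Lemma deficient_elim k (H : {set D}) : tau_closed H -> #|deficient H| <= k ->
  exists K : {set D}, [/\ H \subset K, tau_closed K, deficient K = set0
    & #|K| <= #|H| + \sum_(1 <= j < k.+1) 4 * (trunc_log 3 (#|D| %/ j)).+1].
Proof.
elim: k H => [|k IHk] H Ht.
  by rewrite leqn0 cards_eq0 => /eqP ?; exists H; split=> //; rewrite big_nil addn0.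
rewrite leq_eqVlt => /orP[/eqP defk|]; last first.
  rewrite ltnS => /(IHk _ Ht)[K [? ? ? cK]]; exists K; split=> //.
  by rewrite big_nat_recr //= addnA (leq_trans cK) ?leq_addr.
have [|K [sHK Kt cK dK]] :=
    @deficient_step H Ht (trunc_log 3 (#|D| %/ k.+1)).+1.
  by rewrite defk -ltn_divLR // trunc_log_ltn.
have [|L [sKL Lt dL cL]] := IHk K Kt; first by move: dK; rewrite defk ltnS.
exists L; split=> //; first exact: subset_trans sKL.
rewrite big_nat_recr //= [_ + 4 * _]addnC addnA.
by apply: leq_trans cL _; rewrite leq_add2r.
Qed.

(** The orbit of a bad corner lies in [K], so one turn back suffices. Otherwise [d] is [i] turns
    after a cut [e] with partner [iter j th e]. If [0 < i <= n - 2], take [e]; for [i = 0] take the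
    partner, [n - j] turns back; for [i = n - 1] take the partner, [n - 1 - j] turns back. The two
    bounds on [j] are what the last two cases use. *)
Lemma deficient0_prev (K : {set D}) d : {subset bad <= K} -> deficient K = set0 ->
  d \in K -> exists2 j, 0 < j <= n - 2 & exists2 e, e \in K & d = iter j th e.
Proof.
move=> Kb K0 dK; have [bd|nbd] := boolP (bad d).
  have [e de] : exists e, d = th e.
    by exists (finv th d); rewrite f_finv.
  exists 1; first by lia.
  by exists e => //; apply: Kb; rewrite -topredE /= -bad_th -de.
have : two_cuts K d.
  by have := in_set0 d; rewrite -K0 inE dK nbd /= => /negbFE.
case/existsP => e /andP[eK /andP[de /existsP[j /andP[jn jK]]]].
have per : iter n th d = d by apply/eqP; rewrite -[_ == _]negbK.
have [i ltin di] : exists2 i, i < n & d = iter i th e.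
  have ed : fconnect th e d by rewrite fconnect_sym.
  have pe : iter n th e = e.
    move/iter_findex: ed per => <-; rewrite -!iterD addnC iterD.
    exact: iter_th_inj.
  have cyc m : iter m th e = iter (m %% n) th e.
    by rewrite {1}(divn_eq m n) addnC iterD; congr iter;
       elim: (m %/ n) => // q IHq; rewrite mulSn addnC iterD pe.
  exists (findex th e d %% n); first by rewrite ltn_mod; lia.
  by rewrite -cyc iter_findex.
have pe : iter n th e = e.
  by move: per; rewrite di -!iterD addnC iterD; exact: iter_th_inj.
have [i0|i0] := posnP i.
  exists (n - j); first by lia.
  exists (iter j th e) => //; rewrite -iterD subnK ?pe; last by lia.
  by rewrite di i0.
have [ile|igt] := leqP i (n - 2); first by exists i; [lia|exists e].
exists (n - 1 - j); first by lia.
exists (iter j th e) => //; rewrite -iterD di; congr iter; lia.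
Qed.

Definition cut_cost (m k : nat) := \sum_(1 <= j < k.+1) 4 * (trunc_log 3 (m %/ j)).+1.

Lemma cut_exists : exists K : {set D},
  [/\ {subset bad <= K}, tau_closed K, #|K| <= 2 * #|bad| + cut_cost #|D| #|bad|
    & forall d, d \in K ->
      exists2 j, 0 < j <= n - 2 & exists2 e, e \in K & d = iter j th e].
Proof.
(* Only corners of [tau @: B] can be loose at the start, so there are at most [#|bad|] of them. *)
pose B := [set d | bad d]; pose H := B :|: tau @: B.
have cB : #|B| = #|bad| by rewrite cardsE.
have ctB : #|tau @: B| = #|bad| by rewrite card_imset ?cB //; exact: inv_inj.
have Hb : {subset bad <= H} by move=> d bd; rewrite !inE; apply/orP; left.
have [| |K [sHK Kt K0 cK]] := @deficient_elim #|bad| H.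
- move=> d; rewrite inE => /orP[dB|/imsetP[e eB ->]].
    by rewrite inE imset_f ?orbT.
  by rewrite tauK inE eB.
- rewrite -ctB; apply: subset_leq_card; apply/subsetP => d.
  rewrite inE => /andP[+ /andP[nb _]]; rewrite inE => /orP[|//].
  by rewrite inE (negPf nb).
have Kb : {subset bad <= K} by move=> d /Hb; exact: (subsetP sHK).
exists K; split=> // [|d]; last exact: deficient0_prev.
apply: leq_trans cK _; rewrite leq_add2r.
by apply: leq_trans (leq_card_setU _ _) _; rewrite cB ctB; lia.
Qed.

End Cut.

(** * Attaching layers of polygons *)

Section Layer.
Variables (X P : finType) (n : nat) (nx bar : P -> P) (A : X -> P -> X).
Hypotheses (n1 : 1 < n) (nx_per : forall k, iter n nx k = k) (barK : involutive bar).
Hypotheses (sig1 : forall k, nx (bar k) != k)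
  (sig2 : forall k, nx (bar (nx (bar k))) != k)
  (sig3 : forall k, nx (bar (nx (bar (nx (bar k))))) != k).
Hypothesis AK : forall x k, A (A x k) (bar k) = x.

(** One turn leaves through side [k], enters the neighbour through its side [bar k], and goes on to
    [nx k]. Hence [nx (bar k)] is the side after [k] on the boundary of a polygon, and [sig1],
    [sig2], [sig3] say that any four consecutive sides are distinct. *)
Definition turn (d : X * P) : X * P := (A d.1 d.2, nx d.2).
Definition flip (d : X * P) : X * P := (A d.1 d.2, bar d.2).

Lemma flipK : involutive flip.
Proof. by case=> x k; rewrite /flip /= AK barK. Qed.

Lemma nx_inj : injective nx.
Proof.
have nE : n = n.-1.+1 by lia.
by move=> j k; move/(congr1 (iter n.-1 nx)); rewrite -!iterSr -nE !nx_per.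
Qed.

Lemma turn_inj : injective turn.
Proof.
case=> [x j] [y k] [] + /nx_inj jk; rewrite -{}jk => E.
by rewrite -[x](AK _ j) -[y](AK _ j) E.
Qed.

Lemma iter_turn_inj j : injective (iter j turn).
Proof. by elim: j => //= j IHj d e /turn_inj /IHj. Qed.

Lemma turn_iter2 i d : (iter i turn d).2 = iter i nx d.2.
Proof. by elim: i => //= i ->. Qed.

Lemma sigN1 j : nx j <> bar j.
Proof. by apply/eqP; have := sig1 (bar j); rewrite barK. Qed.

Lemma sigN2 j : nx (bar (nx j)) <> bar j.
Proof. by apply/eqP; have := sig2 (bar j); rewrite barK. Qed.

Lemma sigN3 j : nx (bar (nx (bar (nx j)))) <> bar j.
Proof. by apply/eqP; have := sig3 (bar j); rewrite barK. Qed.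

Section Partial.
Variables (T : Type) (edge : T -> P -> T -> bool).

(** A full vertex: the [n] polygons met around it, as an [n]-periodic sequence in which points may
    repeat. *)
Definition closed_corner (u : T) (k : P) := exists c : nat -> T,
  [/\ c 0 = u, forall i, c (i + n) = c i
    & forall i, edge (c i) (iter i nx k) (c i.+1)].

Lemma closed_corner_shift (c : nat -> T) k i :
  (forall i, c (i + n) = c i) -> (forall i, edge (c i) (iter i nx k) (c i.+1)) ->
  closed_corner (c i) (iter i nx k).
Proof.
move=> cp ce; exists (fun j => c (i + j)); split=> [|j|j].
- by rewrite addn0.
- by rewrite addnA cp.
- by rewrite -iterD addnS [j + i]addnC.
Qed.

Lemma closed_corner_mod (c : nat -> T) k :
  (forall i, i < n -> edge (c i) (iter i nx k) (c (i.+1 %% n))) ->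
  closed_corner (c 0) k /\ forall i, i < n -> closed_corner (c i) (iter i nx k).
Proof.
move=> ce; pose c' i := c (i %% n).
have n0 : 0 < n by lia.
have cp i : c' (i + n) = c' i by rewrite /c' modnDr.
have itm i : iter (i %% n) nx k = iter i nx k.
  by rewrite {2}(divn_eq i n) iterD; elim: (i %/ n) => // q IHq;
     rewrite mulSn iterD nx_per.
have ce' i : edge (c' i) (iter i nx k) (c' i.+1).
  have := ce _ (ltn_pmod i n0); rewrite itm /c'; congr (edge _ _ (c _)).
  by rewrite -[in LHS]addn1 modnDml addn1.
have cl i : i < n -> closed_corner (c i) (iter i nx k).
  by move=> ltin; have := closed_corner_shift i cp ce'; rewrite /c' modn_small.
by split=> //; exact: (cl 0).
Qed.

End Partial.

Variable H : {set X * P}.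
Hypothesis H_flip : forall d, d \in H -> flip d \in H.
Hypothesis H_reg : forall d, d \notin H -> iter n turn d = d.
Hypothesis H_prev : forall d, d \in H ->
  exists2 j, 0 < j <= n - 2 & exists2 e, e \in H & d = iter j turn e.

(** Number of turns back to the nearest earlier cut around the vertex of [d]; that cut is
    [prev d]. *)
Definition gap (d : X * P) : nat := find (fun j => (0 < j) &&
  [exists e in H, d == iter j turn e]) (iota 0 n).

Definition prev (d : X * P) : X * P :=
  if [pick e in H | d == iter (gap d) turn e] is Some e then e else d.

Lemma gapP d : d \in H -> [/\ 0 < gap d <= n - 2, prev d \in H,
  d = iter (gap d) turn (prev d) &
  forall i, 0 < i < gap d -> iter i turn (prev d) \notin H].
Proof.
move=> dH; have [j jn [e eH dE]] := H_prev dH.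
set a := fun j => (0 < j) && [exists e in H, d == iter j turn e].
have aj : a j.
  by rewrite /a (andP jn).1; apply/existsP; exists e; rewrite eH dE eqxx.
have gj : gap d <= j.
  rewrite leqNgt; apply/negP => /(before_find 0); rewrite nth_iota; last by lia.
  by rewrite add0n -/(a j) aj.
have hasa : has a (iota 0 n).
  by apply/hasP; exists j => //; rewrite mem_iota; lia.
have /andP[g0 /existsP[e1 /andP[e1H e1d]]] : a (gap d).
  have := nth_find 0 hasa; rewrite -/(gap d) nth_iota //.
  by have := hasa; rewrite has_find size_iota.
have [pH pE] : prev d \in H /\ d = iter (gap d) turn (prev d).
  rewrite /prev; case: pickP => [e2 /andP[? /eqP ?] //|/(_ e1)].
  by rewrite e1H e1d.
split=> //; first by rewrite g0; lia.
move=> i ig; apply/negP => iH.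
have lt : gap d - i < gap d by lia.
have := before_find 0 lt; rewrite nth_iota; last by lia.
rewrite add0n /= => /negbT /negP; apply; apply/andP; split; first by lia.
apply/existsP; exists (iter i turn (prev d)); rewrite iH /= -iterD subnK; last lia.
by rewrite -pE.
Qed.

(** Otherwise the nearer of the two cuts would lie strictly between the farther one and its nearest
    predecessor. *)
Lemma prev_inj d d' : d \in H -> d' \in H -> prev d = prev d' -> d = d'.
Proof.
move=> dH dH' pp; have [g1 _ e1 m1] := gapP dH; have [g2 _ e2 m2] := gapP dH'.
rewrite e1 e2 -pp; congr iter; case: (ltngtP (gap d) (gap d')) => // lt.
  have := m2 (gap d); rewrite -pp -e1 dH => F.
  by have : false by apply: F; lia.
have := m1 (gap d'); rewrite pp -e2 dH' => F.
by have : false by apply: F; lia.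
Qed.

(** Of the [n] places around the vertex between [prev d] and [d], [gap d] belong to old polygons and
    one to the first polygon of the fan at [flip (prev d)]; the fan of [d] gets the rest. *)
Definition fan_size d := n - gap d - 1.

Lemma fan_size_gt0 d : d \in H -> 0 < fan_size d.
Proof. by move=> /gapP[? _ _ _]; rewrite /fan_size; lia. Qed.

(** A block of [n] points per cut, whatever the size of its fan; points of index at least [fan_size]
    carry no edge and wait for the completion. *)
Definition layer : finType := ({d : X * P | d \in H} * 'I_n)%type.

(** The last alternative closes the vertex: the fan of [d] ends at the polygon glued behind the
    preceding cut. *)
Definition layer_base (u : X + layer) (k : P) (v : X + layer) : bool :=
  match u, v with
  | inl x, inl y => ((x, k) \notin H) && (y == A x k)
  | inl x, inr (d, i) => ((x, k) == val d) && (i == 0 :> nat)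
  | inr (d, i), inr (d', i') =>
      [&& i < fan_size (val d), k == iter i.+1 nx (val d).2
        & if i.+1 < fan_size (val d) then (d' == d) && (i' == i.+1 :> nat)
          else (val d' == flip (prev (val d))) && (i' == 0 :> nat)]
  | _, _ => false
  end.

Definition layer_edge u k v := layer_base u k v || layer_base v (bar k) u.

Lemma layer_edge_sym u k v : layer_edge u k v -> layer_edge v (bar k) u.
Proof. by rewrite /layer_edge barK orbC. Qed.

Lemma layer_edge_inl x k v : layer_edge (inl x) k v ->
  if v is inr di then (x, k) = val di.1 /\ di.2 = 0 :> nat
  else (x, k) \notin H /\ v = inl (A x k).
Proof.
rewrite /layer_edge; case: v => [y|[d i]] /=.
  case/orP => [/andP[nH /eqP ->]//|/andP[nH /eqP xE]].
  have yE : y = A x k by rewrite xE -{2}[k]barK AK.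
  split; last by rewrite yE.
  by apply: contra nH => /H_flip; rewrite /flip /= yE.
by rewrite orbF => /andP[/eqP -> /eqP].
Qed.

Lemma layer_edge_old x k : (x, k) \notin H -> layer_edge (inl x) k (inl (A x k)).
Proof. by move=> nH; rewrite /layer_edge /= nH eqxx. Qed.

Lemma layer_edge_turn d : d \notin H -> layer_edge (inl d.1) d.2 (inl (turn d).1).
Proof. by case: d => x k; exact: layer_edge_old. Qed.

(* The sides of a new polygon that are glued: the one towards the old polygon
   (for the first point of a fan) and those towards its neighbours in fans. *)
Lemma layer_edge_inr d i k v : layer_edge (inr (d, i)) k v ->
  [\/ [/\ i = 0 :> nat, k = bar (val d).2 & v = inl (val d).1],
      [/\ i < fan_size (val d), k = iter i.+1 nx (val d).2 &
        if v is inr (d', i') then 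
        if i.+1 < fan_size (val d) then d' = d /\ i' = i.+1 :> nat
        else val d' = flip (prev (val d)) /\ i' = 0 :> nat else False],
      [/\ 0 < i, i < fan_size (val d), k = bar (iter i nx (val d).2)
        & if v is inr (d', i') then d' = d /\ i = i'.+1 :> nat else False] |
      [/\ i = 0 :> nat, bar (nx (bar k)) = (val d).2 &
        if v is inr (d', i') then val d = flip (prev (val d'))
          /\ i'.+1 = fan_size (val d') else False]].
Proof.
rewrite /layer_edge; case: v => [y|[d' i']] /=.
  move=> /andP[/eqP dE /eqP i0]; apply: Or41; rewrite -dE /=.
  by rewrite barK.
case/orP => [/and3P[ilt /eqP kE vE]|/and3P[ilt /eqP kE vE]].
  apply: Or42; split=> //; case: ifP vE => _ /andP[/eqP ? /eqP ?]; by split.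
case: ifP vE => [lt /andP[/eqP dd /eqP ii]|nlt /andP[/eqP dd /eqP ii]].
  by apply: Or43; split; rewrite ?ii ?dd // iterS -kE barK.
have lenE : i'.+1 = fan_size (val d').
  by apply/eqP; rewrite eqn_leq ilt leqNgt nlt.
apply: Or44; split=> //.
have [gn pH dE _] := gapP (valP d').
have E2 : (val d').2 = iter (gap (val d')) nx (prev (val d')).2.
  by rewrite {1}dE turn_iter2.
rewrite kE -[nx (iter _ _ _)]iterS lenE dd /= E2 -iterD -iterS /fan_size.
have -> : (n - gap (val d') - 1 + gap (val d')).+1 = n by lia.
by rewrite nx_per.
Qed.

(** A new polygon has at most three glued sides, consecutive on its boundary, and [sig1], [sig2]
    keep these distinct. The fan that ends at a given first polygon is unique because [flip] and
    [prev] are injective on cuts. *)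
Lemma layer_edge_fun u k v w : layer_edge u k v -> layer_edge u k w -> v = w.
Proof.
have ordE (i j : 'I_n) : i = j :> nat -> i = j by exact: val_inj.
case: u => [x|[d i]].
  move=> /layer_edge_inl + /layer_edge_inl.
  case: v => [y|[d i]]; case: w => [z|[d' i']] /=.
  - by move=> [_ ->] [_ ->].
  - by move=> [/negP nH _] [xE _]; case: nH; rewrite xE; exact: valP.
  - by move=> [xE _] [/negP nH _]; case: nH; rewrite xE; exact: valP.
  - by move=> [xE iE] [xE' iE']; congr (inr (_, _)); [apply: val_inj; exact: etrans (esym xE) xE'|
      apply: ordE; exact: etrans iE (esym iE')].
move=> /layer_edge_inr + /layer_edge_inr.
case=> [[i0 kE vE]|[ilt kE vE]|[i0 ilt kE vE]|[i0 kE vE]];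
case=> [[j0 kE' vE']|[jlt kE' vE']|[j0 jlt kE' vE']|[j0 kE' vE']]; try lia.
- by rewrite vE vE'.
- by case: (sigN1 (j := (val d).2)); rewrite -kE kE' i0.
- by case: (sigN1 (j := (val d).2)); apply: (inv_inj barK); rewrite barK -[RHS]kE' kE barK.
- by case: (sigN1 (j := (val d).2)); rewrite -kE' kE j0.
- case: v vE => // -[d1 i1]; case: w vE' => // -[d2 i2].
  case: ifP => _ [E1 E2] [F1 F2]; congr (inr (_, _)).
  + by rewrite E1 F1.
  + by apply: ordE; rewrite E2 F2.
  + by apply: val_inj; rewrite E1 F1.
  + by apply: ordE; rewrite E2 F2.
- by case: (sigN1 (j := iter i nx (val d).2)); rewrite -kE' kE.
- case: (sigN2 (j := (val d).2)); apply: (inv_inj barK).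
  by rewrite barK -[RHS]kE' kE j0.
- by case: (sigN1 (j := iter i nx (val d).2)); rewrite -kE kE'.
- case: v vE => // -[d1 i1] [-> E]; case: w vE' => // -[d2 i2] [-> F].
  by congr (inr (_, _)); apply: ordE; move: E F => -> [].
- by case: (sigN1 (j := (val d).2)); apply: (inv_inj barK); rewrite barK -[RHS]kE kE' barK.
- case: (sigN2 (j := (val d).2)); apply: (inv_inj barK).
  by rewrite barK -[RHS]kE kE' i0.
- case: v vE => // -[d1 i1] [E1 E2]; case: w vE' => // -[d2 i2] [F1 F2].
  have dd : d1 = d2.
    apply: val_inj; apply: prev_inj; rewrite ?(valP d1) ?(valP d2) //.
    by apply: (inv_inj flipK); rewrite -E1 -F1.
  by congr (inr (_, _)) => //; apply: ordE; apply: succn_inj; rewrite E2 F2 dd.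
Qed.

(** The polygons around the vertex are, in order: the [g] old ones from [turn e] to [d], the fan of
    [d], and the first polygon of the fan at [flip e], which borders the polygon of [turn e]
    again. *)
Lemma run_closed (d : {d : X * P | d \in H}) (e := prev (val d)) (g := gap (val d)) :
  [/\ forall i, 0 < i <= g ->
        closed_corner layer_edge (inl (iter i turn e).1) (iter i turn e).2,
      forall i : 'I_n, i < fan_size (val d) ->
        closed_corner layer_edge (inr (d, i)) (iter i.+1 nx (val d).2) &
      forall (d' : {d : X * P | d \in H}) (i : 'I_n), val d' = flip e -> i = 0 :> nat ->
        closed_corner layer_edge (inr (d', i)) e.2].
Proof.
have [gn eH dE gmin] := gapP (valP d); rewrite -/e -/g in gn eH dE gmin.
have fE : fan_size (val d) = n - g - 1 by [].
have n0 : 0 < n by lia.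
pose d1 : {d : X * P | d \in H} := exist _ (flip e) (H_flip eH).
pose c i : X + layer := if i < g then inl (iter i.+1 turn e).1
  else if i < n.-1 then inr (d, insubd (Ordinal n0) (i - g))
  else inr (d1, Ordinal n0).
have ordv i (ltin : i < n) : val (insubd (Ordinal n0) i) = i by rewrite insubdK.
have [] := @closed_corner_mod _ layer_edge c (nx e.2).
  move=> i ltin; rewrite -iterSr.
  have [ig|gi] := ltnP i.+1 g.
    rewrite modn_small; last by lia.
    rewrite /c ig (ltnW ig) -turn_iter2.
    by apply: (@layer_edge_turn (iter i.+1 turn e)); apply: gmin; lia.
  have [ig|{}gi] := ltnP i g.
    have iE : i.+1 = g by lia.
    rewrite modn_small; last by lia.
    rewrite /c ig iE ltnn; have -> : g < n.-1 by lia.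
    rewrite -turn_iter2 -dE /layer_edge /= -surjective_pairing eqxx /= subnn.
    by rewrite insubdK.
  have kE : iter i.+1 nx e.2 = iter (i - g).+1 nx (val d).2.
    have -> : i.+1 = (i - g).+1 + g by lia.
    by rewrite iterD -[iter g nx _]turn_iter2 -dE.
  have [i1|i1] := ltnP i.+1 n.-1.
    rewrite modn_small; last by lia.
    rewrite /c; have -> : i < g = false by lia.
    have -> : i.+1 < g = false by lia.
    rewrite i1 (ltnW i1).
    rewrite /layer_edge /= !ordv; try lia.
    move: kE => /= ->; rewrite eqxx fE; have -> : i - g < n - g - 1 by lia.
    have -> : (i - g).+1 < n - g - 1 by lia.
    by rewrite eqxx /=; apply/orP; left; apply/eqP; lia.
  have [i2|i2] := ltnP i n.-1.
    have iE : i.+1 = n.-1 by lia.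
    rewrite modn_small; last by lia.
    rewrite /c; have -> : i < g = false by lia.
    rewrite i2 iE ltnn; have -> : n.-1 < g = false by lia.
    rewrite /layer_edge /= !ordv; try lia.
    rewrite -iE; move: kE => /= ->; rewrite eqxx fE; have -> : i - g < n - g - 1 by lia.
    have -> : (i - g).+1 < n - g - 1 = false by lia.
    by rewrite -/e !eqxx.
  have iE : i = n.-1 by lia.
  have -> : i.+1 = n by lia.
  rewrite modnn nx_per /c iE; have -> : n.-1 < g = false by lia.
  rewrite ltnn; have -> : 0 < g by lia.
  by rewrite /layer_edge /= /flip !eqxx.
move=> _ cl; split=> [i ig|i ilt|d' i dE' i0].
- have ltin : i.-1 < n by lia.
  have := cl _ ltin; rewrite /c; have -> : i.-1 < g by lia.
  by rewrite -iterSr -[iter _ nx e.2]turn_iter2 prednK //; case/andP: ig.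
- have ltin : g + i < n by lia.
  have := cl _ ltin; rewrite /c; have -> : g + i < g = false by lia.
  have -> : g + i < n.-1 by lia.
  have -> : insubd (Ordinal n0) (g + i - g) = i.
    by apply: val_inj; rewrite addKn ordv.
  by rewrite dE turn_iter2 -iterD -iterSr [g + i]addnC.
- have ltin : n.-1 < n by lia.
  have := cl _ ltin; rewrite /c; have -> : n.-1 < g = false by lia.
  rewrite ltnn -iterSr prednK // nx_per.
  have -> : d' = d1 by apply: val_inj.
  by have -> : i = Ordinal n0 by apply: val_inj.
Qed.

(** If the turns from [(x, k)] meet a cut, let [d] be the first one. Its predecessor lies strictly
    before [(x, k)], or it would have been met earlier; so [(x, k)] is an old corner of the run of
    [d]. If they meet none, the vertex is regular and untouched. *)
Lemma old_closed x k : closed_corner layer_edge (inl x) k.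
Proof.
have [ex|nex] := boolP [exists i : 'I_n, iter i turn (x, k) \in H].
  have exi : exists i, iter i turn (x, k) \in H by case/existsP: ex => i; exists i.
  case: (ex_minnP exi) => i iH imin.
  pose d : {d : X * P | d \in H} := exist (fun d => d \in H) _ iH.
  have [gn eH dE gmin] := gapP (valP d).
  have ig : i < gap (val d).
    rewrite ltnNge; apply/negP => gi.
    have := imin (i - gap (val d)); rewrite leqNgt.
    have -> : i - gap (val d) < i by lia.
    move=> F; have {F}/negP[] : iter (i - gap (val d)) turn (x, k) \notin H.
      by apply/negP => /F.
    suff -> : iter (i - gap (val d)) turn (x, k) = prev (val d) by case: (gapP (valP d)).
    have : iter (gap (val d)) turn (iter (i - gap (val d)) turn (x, k)) = 
       iter (gap (val d)) turn (prev (val d)).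
      by rewrite -iterD subnKC // -dE.
    exact: iter_turn_inj.
  have [cl _ _] := run_closed d.
  have xE : (x, k) = iter (gap (val d) - i) turn (prev (val d)).
    have : iter i turn (x, k) = iter i turn (iter (gap (val d) - i) turn (prev (val d))).
      by rewrite -iterD subnKC ?(ltnW ig) // -dE.
    exact: iter_turn_inj.
  have := cl (gap (val d) - i); rewrite -xE; apply.
  by case/andP: gn => g0 gn; lia.
have reg i : iter i turn (x, k) \notin H.
  have n0 : 0 < n by lia.
  have d0 : (x, k) \notin H.
    by move: nex; rewrite negb_exists => /forallP/(_ (Ordinal n0)).
  have := H_reg d0 => per.
  have -> : iter i turn (x, k) = iter (i %% n) turn (x, k).
    by rewrite {1}(divn_eq i n) addnC iterD; congr iter;
       elim: (i %/ n) => // q IHq; rewrite mulSn addnC iterD per.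
  by move: nex; rewrite negb_exists => /forallP/(_ (Ordinal (ltn_pmod i n0))).
exists (fun i => inl (iter i turn (x, k)).1); split=> // i.
  by rewrite iterD H_reg //; exact: (reg 0).
by rewrite -[k in iter i nx k]/((x, k).2) -turn_iter2; exact: layer_edge_turn (reg i).
Qed.

(** At a new polygon, two glued sides that are consecutive around a vertex belong to a run. The one
    entry outside the runs is through the last glued side; the side after it is not glued, since
    four consecutive sides are distinct. *)
Lemma layer_edge_closed u k v w : layer_edge u k v -> layer_edge v (nx k) w ->
  closed_corner layer_edge v (nx k).
Proof.
case: v => [x _ _|[d i]]; first exact: old_closed.
have [_ clm cll] := run_closed d.
move=> /layer_edge_sym /layer_edge_inr + /layer_edge_inr.
case=> [[i0 kE vE]|[ilt kE vE]|[i0 ilt kE vE]|[i0 kE vE]].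
- have {}kE : k = (val d).2 by apply: (inv_inj barK).
  by move=> _; have := clm i; rewrite i0 -kE; apply; apply: fan_size_gt0; exact: valP.
- have kE' : k = bar (iter i.+1 nx (val d).2) by rewrite -kE barK.
  case=> [[j0 lE _]|[jlt lE _]|[j0 jlt lE _]|[j0 lE _]].
  + by case: (sigN2 (j := (val d).2)); rewrite -lE kE' j0.
  + by case/eqP: (sig1 (iter i.+1 nx (val d).2)); rewrite -kE'.
  + by case: (sigN2 (j := iter i nx (val d).2)); rewrite -lE kE'.
  + case: (sigN3 (j := (val d).2)); apply: (inv_inj barK).
    by rewrite barK -[RHS]lE kE' j0.
- have {}kE : k = iter i nx (val d).2 by apply: (inv_inj barK).
  by move=> _; have := clm i; rewrite iterS -kE; apply.
- rewrite barK in kE; case: u vE => // -[d' i'] [dE iE] _.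
  have [_ _ cll'] := run_closed d'.
  have -> : nx k = (prev (val d')).2.
    by apply: (inv_inj barK); rewrite kE dE.
  exact: cll'.
Qed.

End Layer.

(** * Even permutations are commutators *)

Local Open Scope group_scope.

Definition comm (gT : groupType) (a b : gT) : gT := a * b * a^-1 * b^-1.

Lemma odd_comm (T : finType) (a b : {perm T}) : odd_perm (comm a b) = false.
Proof. by rewrite /comm !odd_permM !odd_permV -addbA addbC; case: (odd_perm a); case: (odd_perm b). Qed.

(** A partial injection, listed with possible repetitions by [u] and [v], extends to a permutation:
    each new value is corrected by a transposition that fixes the values already right. *)
Lemma matching_perm (I U : finType) (u v : I -> U) :
  (forall i j, u i = u j <-> v i = v j) -> exists s : {perm U}, forall i, s (u i) = v i.
Proof.
move=> uv; suff [s sP] : exists s : {perm U}, forall i, i \in enum I -> s (u i) = v i.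
  by exists s => i; apply: sP; rewrite mem_enum.
elim: (enum I) => [|i l [s sP]]; first by exists 1.
exists (s * tperm (s (u i)) (v i)) => j; rewrite inE permM => /predU1P[->|jl].
  exact: tpermL.
have [/uv ij|nij] := eqVneq (u i) (u j).
  by have /uv -> := ij; rewrite tpermL.
have sj := sP _ jl; rewrite tpermD ?sj //; first by rewrite -sj (inj_eq perm_inj).
by apply: contra_neq nij => vij; apply/uv.
Qed.

Section FullCycles.
Variable V : finType.
Implicit Types p q s c : {perm V}.

Lemma porbits_gt1 p : 1 < #|porbits p| -> exists x y, x \notin porbit p y.
Proof.
move=> /card_gt1P[A [B [/imsetP[x _ ->] /imsetP[y _ ->] AB]]].
by exists x, y; rewrite -eq_porbit_mem.
Qed.

Lemma porbits_gt2 p : 2 < #|porbits p| ->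
  exists x y z, [/\ x \notin porbit p y, z \notin porbit p x & z \notin porbit p y].
Proof.
move=> /card_gt2P[A [B [C [[/imsetP[x _ ->] /imsetP[y _ ->] /imsetP[z _ ->]] [AB BC CA]]]]].
by exists x, y, z; rewrite -!eq_porbit_mem; split=> //; rewrite eq_sym.
Qed.

Lemma porbit_le1 p x y : #|porbits p| <= 1 -> x \in porbit p y.
Proof.
move=> /card_le1_eqP le1; rewrite -eq_porbit_mem; apply/eqP.
by apply: le1; exact: imset_f.
Qed.

Lemma porbit_tperm p x y z : z \notin porbit p x -> z \notin porbit p y ->
  porbit (tperm x y * p) z = porbit p z.
Proof.
move=> zx zy; suff E n : ((tperm x y * p) ^+ n) z = (p ^+ n) z.
  by apply/setP => w; apply/porbitP/porbitP => -[n ->]; exists n; rewrite E.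
elim: n => [|n IHn]; first by rewrite !expg0.
rewrite !expgSr !permM IHn tpermD //.
  by apply: contraNneq zx => ->; rewrite porbit_sym mem_porbit.
by apply: contraNneq zy => ->; rewrite porbit_sym mem_porbit.
Qed.

(** A transposition merges the orbits of its two points if they differ, and splits their common
    orbit otherwise. Two points separated by both [p] and [q] give [t] at once. If there are none,
    [q] is a full cycle, and equal parity gives [p] at least three orbits: two transpositions then
    merge [p] twice, while [q] is split and merged again. *)
Lemma porbits_merge p q : odd_perm p = odd_perm q ->
  1 < #|porbits p| -> 
  exists t : {perm V}, #|porbits (t * p)| + #|porbits (t * q)| < #|porbits p| + #|porbits q|.
Proof.
move=> pq p1.
have merge (r : {perm V}) x y : x \notin porbit r y -> #|porbits (tperm x y * r)|.+1 = #|porbits r|.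
  move=> xy; have := porbits_mul_tperm r x y; rewrite /= xy.
  by have -> : x != y by [apply: contraNneq xy => ->; exact: porbit_id]; lia.
have split (r : {perm V}) x y : x != y -> x \in porbit r y ->
    #|porbits (tperm x y * r)| = #|porbits r|.+1.
  by move=> xy xry; have := porbits_mul_tperm r x y; rewrite /= xry xy; lia.
have [/existsP[x /existsP[y /andP[xp xq]]]|] :=
    boolP [exists x, exists y, (x \notin porbit p y) && (x \notin porbit q y)].
  by exists (tperm x y); have := merge _ _ _ xp; have := merge _ _ _ xq; lia.
rewrite negb_exists => /forallP nex.
have {nex}or x y : x \in porbit p y \/ x \in porbit q y.
  have := nex x; rewrite negb_exists => /forallP/(_ y); rewrite negb_and !negbK.
  by move/orP.
have tr (r : {perm V}) x y z : x \in porbit r y -> y \in porbit r z -> x \in porbit r z.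
  by rewrite -!eq_porbit_mem => /eqP ->.
have sy (r : {perm V}) x y : x \in porbit r y -> y \in porbit r x by rewrite porbit_sym.
have [x [y xy]] := porbits_gt1 p1.
have qxy : x \in porbit q y by case: (or x y) => //; rewrite (negPf xy).
(* Any [u] misses the [p]-orbit of [x] or that of [y], hence shares a [q]-orbit with one of them,
   and these two share theirs. *)
have q1 : #|porbits q| = 1%N.
  apply/eqP; rewrite eqn_leq; apply/andP; split; last first.
    by apply/card_gt0P; exists (porbit q x); exact: imset_f.
  rewrite leqNgt; apply/negP => /porbits_gt1[z [w /negP[]]].
  have toxy u : u \in porbit q x.
    case: (or u x) => // ux; apply: (tr _ _ _ _ _ (sy _ _ _ qxy)).
    by case: (or u y) => // uy; case/negP: xy; exact: tr (sy _ _ _ ux) uy.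
  by apply: tr (toxy z) _; apply/sy/toxy.
have p2 : 2 < #|porbits p|.
  move: pq; rewrite /odd_perm q1 => /addbI /= op.
  by rewrite ltn_neqAle p1 andbT; apply: contraTneq op => <-.
have [{xy qxy}x [{}y [z [xy zx zy]]]] := porbits_gt2 p2.
have nxy : x != y by apply: contraNneq xy => ->; exact: porbit_id.
have qin u v : u \in porbit q v by apply: porbit_le1; rewrite q1.
set q' := tperm x y * q.
have q'xy : x \notin porbit q' y.
  have := porbits_mul_tperm q' x y; rewrite /= /q' mulgA tperm2 mul1g split // nxy q1.
  by case: (_ \notin _).
(* [q'] separates [x] from [y], so [z] lies outside the [q']-orbit of at least one of them. *)
have [u [zu zq']] : exists u, z \notin porbit (tperm x y * p) u /\ z \notin porbit q' u.
  have zz u : z \notin porbit p u -> z \notin porbit (tperm x y * p) u.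
    by rewrite porbit_sym => zu; rewrite porbit_sym porbit_tperm.
  have [zx'|zx'] := boolP (z \in porbit q' x); last by exists x; rewrite zz.
  exists y; rewrite zz //; split=> //; apply: contra q'xy => zy'.
  by apply: tr zy'; exact: sy.
exists (tperm z u * tperm x y); rewrite -!mulgA -/q'.
have := merge _ _ _ zu; have := merge _ _ _ zq'; have := merge _ _ _ xy.
have := split q x y nxy (qin x y); rewrite -/q' => -> <- [->] <-.
by rewrite ltn_add2r ltnW.
Qed.

(** [c] and [c * s] have equal parity because [s] is even, and [porbits_merge] multiplies both on
    the left by the same [t]; the total number of orbits drops until both are full cycles. *)
Lemma full_cycles_exist s : ~~ odd_perm s ->
  exists c, #|porbits c| <= 1 /\ #|porbits (c * s)| <= 1.
Proof.
move=> ev; pose m c := #|porbits c| + #|porbits (c * s)|.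
have [n] := ubnP (m 1); elim: n (1 : {perm V}) => // n IHn c.
rewrite ltnS => mc.
have par : odd_perm c = odd_perm (c * s) by rewrite odd_permM (negPf ev) addbF.
have [p1|p1] := leqP #|porbits c| 1.
  have [q1|q1] := leqP #|porbits (c * s)| 1; first by exists c.
  have [t lt] := porbits_merge (esym par) q1.
  by apply: (IHn (t * c)); apply: leq_trans mc; rewrite /m -mulgA addnC [X in _ < X]addnC.
have [t lt] := porbits_merge par p1.
by apply: (IHn (t * c)); apply: leq_trans mc; rewrite /m -mulgA.
Qed.

Lemma full_cycles_conj c d : #|porbits c| <= 1 -> #|porbits d| <= 1 ->
  exists b : {perm V}, forall x, b (d x) = c (b x).
Proof.
move=> c1 d1; have [v0 _|V0] := pickP V; last by exists 1 => x; have := V0 x.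
have full p : #|porbits p| <= 1 -> #|porbit p v0| = #|V|.
  by move=> p1; apply: eq_card => x; rewrite porbit_le1.
have cyc p : #|porbits p| <= 1 -> iter #|V| p v0 = v0.
  by move=> p1; rewrite -{1}(full p p1) iter_porbit.
have inj p (i j : 'I_#|V|) : #|porbits p| <= 1 -> iter i p v0 = iter j p v0 -> i = j.
  move=> p1; have := uniq_traject_porbit p v0; rewrite full // => un.
  rewrite -!(nth_traject p (n := #|V|)) // => /eqP; rewrite nth_uniq ?size_traject //.
  by move/eqP/val_inj.
have [|b bE] := @matching_perm 'I_#|V| V (fun i => iter i d v0) (fun i => iter i c v0).
  by move=> i j; split=> /(inj _ _ _) ->.
exists b => x.
have /porbitP[m ->] := porbit_le1 x v0 d1.
have V0 : 0 < #|V| by apply/card_gt0P; exists v0.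
have dm : (d ^+ m) v0 = iter (m %% #|V|) d v0.
  rewrite permX {1}(divn_eq m #|V|) addnC iterD; congr iter.
  by elim: (m %/ _) => // q IHq; rewrite mulSn addnC iterD cyc.
have bI i : i < #|V| -> b (iter i d v0) = iter i c v0 by move=> lt; exact: (bE (Ordinal lt)).
have ltm := ltn_pmod m V0.
rewrite dm bI // -!iterS; case: (ltnP (m %% #|V|).+1 #|V|) => [/bI //|ge].
have -> : (m %% #|V|).+1 = #|V| by apply/eqP; rewrite eqn_leq ge ltm.
by rewrite !cyc // (bI 0).
Qed.

(* [comm a b = s] says that [b^-1] conjugates [a^-1] to [a^-1 * s]. *)
Lemma even_perm_comm s : ~~ odd_perm s -> exists a b, comm a b = s.
Proof.
move=> /full_cycles_exist[c [c1 cs1]].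
have [b bE] := full_cycles_conj c1 cs1.
exists c^-1, b; have E : c * s * b = b * c by apply/permP => x; rewrite !permM -bE !permM.
by rewrite /comm invgK -(mulgA c^-1) -E !mulgA mulVg mul1g mulgK.
Qed.

End FullCycles.

(** * Completing the handles *)

Section SumPerm.
Variables T V : finType.

Definition sum_fun (s : {perm T}) (t : {perm V}) (u : T + V) : T + V :=
  match u with inl x => inl (s x) | inr v => inr (t v) end.

Lemma sum_fun_inj s t : injective (sum_fun s t).
Proof. by case=> x [] y //= [] /perm_inj ->. Qed.

Definition sum_perm s t : {perm T + V} := perm (@sum_fun_inj s t).

Lemma sum_permE s t u : sum_perm s t u = sum_fun s t u.
Proof. exact: permE. Qed.

Lemma sum_permM s s' t t' : sum_perm (s * s') (t * t') = sum_perm s t * sum_perm s' t'.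
Proof. by apply/permP => -[x|v]; rewrite permM !sum_permE /= permM. Qed.

Lemma sum_perm1 : sum_perm 1 1 = 1.
Proof. by apply/permP => -[x|v]; rewrite sum_permE perm1 /= perm1. Qed.

Lemma sum_permV s t : (sum_perm s t)^-1 = sum_perm s^-1 t^-1.
Proof. by apply/eqP; rewrite eq_invg_mul -sum_permM !mulgV sum_perm1. Qed.

Lemma sum_perm_comm s s' t t' :
  comm (sum_perm s t) (sum_perm s' t') = sum_perm (comm s s') (comm t t').
Proof. by rewrite /comm !sum_permV -!sum_permM. Qed.

Lemma odd_sum_perm s t : odd_perm (sum_perm s t) = odd_perm s (+) odd_perm t.
Proof.
have -> : sum_perm s t = sum_perm s 1 * sum_perm 1 t by rewrite -sum_permM mul1g mulg1.
rewrite odd_permM; congr (_ (+) _).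
- have splitM r r' : sum_perm (r * r') 1 = sum_perm r 1 * sum_perm r' 1.
    by rewrite -sum_permM mulg1.
  have [ts -> _] := prod_tpermP s.
  elim: ts => [|[x y] ts IHts]; first by rewrite !big_nil sum_perm1 !odd_perm1.
  rewrite !big_cons splitM.
  rewrite !odd_permM IHts odd_tperm; congr (_ (+) _).
  have -> : sum_perm (tperm x y) 1 = tperm (inl x) (inl y).
    apply/permP => -[z|v]; rewrite sum_permE /= ?perm1; last by rewrite tpermD.
    case: (tpermP x y z) => [->|->|nx ny]; rewrite ?tpermL ?tpermR //.
    by rewrite tpermD //; apply/eqP => -[E]; [apply: nx|apply: ny].
  by rewrite odd_tperm.
- have splitM r r' : sum_perm 1 (r * r') = sum_perm 1 r * sum_perm 1 r'.
    by rewrite -sum_permM mulg1.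
  have [ts -> _] := prod_tpermP t.
  elim: ts => [|[x y] ts IHts]; first by rewrite !big_nil sum_perm1 !odd_perm1.
  rewrite !big_cons splitM !odd_permM IHts odd_tperm; congr (_ (+) _).
  have -> : sum_perm 1 (tperm x y) = tperm (inr x) (inr y).
    apply/permP => -[v|z]; rewrite sum_permE /= ?perm1; first by rewrite tpermD.
    case: (tpermP x y z) => [->|->|nx ny]; rewrite ?tpermL ?tpermR //.
    by rewrite tpermD //; apply/eqP => -[E]; [apply: nx|apply: ny].
  by rewrite odd_tperm.
Qed.

End SumPerm.

Section HandleFill.
Variables (T : finType) (al be : T -> option T) (c : {perm T}).
Hypotheses (al_inj : forall x y z, al x = Some z -> al y = Some z -> x = y)
  (be_inj : forall x y z, be x = Some z -> be y = Some z -> x = y).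
Hypotheses (al_be : forall x w z, al x = Some w -> be w = Some z ->
    exists2 q, be (c x) = Some q & al q = Some z)
  (be_al : forall x q z, be (c x) = Some q -> al q = Some z ->
    exists2 w, al x = Some w & be w = Some z).

(** Products act from left to right, so [comm a b = c] reads [a * b = c * b * a]. The hypotheses
    [al_be] and [be_al] say that one side is defined at [x] exactly when the other is, with the same
    value; the points of [broken] are those where neither is. *)
Definition broken : {set T} := [set x | obind be (al x) == None].

Definition fresh : finType := ({x | x \in broken} * 'I_3)%type.

Definition mk (x : T) (j : 'I_3) : T + fresh :=
  if insub x is Some e then inr (e, j) else inl x.

Lemma mk_inl x j z : x \in broken -> mk x j <> inl z.
Proof. by move=> xb; rewrite /mk insubT. Qed.

Lemma mk_inj x y i j : x \in broken -> y \in broken -> mk x i = mk y j -> x = y /\ i = j.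
Proof. by move=> xb yb; rewrite /mk !insubT => -[-> ->]. Qed.

Let tM : 'I_3 := @Ordinal 3 0 isT.
Let tP : 'I_3 := @Ordinal 3 1 isT.
Let tQ : 'I_3 := @Ordinal 3 2 isT.

(* Images of [x], of [c x] and of both under the words [a], [b] and [a b], [b a]
   respectively; points of [fresh] are used where these are undefined. *)
Definition ab_image (x : T) : T + fresh :=
  if obind be (al x) is Some z then inl z else mk x tM.

(** If [al x] is undefined but [x] is the [b]-image of [c x'], the value of [a] at [x] is forced to
    be that of [a b] at [x']; a point of its own is used only in the remaining case. The same holds
    for [b_image]. *)
Definition a_image (x : T) : T + fresh :=
  if al x is Some w then inl w
  else if [pick x' | be (c x') == Some x] is Some x' then mk x' tM else mk x tP.

Definition b_image (x : T) : T + fresh :=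
  if be (c x) is Some q then inl q
  else if [pick x' | al x' == Some (c x)] is Some x' then mk x' tM else mk x tQ.

Variant ab_spec x : T + fresh -> Prop :=
  | AbOld w q z of al x = Some w & be w = Some z & be (c x) = Some q & al q = Some z :
      ab_spec x (inl z)
  | AbNew of x \in broken & (forall w z, al x = Some w -> be w <> Some z) &
      (forall q z, be (c x) = Some q -> al q <> Some z) : ab_spec x (mk x tM).

Lemma ab_imageP x : ab_spec x (ab_image x).
Proof.
rewrite /ab_image; case E : obind => [z|].
  case E1 : (al x) E => [w|] //= E2.
  by have [q ? ?] := al_be E1 E2; apply: (AbOld (w := w) (q := q)).
apply: AbNew; first by rewrite inE E.
- by move=> w z E1 E2; rewrite E1 /= E2 in E.
- by move=> q z E1 E2; have [w E3 E4] := be_al E1 E2; rewrite E3 /= E4 in E.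
Qed.

Variant a_spec x : T + fresh -> Prop :=
  | AOld w of al x = Some w : a_spec x (inl w)
  | AMid x' of al x = None & be (c x') = Some x & x' \in broken : a_spec x (mk x' tM)
  | ANew of al x = None & (forall x', be (c x') <> Some x) & x \in broken :
      a_spec x (mk x tP).

Lemma a_imageP x : a_spec x (a_image x).
Proof.
rewrite /a_image; case E : (al x) => [w|]; first exact: AOld.
case: pickP => [x' /eqP E'|nE].
  apply: AMid => //; have := ab_imageP x'; case=> // w q z _ _.
  by rewrite E' => -[<-]; rewrite E.
by apply: ANew => // [x' /eqP|]; [rewrite nE|rewrite inE E].
Qed.

Variant b_spec x : T + fresh -> Prop :=
  | BOld q of be (c x) = Some q : b_spec x (inl q)
  | BMid x' of be (c x) = None & al x' = Some (c x) & x' \in broken : b_spec x (mk x' tM)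
  | BNew of be (c x) = None & (forall x', al x' <> Some (c x)) & x \in broken :
      b_spec x (mk x tQ).

Lemma b_imageP x : b_spec x (b_image x).
Proof.
rewrite /b_image; case E : (be (c x)) => [w|]; first exact: BOld.
case: pickP => [x' /eqP E'|nE].
  apply: BMid => //; have := ab_imageP x'; case=> // w q z.
  by rewrite E' => -[<-]; rewrite E.
apply: BNew => // [x' /eqP|]; first by rewrite nE.
by have := ab_imageP x; case=> // w q z _ _; rewrite E.
Qed.

Lemma ab_image_inj x y : ab_image x = ab_image y -> x = y.
Proof.
case: ab_imageP => [w q z E1 E2 _ _|xb _ _]; case: ab_imageP => [w' q' z' F1 F2 _ _|yb _ _].
- by case=> zz; apply: al_inj E1 _; rewrite F1; congr Some; apply: be_inj F2 _; rewrite -zz.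
- by move/esym/mk_inl.
- by move/mk_inl.
- by move/mk_inj => [].
Qed.

Lemma a_image_inj x y : a_image x = a_image y -> x = y.
Proof.
case: a_imageP => [w E|x' E E' x'b|E nE xb]; case: a_imageP => [w' F|y' F F' y'b|F nF yb].
- by case=> ww; apply: al_inj E _; rewrite ww.
- by move/esym/mk_inl.
- by move/esym/mk_inl.
- by move/mk_inl.
- by move/mk_inj => [] // xy _; move: E'; rewrite xy F' => -[].
- by move/mk_inj => [].
- by move/mk_inl.
- by move/mk_inj => [].
- by move/mk_inj => [].
Qed.

Lemma b_image_inj x y : b_image x = b_image y -> x = y.
Proof.
case: b_imageP => [w E|x' E E' x'b|E nE xb]; case: b_imageP => [w' F|y' F F' y'b|F nF yb].
- by case=> ww; apply: (@perm_inj _ c); apply: be_inj E _; rewrite ww.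
- by move/esym/mk_inl.
- by move/esym/mk_inl.
- by move/mk_inl.
- by move/mk_inj => [] // xy _; apply: (@perm_inj _ c); move: E'; rewrite xy F' => -[].
- by move/mk_inj => [].
- by move/mk_inl.
- by move/mk_inj => [].
- by move/mk_inj => [].
Qed.

Lemma a_matching x y : inl x = b_image y <-> a_image x = ab_image y.
Proof.
split.
  case: b_imageP => [q E [xq]|x' _ _ x'b|_ _ yb]; [|by move/esym/mk_inl..].
  subst q; case: ab_imageP => [w q z E1 E2 E3 E4|yb nE1 nE2].
    have [qx] : Some q = Some x by rewrite -E3 E.
    by rewrite qx in E4; case: a_imageP; rewrite ?E4 // => _ [<-].
  case: a_imageP => [w E1|x' E1 E2 x'b|E1 nE xb].
  - by case: (nE2 _ _ E E1).
  - by congr mk; apply: (@perm_inj _ c); apply: be_inj E2 E.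
  - by case: (nE y).
case: a_imageP => [w E|x' E E' x'b|E nE xb]; case: ab_imageP => [w' q z F1 F2 F3 F4|yb nF1 nF2].
- case=> wz; subst z; have xq := al_inj E F4; subst q.
  by case: b_imageP; rewrite ?F3 // => _ [<-].
- by move/esym/mk_inl.
- by move/mk_inl.
- move/mk_inj => [] // xy _; subst x'.
  by case: b_imageP; rewrite ?E' // => _ [<-].
- by move/mk_inl.
- by move/mk_inj => [].
Qed.

Lemma b_matching x y : inl (c x) = a_image y <-> b_image x = ab_image y.
Proof.
split.
  case: a_imageP => [w E [xq]|x' _ _ x'b|_ _ yb]; [|by move/esym/mk_inl..].
  subst w; case: ab_imageP => [w q z E1 E2 E3 E4|yb nE1 nE2].
    have [wx] : Some w = Some (c x) by rewrite -E1 E.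
    by rewrite wx in E2; case: b_imageP; rewrite ?E2 // => _ [<-].
  case: b_imageP => [w E1|x' E1 E2 x'b|E1 nE xb].
  - by case: (nE1 _ _ E E1).
  - by congr mk; apply: al_inj E2 E.
  - by case: (nE y).
case: b_imageP => [w E|x' E E' x'b|E nE xb]; case: ab_imageP => [w' q z F1 F2 F3 F4|yb nF1 nF2].
- case=> wz; subst z; have xq := be_inj E F2; subst w'.
  by case: a_imageP; rewrite ?F1 // => _ [<-].
- by move/esym/mk_inl.
- by move/mk_inl.
- move/mk_inj => [] // xy _; subst x'.
  by case: a_imageP; rewrite ?E' // => _ [<-].
- by move/mk_inl.
- by move/mk_inj => [].
Qed.

(** [a] is prescribed on [inl x] and on [b_image x], [b] on [inl (c x)] and on [a_image x], so that
    both routes, from [x] and from [c x], end at [ab_image x]. The matching lemmas are the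
    consistency and injectivity of these prescriptions; the other values are arbitrary. *)
Lemma handle_fill : exists a b : {perm T + fresh},
  [/\ forall x w, al x = Some w -> a (inl x) = inl w,
      forall x w, be x = Some w -> b (inl x) = inl w
    & forall x, comm a b (inl x) = inl (c x)].
Proof.
pose sw (T1 T2 U : Type) (f : T1 -> U) (g : T2 -> U) (i : T1 + T2) :=
  match i with inl x => f x | inr y => g y end.
have [|a aE] := @matching_perm _ _ (sw _ _ _ inl b_image) (sw _ _ _ a_image ab_image).
  move=> [x|x] [y|y] /=.
  - by split=> [[->]//|/a_image_inj ->].
  - exact: a_matching.
  - by split=> /esym/a_matching/esym.
  - by split=> [/b_image_inj ->|/ab_image_inj ->].
have [|b bE] := @matching_perm _ _ (sw _ _ _ (fun x => inl (c x)) a_image)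
    (sw _ _ _ b_image ab_image).
  move=> [x|x] [y|y] /=.
  - by split=> [[/perm_inj ->]//|/b_image_inj ->].
  - exact: b_matching.
  - by split=> /esym/b_matching/esym.
  - by split=> [/a_image_inj ->|/ab_image_inj ->].
have aP x : a (inl x) = a_image x := aE (inl x).
have aM x : a (b_image x) = ab_image x := aE (inr x).
have bP x : b (inl (c x)) = b_image x := bE (inl x).
have bM x : b (a_image x) = ab_image x := bE (inr x).
exists a, b; split=> [x w E|x w E|x].
- by rewrite aP; case: a_imageP; rewrite E // => _ [<-].
- have := bP (c^-1 x); rewrite permKV => ->.
  by case: b_imageP; rewrite permKV E // => _ [<-].
- by rewrite /comm !permM aP bM -aM permK -bP permK.
Qed.

End HandleFill.

Section Fill.
Variables (h : nat) (T : finType) (E : nat -> T -> T -> bool).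
Hypothesis h0 : 0 < h.
Local Notation g := h.+1.
Local Notation p := (4 * h)%N.
Hypotheses (E_fun : forall n u v w, E n u v -> E n u w -> v = w)
  (E_bar : forall n u v, n %% 4 < 2 -> E n u v = E (n + 2) v u).
Hypothesis E_closed : forall n u v w, n < (4 * g)%N ->
  E n u v -> E (n.+1 %% (4 * g)) v w -> exists c : nat -> T,
  [/\ c 0 = v, forall i, c (i + 4 * g) = c i
    & forall i, E ((n.+1 + i) %% (4 * g)) (c i) (c i.+1)].

Lemma E_inj n u v w : n %% 4 < 2 -> E n u w -> E n v w -> u = v.
Proof. by move=> n4; rewrite (E_bar u w n4) (E_bar v w n4); exact: E_fun. Qed.

Lemma E_perm n : n %% 4 < 2 -> exists s : {perm T}, forall u v, E n u v -> s u = v.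
Proof.
move=> n4.
have [|s sE] := @matching_perm {uv : T * T | E n uv.1 uv.2} T
    (fun i => (val i).1) (fun i => (val i).2).
  move=> [[u v] /= uv] [[u' v'] /= uv']; split=> E'; subst.
    exact: E_fun uv uv'.
  exact: E_inj n4 uv uv'.
by exists s => u v uv; exact: (sE (exist _ (u, v) uv)).
Qed.

Lemma comm_path (A B : {perm T}) i (c : nat -> T) :
  (forall u v, E (4 * i) u v -> A u = v) ->
  (forall u v, E (4 * i + 1) u v -> B u = v) ->
  (forall j, j < 4 -> E (4 * i + j) (c j) (c j.+1)) ->
  comm A B (c 0) = c 4.
Proof.
move=> AE BE cE; rewrite /comm !permM.
have := cE 0 isT; rewrite addn0 => /AE ->.
have /BE -> := cE 1%N isT.
have := cE 2 isT; rewrite -E_bar; last by lia.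
move/AE => <-; rewrite permK.
have := cE 3 isT; rewrite (_ : 4 * i + 3 = 4 * i + 1 + 2); last by lia.
by rewrite -E_bar; [move/BE <-; rewrite permK|lia].
Qed.

Lemma comm_prod_path (A B : nat -> {perm T}) m (c : nat -> T) :
  (forall i u v, i < m -> E (4 * i) u v -> A i u = v) ->
  (forall i u v, i < m -> E (4 * i + 1) u v -> B i u = v) ->
  (forall j, j < (4 * m)%N -> E j (c j) (c j.+1)) ->
  (\prod_(0 <= i < m) comm (A i) (B i)) (c 0) = c (4 * m)%N.
Proof.
elim: m => [|m IHm] AE BE cE; first by rewrite big_nil perm1 muln0.
rewrite big_nat_recr //= permM IHm.
- have -> : (4 * m.+1 = 4 * m + 4)%N by lia.
  rewrite -[(4 * m)%N in LHS]addn0; apply: (@comm_path _ _ m (fun j => c (4 * m + j)%N)).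
  + by move=> u v; apply: AE.
  + by move=> u v; apply: BE.
  + by move=> j j4; rewrite addnS; apply: cE; lia.
- by move=> i u v im; apply: AE; lia.
- by move=> i u v im; apply: BE; lia.
- by move=> j jm; apply: cE; lia.
Qed.

Lemma mod_last j : j < 4 -> (p + j) %% (4 * g) = (p + j)%N.
Proof. by move=> j4; rewrite modn_small //; lia. Qed.

Lemma mod_wrap j : j < (4 * g)%N -> (p + (4 + j)) %% (4 * g) = j.
Proof.
move=> jg; have -> : (p + (4 + j) = j + 4 * g)%N by lia.
by rewrite modnDr modn_small.
Qed.

Lemma last_lt j : j < 4 -> (p + j)%N < (4 * g)%N.
Proof. lia. Qed.

Lemma last_mod4 j : j < 4 -> (p + j) %% 4 = j.
Proof. by move=> j4; rewrite mulnC modnMDl modn_small. Qed.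

(** The first [h] handles are extended arbitrarily on [T], which forces the last commutator to be
    [c] there. On [V] it is some [pi], even since the whole commutator and [c] are. As [0 < h],
    handle 0 can act on [V] by permutations with commutator [pi^-1]. *)
Lemma fill (Old : {set T}) :
  (forall x, x \in Old -> exists w z, E p x w /\ E (p + 1) w z) ->
  exists (V : finType) (A B : nat -> {perm T + V}),
  [/\ #|V| <= (3 * #|~: Old|)%N,
      forall i u v, i < g -> E (4 * i) u v -> A i (inl u) = inl v,
      forall i u v, i < g -> E (4 * i + 1) u v -> B i (inl u) = inl v
    & \prod_(0 <= i < g) comm (A i) (B i) = 1].
Proof.
move=> OldE.
have E_permE n : exists s : {perm T}, n %% 4 < 2 -> forall u v, E n u v -> s u = v.
  by case: (boolP (n %% 4 < 2)) => [/E_perm[s sE]|_]; [exists s|exists 1].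
have [S SE] := fin_all_exists (fun n : 'I_(4 * g)%N => E_permE n).
have g40 : 0 < (4 * g)%N by rewrite muln_gt0.
pose St n := S (insubd (Ordinal g40) n).
have StE n u v : n < (4 * g)%N -> n %% 4 < 2 -> E n u v -> St n u = v.
  move=> lt n4; have vE : val (insubd (Ordinal g40) n) = n by rewrite insubdK.
  by have := SE (insubd (Ordinal g40) n); rewrite vE => /(_ n4); apply.
pose A i := St (4 * i)%N; pose B i := St (4 * i + 1)%N.
have AE i u v : i < h -> E (4 * i) u v -> A i u = v.
  by move=> ih; apply: StE; [rewrite ltn_pmul2l // ltnW|rewrite modnMr].
have BE i u v : i < h -> E (4 * i + 1) u v -> B i u = v.
  move=> ih; apply: StE; last by rewrite mulnC modnMDl.
  by clear -ih; lia.
pose Q := \prod_(0 <= i < h) comm (A i) (B i); pose c := Q^-1.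
have QE (d : nat -> T) : (forall j, j < p -> E j (d j) (d j.+1)) -> c (d p) = d 0.
  by move=> dE; apply: (canLR (permK _)); rewrite (comm_prod_path AE BE dE).
pose al x := [pick w | E p x w]; pose be x := [pick w | E (p + 1) x w].
have p4 : p %% 4 < 2 by rewrite -[p]addn0 last_mod4.
have p4' : (p + 1) %% 4 < 2 by rewrite last_mod4.
have alE x w : al x = Some w <-> E p x w.
  rewrite /al; case: pickP => [w' E'|n]; split=> //; [by case=> <-| |by rewrite n].
  by move=> E''; congr Some; exact: E_fun E' E''.
have beE x w : be x = Some w <-> E (p + 1) x w.
  rewrite /be; case: pickP => [w' E'|n]; split=> //; [by case=> <-| |by rewrite n].
  by move=> E''; congr Some; exact: E_fun E' E''.
(* The closed corner through [x], [w], [z] continues with the inverse letters to [d 2] and [d 3],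
   then with the first [h] handles from [d 3] back to [x]. Hence [d 3] is [c x], and [d 2] is the
   required [q]. *)
have al_be x w z : al x = Some w -> be w = Some z ->
    exists2 q, be (c x) = Some q & al q = Some z.
  move=> /alE E1 /beE E2; have [||d [d0 dper dE]] := @E_closed p x w z _ E1.
  - by have := @last_lt 0 isT; rewrite addn0.
  - by rewrite -addn1 mod_last.
  have {}dE i : E ((p + (1 + i)) %% (4 * g)) (d i) (d i.+1).
    by have := dE i; rewrite addSnnS.
  have d1 : d 1%N = z.
    apply: (E_fun (n := p + 1) (u := w)) => //.
    by have := dE 0; rewrite d0 mod_last.
  have F2 : E (p + 2) (d 1%N) (d 2) by have := dE 1%N; rewrite mod_last.
  have F3 : E (p + 1 + 2) (d 2) (d 3) by have := dE 2; rewrite mod_last // addnA.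
  have F4 j : j <= p -> E j (d (3 + j)) (d (3 + j).+1).
    move=> jp; have := dE (3 + j); rewrite mod_wrap //.
    by apply: leq_ltn_trans jp _; rewrite ltn_pmul2l.
  have xE : d (3 + p) = x.
    apply: (E_inj p4) E1; have := F4 p (leqnn _).
    have -> : (3 + p).+1 = (0 + 4 * g)%N by clear; lia.
    by rewrite dper d0.
  exists (d 2).
    apply/beE; rewrite E_bar // -xE (QE (fun j => d (3 + j))) //.
    by move=> j jp; rewrite addnS; apply: F4; exact: ltnW.
  by apply/alE; rewrite E_bar // -d1.
(* The same kind of corner, entered at position [p + 2] along [z], [q], [c x]; the first handles
   lead from [c x] to [x]. *)
have be_al x q z : be (c x) = Some q -> al q = Some z ->
    exists2 w, al x = Some w & be w = Some z.
  move=> /beE E1 /alE E2; have [|||d [d0 dper dE]] := @E_closed (p + 2) z q (c x).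
  - exact: last_lt.
  - by rewrite -E_bar.
  - by rewrite -addn1 -addnA mod_last // (_ : p + (2 + 1) = p + 1 + 2) -?E_bar // -addnA.
  have {}dE i : E ((p + (3 + i)) %% (4 * g)) (d i) (d i.+1).
    by have := dE i; rewrite -addn1 -!addnA.
  have d1 : d 1%N = c x.
    apply: (E_fun (n := p + 1 + 2) (u := q)); last by rewrite -E_bar.
    by have := dE 0; rewrite d0 mod_last // -addnA.
  have F4 j : j < (4 * g)%N -> E j (d (1 + j)) (d (1 + j).+1).
    by move=> jp; have := dE (1 + j); rewrite mod_wrap.
  have xE : d (1 + p) = x.
    apply: (@perm_inj _ c); rewrite (QE (fun j => d (1 + j))) ?d1 //.
    by move=> j jp; rewrite addnS; apply: F4; apply: ltn_trans jp _; rewrite ltn_pmul2l.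
  exists (d (1 + p).+1).
    by apply/alE; rewrite -xE; apply: F4; rewrite ltn_pmul2l.
  apply/beE; have -> : z = d (1 + (p + 1)).+1.
    apply: (E_fun (n := p) (u := q)) => //; rewrite E_bar //.
    have -> : q = d (1 + (p + 2)).+1.
      by rewrite -d0 -(dper 0); congr d; clear; lia.
    have -> : (1 + (p + 1)).+1 = (1 + (p + 2))%N by clear; lia.
    by apply: F4; exact: last_lt.
  have -> : (1 + p).+1 = (1 + (p + 1))%N by clear; lia.
  by apply: F4; exact: last_lt.
have al_inj x y z : al x = Some z -> al y = Some z -> x = y.
  by move=> /alE + /alE; exact: E_inj.
have be_inj x y z : be x = Some z -> be y = Some z -> x = y.
  by move=> /beE + /beE; exact: E_inj.
have [a [b [aE bE abE]]] := handle_fill al_inj be_inj al_be be_al.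
pose V := fresh al be; pose K := comm a b.
have KE : exists pi : {perm V}, K = sum_perm c pi.
  have Kr v : exists v', K (inr v) = inr v'.
    case E' : (K (inr v)) => [t|v']; last by exists v'.
    have : K (inl (c^-1 t)) = K (inr v) by rewrite abE permKV.
    by move/perm_inj.
  have [f fE] := fin_all_exists Kr.
  have finj : injective f.
    by move=> v w fvw; have /perm_inj [] : K (inr v) = K (inr w) by rewrite !fE fvw.
  exists (perm finj); apply/permP => -[x|v]; rewrite sum_permE /= ?abE //.
  by rewrite fE permE.
have [pi piE] := KE.
have evpi : ~~ odd_perm pi^-1.
  have := odd_comm a b; rewrite -/K piE odd_sum_perm odd_permV /c odd_permV.
  suff -> : odd_perm Q = false by move=> /= ->.
  rewrite /Q; elim/big_ind: _ => [|x y|i _]; rewrite ?odd_perm1 ?odd_comm //.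
  by rewrite odd_permM => -> ->.
have [a0 [b0 ab0]] := even_perm_comm evpi.
pose A' i := if i < h then sum_perm (A i) (if i == 0 then a0 else 1) else a.
pose B' i := if i < h then sum_perm (B i) (if i == 0 then b0 else 1) else b.
have lasth i : i < g -> i < h = false -> i = h by clear; lia.
exists V, A', B'; split.
- rewrite card_prod card_ord mulnC leq_mul2l card_sig /=.
  apply: subset_leq_card; apply/subsetP => x; rewrite inE => /eqP xb.
  rewrite inE; apply/negP => /OldE[w [z [/alE E1 /beE E2]]].
  by rewrite E1 /= E2 in xb.
- move=> i u v ig Euv; rewrite /A'; case: ifP => [ih|/(lasth _ ig) iE].
    by rewrite sum_permE /= (AE _ _ _ ih Euv).
  by apply: aE; apply/alE; rewrite -iE.
- move=> i u v ig Euv; rewrite /B'; case: ifP => [ih|/(lasth _ ig) iE].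
    by rewrite sum_permE /= (BE _ _ _ ih Euv).
  by apply: bE; apply/beE; rewrite -iE.
rewrite big_nat_recr //= {2}/A' {2}/B' ltnn -/K piE.
pose C i := comm (if i == 0 then a0 else 1) (if i == 0 then b0 else 1).
have -> : \prod_(0 <= i < h) comm (A' i) (B' i) = sum_perm Q (\prod_(0 <= i < h) C i).
  rewrite /Q; have: h <= h by []; elim: {1 3 4 5}h => [|m IHm] mh.
    by rewrite !big_nil sum_perm1.
  rewrite !big_nat_recr //= IHm 1?ltnW // sum_permM; congr (_ * _).
  by rewrite /A' /B' mh sum_perm_comm.
have -> : \prod_(0 <= i < h) C i = pi^-1.
  rewrite -(prednK h0) big_nat_recl // [X in _ * X]big1 ?mulg1 // => i _.
  by rewrite /C /= /comm invg1 !mulg1.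
by rewrite -sum_permM /c mulgV mulVg sum_perm1.
Qed.

End Fill.

Local Close Scope group_scope.

(** * Stability of the surface relation *)

Section Handles.
Variable h : nat.
Hypothesis h0 : 0 < h.
Local Notation g := h.+1.
Local Notation n := (4 * g)%N.

Definition bar_nat k := if k %% 4 < 2 then k + 2 else k - 2.

Lemma bar_nat_lt (k : 'I_n) : bar_nat k < n.
Proof. by rewrite /bar_nat; have := ltn_ord k; case: ifP; lia. Qed.

Definition bar_pos (k : 'I_n) : 'I_n := Ordinal (bar_nat_lt k).

Lemma bar_posK : involutive bar_pos.
Proof. by move=> k; apply: val_inj; rewrite /= /bar_nat; case: ifP; case: ifP; lia. Qed.

Lemma val_ordS_iter (k : 'I_n) i : val (iter i (@ordS n) k) = (k + i) %% n.
Proof.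
elim: i => [|i IHi]; first by rewrite addn0 modn_small.
by rewrite iterS /= IHi -addn1 modnDml addn1 addnS.
Qed.

Lemma ordS_per (k : 'I_n) : iter n (@ordS n) k = k.
Proof. by apply: val_inj; rewrite val_ordS_iter modnDr modn_small. Qed.

(** The boundary order of the polygon visits the positions 0, 3, 2, 1 of each block of four and then
    passes to the next block: a single cycle of length [4 * g], hence no cycle of length 1, 2 or
    3. *)
Lemma val_ordS_bar (k : 'I_n) : ordS (bar_pos k) =
  (if k %% 4 == 0 then k + 3 else if k %% 4 == 1 then
     if k + 3 < n then k + 3 else 0 else k - 1) :> nat.
Proof.
have nE : 4 * g = n by [].
rewrite /= /bar_nat; have ltk := ltn_ord k; move: (nat_of_ord k) ltk => {}k ltk.
have [k2|k2] := ltnP (k %% 4) 2.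
  have [k0|k0] := eqVneq (k %% 4) 0; first by rewrite modn_small; lia.
  have -> : k %% 4 == 1 by lia.
  by case: ltnP => kN; [rewrite modn_small; lia|
    rewrite (_ : (k + 2).+1 = n) ?modnn //; lia].
have -> : (k %% 4 == 0) = false by lia.
have -> : (k %% 4 == 1) = false by lia.
by rewrite modn_small; lia.
Qed.

Lemma turn_cycle1 (k : 'I_n) : ordS (bar_pos k) != k.
Proof.
apply/eqP => /(congr1 (@nat_of_ord _)); rewrite val_ordS_bar.
by have := ltn_ord k; move: (nat_of_ord k) => {}k; do 3?case: ifP; lia.
Qed.

Lemma turn_cycle2 (k : 'I_n) : ordS (bar_pos (ordS (bar_pos k))) != k.
Proof.
pose k1 := ordS (bar_pos k).
apply/eqP => /(congr1 (@nat_of_ord _)); rewrite val_ordS_bar -/k1.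
have := val_ordS_bar k; rewrite -/k1.
have := ltn_ord k; move: (nat_of_ord k) (nat_of_ord k1) => {k1}k k1 ltk.
by do 3?case: ifP => ?; move=> ?; do 3?case: ifP => ?; lia.
Qed.

Lemma turn_cycle3 (k : 'I_n) : ordS (bar_pos (ordS (bar_pos (ordS (bar_pos k))))) != k.
Proof.
pose k1 := ordS (bar_pos k); pose k2 := ordS (bar_pos k1).
apply/eqP => /(congr1 (@nat_of_ord _)); rewrite val_ordS_bar -/k1 -/k2.
have := val_ordS_bar k1; have := val_ordS_bar k; rewrite -/k1 -/k2.
have := ltn_ord k; move: (nat_of_ord k) (nat_of_ord k1) (nat_of_ord k2).
move=> {k1 k2}k k1 k2 ltk.
by do 3?case: ifP => ?; move=> ?; do 3?case: ifP => ?; move=> ?; do 3?case: ifP => ?; lia.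
Qed.

Local Open Scope group_scope.

Section Stability.
Variables (X : finType) (a b : nat -> {perm X}).

Definition letter_act (x : X) (k : 'I_n) : X :=
  let i := k %/ 4 in
  match k %% 4 with 0 => a i x | 1 => b i x | 2 => (a i)^-1 x | _ => (b i)^-1 x end.

Lemma letter_actE x (k : 'I_n) i j : k = (4 * i + j)%N :> nat -> j < 4 ->
  letter_act x k =
  match j with 0 => a i x | 1 => b i x | 2 => (a i)^-1 x | _ => (b i)^-1 x end.
Proof.
move=> kE j4; rewrite /letter_act kE mulnC modnMDl modn_small //.
by rewrite divnMDl // divn_small // addn0.
Qed.

Lemma pos_split (k : 'I_n) : exists i j, [/\ i < g, j < 4 & k = (4 * i + j)%N :> nat].
Proof.
exists (k %/ 4), (k %% 4); split; first by rewrite ltn_divLR // [(g * 4)%N]mulnC.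
  exact: ltn_pmod.
by rewrite {1}(divn_eq k 4) [(_ * 4)%N]mulnC.
Qed.

Lemma letter_actK x k : letter_act (letter_act x k) (bar_pos k) = x.
Proof.
have [i [j [ig j4 kE]]] := pos_split k; rewrite (letter_actE _ kE) //.
have barE : val (bar_pos k) = (4 * i + (if j < 2 then j + 2 else j - 2))%N :> nat.
  by rewrite /= /bar_nat kE; clear -j4; case: ifP; case: ifP; lia.
rewrite (letter_actE _ barE); last by case: ifP; lia.
by case: j j4 {kE barE} => [|[|[|[]]]] //= _; rewrite ?permK ?permKV.
Qed.

Local Notation turn := (turn (@ordS n) letter_act).
Local Notation flip := (flip bar_pos letter_act).

Definition relator : {perm X} := \prod_(0 <= i < g) comm (a i) (b i).

Lemma turn_relator x (k : 'I_n) : val k = 0 -> iter n turn (x, k) = (relator x, k).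
Proof.
move=> k0; rewrite (surjective_pairing (iter _ _ _)) turn_iter2 ordS_per; congr (_, _).
suff H m : m <= g -> (iter (4 * m) turn (x, k)).1 =
    (\prod_(0 <= i < m) comm (a i) (b i)) x by exact: H.
elim: m => [|m IHm] mg; first by rewrite muln0 big_nil perm1.
rewrite big_nat_recr // permM -IHm 1?ltnW // (_ : 4 * m.+1 = 4 + 4 * m)%N; last by lia.
rewrite iterD; set d := iter (4 * m) turn (x, k).
have d2 j : j < 4 -> val (iter j turn d).2 = (4 * m + j)%N.
  move=> j4; rewrite -iterD turn_iter2 val_ordS_iter [nat_of_ord _]k0 add0n addnC.
  by rewrite modn_small //; lia.
have st j : j < 4 -> (iter j.+1 turn d).1 = match j with 0 => a m (iter j turn d).1
    | 1 => b m (iter j turn d).1 | 2 => (a m)^-1 (iter j turn d).1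
    | _ => (b m)^-1 (iter j turn d).1 end.
  by move=> j4; rewrite /= (letter_actE _ (d2 _ j4)).
by rewrite (st 3) // (st 2) // (st 1%N) // (st 0) // /comm !permM.
Qed.

Lemma iter_letter_turn_inj j : injective (iter j turn).
Proof.
have n1 : 1 < n by lia.
by move=> d e; apply: (iter_turn_inj n1 ordS_per letter_actK).
Qed.

(** A corner at position [k] reaches position 0 after [n - k] turns, where being bad means being
    moved by the relator. The point reached, together with [k], determines the corner. *)
Lemma card_bad : #|bad n turn| <= n * #|[set x | relator x != x]|.
Proof.
have n0 : 0 < n by [].
pose k0 : 'I_n := Ordinal n0.
pose f (d : X * 'I_n) := (d.2, (iter (n - d.2) turn d).1).
have fP (d : X * 'I_n) : iter (n - d.2) turn d = ((iter (n - d.2) turn d).1, k0).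
  rewrite {1}[iter _ _ _]surjective_pairing; congr (_, _); apply: val_inj.
  by rewrite turn_iter2 val_ordS_iter subnKC ?modnn // ltnW.
have finj : injective f.
  move=> [x k] [y l] [/= kl]; rewrite -{}kl => E.
  by have := fP (x, k); rewrite /= E -(fP (y, k)) => /iter_letter_turn_inj.
have -> : (n * #|[set x | relator x != x]| = #|setX [set: 'I_n] [set x | relator x != x]|)%N.
  by rewrite cardsX cardsT card_ord.
rewrite -(card_imset _ finj); apply: subset_leq_card; apply/subsetP => _ /imsetP[d bd ->].
rewrite !inE /=; apply: contraTN bd => /eqP rE; rewrite negbK.
apply/eqP; apply: (@iter_letter_turn_inj (n - d.2)).
by rewrite -iterD addnC iterD fP turn_relator // rE.
Qed.

(** [m] is the number of cut corners. The layer has [n * m] points and the completion at most three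
    per layer point, since both edges of the last handle that [fill] asks for are present at old
    points. A generator changes only where its edge is cut. *)
Lemma combinatorial_stability : exists (U : finType) (iota : X -> U) (A B : nat -> {perm U}) m,
  [/\ injective iota, #|U| <= #|X| + 4 * n * m,
      forall i, i < g -> #|[set x | A i (iota x) != iota (a i x)]| <= m /\
                         #|[set x | B i (iota x) != iota (b i x)]| <= m,
      \prod_(0 <= i < g) comm (A i) (B i) = 1 &
      let k := (n * #|[set x | relator x != x]|)%N in
      m <= 2 * k + cut_cost (#|X| * n)%N k].
Proof.
have n8 : 8 <= n by lia.
have n1 : 1 < n by exact: leq_trans n8.
have tinj : injective turn by apply: turn_inj n1 ordS_per letter_actK.
have fK : involutive flip by exact: flipK bar_posK letter_actK.
have [H [Hb Hf cH Hp]] := cut_exists n8 tinj fK.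
have Hr d : d \notin H -> iter n turn d = d.
  by move=> dH; apply/eqP; apply: contraNT dH => nd; exact: Hb.
pose L := layer n H.
pose e : X + L -> 'I_n -> X + L -> bool := layer_edge (@ordS n) bar_pos letter_act (H := H).
have e_sym u k v : e u k v -> e v (bar_pos k) u by exact: layer_edge_sym bar_posK _ _ _ _.
have e_fun u k v w : e u k v -> e u k w -> v = w.
  exact: (layer_edge_fun n1 ordS_per bar_posK turn_cycle1 turn_cycle2 letter_actK Hf Hp).
have e_closed u k v w : e u k v -> e v (ordS k) w ->
    closed_corner n (@ordS n) e v (ordS k).
  exact: (layer_edge_closed n1 ordS_per bar_posK turn_cycle1 turn_cycle2 turn_cycle3
    letter_actK Hf Hr Hp).
have e_old x k : closed_corner n (@ordS n) e (inl x) k.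
  exact: (old_closed n1 ordS_per letter_actK Hf Hr Hp).
pose E m u v := [exists k : 'I_n, (val k == m) && e u k v].
have EP m u v : reflect (exists2 k : 'I_n, val k = m & e u k v) (E m u v).
  apply: (iffP existsP) => [[k /andP[/eqP ? ?]]|[k kE ?]]; exists k => //.
  by rewrite kE eqxx.
have E_fun m u v w : E m u v -> E m u w -> v = w.
  by move=> /EP[k kE uv] /EP[l lE uw]; apply: e_fun uv _; rewrite (_ : k = l) //;
     apply: val_inj; rewrite kE lE.
have E_bar m u v : m %% 4 < 2 -> E m u v = E (m + 2) v u.
  move=> m4; apply/EP/EP => -[k kE uv]; exists (bar_pos k); try exact: e_sym.
    by rewrite /= /bar_nat [nat_of_ord k]kE m4.
  rewrite /= /bar_nat [nat_of_ord k]kE; clear -m4; case: ifP; lia.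
have E_closed m u v w : m < n -> E m u v -> E (m.+1 %% n) v w -> exists c : nat -> X + L,
    [/\ c 0 = v, forall i, c (i + n) = c i & forall i, E ((m.+1 + i) %% n) (c i) (c i.+1)].
  move=> mn /EP[k kE uv] /EP[l lE vw].
  have lk : l = ordS k by apply: val_inj; rewrite lE /= [nat_of_ord k]kE.
  rewrite lk in vw; have [c [c0 cp ce]] := e_closed _ _ _ _ uv vw.
  exists c; split=> // i; apply/EP; exists (iter i (@ordS n) (ordS k)) => //.
  by rewrite val_ordS_iter /= [nat_of_ord k]kE modnDml.
have [|V [A [B [cV AE BE AB]]]] := fill h0 E_fun E_bar E_closed (Old := inl @: X).
  move=> _ /imsetP[x _ ->].
  have ltp : (4 * h)%N < n by rewrite ltn_pmul2l.
  have [c [c0 _ ce]] := e_old x (Ordinal ltp).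
  exists (c 1%N), (c 2); split; apply/EP.
    by exists (Ordinal ltp) => //; rewrite -c0; exact: (ce 0).
  by eexists; last exact: (ce 1%N); rewrite val_ordS_iter /= mod_last.
have cL : #|L| = (#|H| * n)%N by rewrite card_prod card_ord card_sig.
exists (X + L + V)%type, (fun x => inl (inl x)), A, B, #|H|; split=> //.
- by move=> x y [].
- rewrite !card_sum cL -addnA leq_add2l.
  have -> : (4 * n * #|H| = #|H| * n + 3 * (#|H| * n))%N by clear; lia.
  rewrite leq_add2l; apply: leq_trans cV _; rewrite leq_mul2l /= -cL.
  have -> : ~: [set inl x | x in X] = [set inr l | l in L] :> {set X + L}.
    apply/setP => -[x|l]; rewrite inE.
      by rewrite imset_f //; apply/esym/imsetP => -[].
    rewrite (imset_f (inr : L -> X + L)) //; apply/imsetP => -[] //.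
  by rewrite card_imset // => ? ? [].
- have cut_count (f : X -> X) (F : {perm X + L + V}) m : m < n ->
      (forall x (k : 'I_n), val k = m -> letter_act x k = f x) ->
      (forall u v, E m u v -> F (inl u) = inl v) ->
      #|[set x | F (inl (inl x)) != inl (inl (f x))]| <= #|H|.
    move=> mn fE FE; pose k : 'I_n := Ordinal mn.
    have kinj : injective (fun x : X => (x, k)) by move=> x y [].
    rewrite -(card_imset _ kinj); apply: subset_leq_card.
    apply/subsetP => _ /imsetP[x + ->]; rewrite inE; apply: contraNT => xH.
    apply/eqP; apply: FE; apply/EP; exists k => //.
    by rewrite -(fE x k) //; exact: layer_edge_old.
  move=> i ig; split.
    apply: (@cut_count (a i) (A i) (4 * i)%N) => [|x k kE|]; last by move=> u v; exact: AE.
      by rewrite ltn_pmul2l.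
    by rewrite (@letter_actE x k i 0) // addn0 -kE.
  apply: (@cut_count (b i) (B i) (4 * i + 1)%N) => [|x k kE|]; last by move=> u v; exact: BE.
    by clear -ig; lia.
  by rewrite (@letter_actE x k i 1%N) // -kE.
- move=> k; apply: leq_trans cH _; rewrite -/k card_prod card_ord.
  have kb : #|bad n turn| <= k by exact: card_bad.
  apply: leq_add; first by rewrite leq_mul2l kb orbT.
  rewrite /cut_cost (big_cat_nat (n := #|bad n turn|.+1) (p := k.+1)) //= leq_addr //.
Qed.

End Stability.
End Handles.

Local Close Scope group_scope.

(** * Free groups and flexible stability *)

From HB Require Import structures.
From mathcomp Require Import all_order all_algebra.
From mathcomp Require Import generic_quotient.
From mathcomp Require Import all_classical all_reals all_analysis.
From mathcomp Require Import homotopy ring lra zify.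
From Stdlib Require Import Relation_Operators.
Require Import Defs.
Import Order.TTheory GRing.Theory Num.Theory.

Section FreeGroup.
Variable Sigma : choiceType.
Local Open Scope group_scope.

Lemma multiplicative1 (G H : groupType) (f : {multiplicative G -> H}) : f 1 = 1.
Proof. by apply: (mulgI (f 1)); rewrite -gmulfM !mulg1. Qed.

Lemma multiplicativeV (G H : groupType) (f : {multiplicative G -> H}) x : f x^-1 = (f x)^-1.
Proof. by apply: (mulgI (f x)); rewrite -gmulfM !mulgV multiplicative1. Qed.

Section Lift.
Variables (H : groupType) (f : Sigma -> H).

Definition letter_val (a : letter Sigma) : H := if a.2 then (f a.1)^-1 else f a.1.

Definition word_val (w : seq (letter Sigma)) : H := \prod_(a <- w) letter_val a.

Lemma letter_val_inv a : letter_val (inv_letter a) = (letter_val a)^-1.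
Proof. by case: a => s [] //=; rewrite /letter_val /= invgK. Qed.

Lemma word_val_cat u v : word_val (u ++ v) = word_val u * word_val v.
Proof. exact: big_cat. Qed.

Lemma word_val_reduce w : word_val (reduce w) = word_val w.
Proof.
elim: w => //= a w IHw; rewrite [RHS]big_cons -[\prod_(_ <- w) _]/(word_val w) -IHw.
case: (reduce w) => [|b v] /=; first by rewrite /word_val big_cons.
case: eqP => [->|_]; rewrite /word_val !big_cons //.
by rewrite letter_val_inv mulgA mulgV mul1g.
Qed.

Definition fg_lift (x : free_group Sigma) : H := word_val (val x).

Lemma fg_liftM : {morph fg_lift : x y / x * y}.
Proof. by move=> x y; rewrite /fg_lift /= word_val_reduce word_val_cat. Qed.

HB.instance Definition _ := isMultiplicative.Build (free_group Sigma) H fg_lift fg_liftM.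

Lemma fg_lift_generator s : fg_lift (generator s) = f s.
Proof. by rewrite /fg_lift /word_val /= big_cons big_nil mulg1. Qed.

End Lift.

Lemma fg_of_cat u v : fg_of (u ++ v) = fg_of u * fg_of v :> free_group Sigma.
Proof. by apply: val_inj; rewrite /= reduce_catl reduce_catr. Qed.

Lemma fg_of_val (x : free_group Sigma) : fg_of (val x) = x.
Proof. by apply: val_inj; rewrite /= reduce_id //; exact: valP. Qed.

Lemma fg_of_letter a : fg_of [:: a] =
  (if a.2 then (generator a.1)^-1 else generator a.1) :> free_group Sigma.
Proof. by case: a => s [] //=; apply: val_inj. Qed.

Lemma fg_ind (P : free_group Sigma -> Prop) : P 1 ->
  (forall s x, P x -> P (generator s * x)) ->
  (forall s x, P x -> P ((generator s)^-1 * x)) -> forall x, P x.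
Proof.
move=> P1 Ps Psi x; rewrite -[x]fg_of_val; elim: (val x) => [|a w IHw] //.
by rewrite -cat1s fg_of_cat fg_of_letter; case: a.2; [exact: Psi|exact: Ps].
Qed.

Lemma eq_fg_hom (H : groupType) (f f' : {multiplicative free_group Sigma -> H}) :
  (forall s, f (generator s) = f' (generator s)) -> f =1 f'.
Proof.
move=> ff; elim/fg_ind => [|s x IHx|s x IHx]; first by rewrite !multiplicative1.
  by rewrite !gmulfM ff IHx.
by rewrite !gmulfM !multiplicativeV ff IHx.
Qed.

Lemma presentation_factor (G H : groupType) (rels : set (free_group Sigma))
    (p : {multiplicative free_group Sigma -> G})
    (f : {multiplicative free_group Sigma -> H}) :
  is_presentation rels p -> (forall r, rels r -> f r = 1) ->
  exists f' : {multiplicative G -> H}, f =1 f' \o p.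
Proof.
move=> [psurj pker] fr.
have ker w : p w = 1 -> f w = 1.
  move=> pw; have : normal_closure rels w by rewrite -pker.
  apply: (_ : normal_closure rels `<=` [set x | f x = 1])%classic.
  move=> z; apply; split; last exact: fr.
  split=> [|x y /= fx fy|x /= fx|x y /= fx].
  - by rewrite /= multiplicative1.
  - by rewrite gmulfM fx fy mulg1.
  - by rewrite multiplicativeV fx invg1.
  - by rewrite /conjg !gmulfM fx mul1g -gmulfM mulVg multiplicative1.
have [s sP] := choice psurj.
have fs w : f (s (p w)) = f w.
  apply: (mulgI (f w)^-1); rewrite mulVg -multiplicativeV -gmulfM; apply: ker.
  by rewrite gmulfM multiplicativeV sP mulVg.
have fsM : {morph (f \o s) : x y / x * y}.
  by move=> x y /=; rewrite -{1}(sP x) -{1}(sP y) -gmulfM fs gmulfM.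
pose f' := HB.pack_for {multiplicative G -> H} (f \o s) (isMultiplicative.Build G H _ fsM).
by exists f' => w /=; rewrite fs.
Qed.

End FreeGroup.

Local Open Scope ring_scope.

(** * A square-root bound for the number of cuts *)

Lemma trunc_log3_sqr m : (0 < m)%N -> ((trunc_log 3 m).+1 ^ 2 <= 4 * m)%N.
Proof.
move=> m0; apply: leq_trans (_ : 4 * 3 ^ trunc_log 3 m <= _)%N; last first.
  by rewrite leq_mul2l trunc_logP.
elim: (trunc_log 3 m) => // t IHt; rewrite [(3 ^ t.+1)%N]expnS.
have [t1|t1] := leqP t 1; first by case: t t1 IHt => [|[|]].
have t2 : (t.+2 ^ 2 <= 3 * t.+1 ^ 2)%N by nia.
by apply: leq_trans t2 _; rewrite [leqRHS]mulnCA leq_mul2l.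
Qed.

(** With [s], [r], [d] the roots of [k.+1], [k], [D], the logarithmic factor [t] satisfies
    [t * s <= 2 * d]. As [(s - r) * (s + r) = 1] and [r <= s], the increment [4 * t] is at most
    [8 * t * s * (s - r) <= 16 * d * (s - r)], which telescopes. *)
Lemma cut_cost_sqrt (R : realType) (D k : nat) : (k <= D)%N ->
  (cut_cost D k)%:R <= 16 * (Num.sqrt k%:R * Num.sqrt D%:R) :> R.
Proof.
elim: k => [|k IHk] kD; first by rewrite /cut_cost big_nil sqrtr0 mul0r mulr0.
rewrite /cut_cost big_nat_recr //= natrD; have := IHk (ltnW kD).
rewrite -/(cut_cost D k); set C := (cut_cost D k)%:R.
set t := (trunc_log 3 (D %/ k.+1)).+1.
set s := Num.sqrt k.+1%:R; set r := Num.sqrt k%:R; set d := Num.sqrt D%:R => IH.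
have s2 : s ^+ 2 = k.+1%:R :> R by rewrite sqr_sqrtr.
have r2 : r ^+ 2 = k%:R :> R by rewrite sqr_sqrtr.
have s0 : 0 < s by rewrite sqrtr_gt0 ltr0n.
have r0 : 0 <= r by rewrite sqrtr_ge0.
have d0 : 0 <= d by rewrite sqrtr_ge0.
have rs : r <= s by rewrite ler_wsqrtr // ler_nat.
have ts : t%:R * s <= 2 * d.
  rewrite -ler_sqr ?nnegrE ?mulr_ge0 // ?(ltW s0) //.
  rewrite !exprMn s2 sqr_sqrtr //.
  have tD : (t ^ 2 * k.+1 <= 4 * D)%N.
    have := trunc_log3_sqr (m := D %/ k.+1); rewrite divn_gt0 // -/t => /(_ kD) t2.
    apply: leq_trans (_ : 4 * (D %/ k.+1) * k.+1 <= _)%N; first by rewrite leq_mul2r t2.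
    by rewrite -mulnA leq_mul2l leq_trunc_div.
  move: tD; rewrite -(ler_nat R) !natrM => tD.
  by apply: le_trans tD _; rewrite expr2; lra.
have E : (s - r) * (s + r) = 1.
  by rewrite -subr_sqr s2 r2 -natrB // subSnn.
rewrite natrM; suff : 4 * t%:R <= 16 * (d * (s - r)) by lra.
have sr0 : 0 < s + r by lra.
rewrite -(ler_pM2r sr0) -!mulrA E mulr1 mulrDr.
have : t%:R * r <= t%:R * s by rewrite ler_wpM2l.
lra.
Qed.

Local Close Scope ring_scope.

(** * Passage to symmetric groups, and the stability estimate *)

Section Transport.
Variables (U : finType) (M : nat) (f : U -> 'I_M) (f' : 'I_M -> U).
Hypotheses (fK : cancel f f') (f'K : cancel f' f).
Local Open Scope group_scope.

Lemma transport_inj (s : {perm U}) : injective (fun j => f (s (f' j))).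
Proof. by move=> i j /(can_inj fK) /perm_inj /(can_inj f'K). Qed.

Definition transport (s : {perm U}) : 'S_M := perm (@transport_inj s).

Lemma transportM : {morph transport : s t / s * t}.
Proof.
have tE s j : transport s j = f (s (f' j)) by exact: permE.
by move=> s t; apply/permP => j; rewrite tE permM [RHS]permM !tE fK.
Qed.

HB.instance Definition _ := isMultiplicative.Build {perm U} 'S_M transport transportM.

Lemma transportE s x : transport s (f x) = f (s x).
Proof. by rewrite permE fK. Qed.

End Transport.

Lemma extend_bijection (N M : nat) (le_NM : (N <= M)%N) (U : finType) (iota : 'I_N -> U) :
  injective iota -> #|U| = M -> exists (f : U -> 'I_M) (f' : 'I_M -> U),
  [/\ cancel f f', cancel f' f & forall x, f (iota x) = widen_ord le_NM x].
Proof.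
move=> iinj UM; subst M.
have [|s sE] := @matching_perm 'I_N 'I_#|U| (fun i => enum_rank (iota i)) (widen_ord le_NM).
  move=> i j; split=> [/enum_rank_inj /iinj -> //|E].
  by have -> // : i = j; apply: val_inj; apply: (congr1 val E).
exists (fun x => s (enum_rank x)), (fun j => enum_val ((s^-1)%g j)); split=> // x.
  by rewrite permK enum_rankK.
by rewrite enum_valK permKV.
Qed.

Section SurfaceGroup.
Variable g : nat.

Definition surface_gen : finType := ('I_g * bool)%type.

Definition gen_a (i : 'I_g) : free_group surface_gen := generator (i, false).
Definition gen_b (i : 'I_g) : free_group surface_gen := generator (i, true).

Definition surface_rel : free_group surface_gen :=
  (\prod_(i < g) comm (gen_a i) (gen_b i))%g.

Lemma hom_comm (G H : groupType) (f : {multiplicative G -> H}) x y :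
  f (comm x y) = comm (f x) (f y).
Proof. by rewrite /comm !gmulfM !multiplicativeV. Qed.

Lemma hom_surface_rel (H : groupType) (f : {multiplicative free_group surface_gen -> H}) :
  f surface_rel = (\prod_(i < g) comm (f (gen_a i)) (f (gen_b i)))%g.
Proof.
rewrite /surface_rel (big_morph f (@gmulfM _ _ f) (multiplicative1 f)).
by apply: eq_bigr => i _; rewrite hom_comm.
Qed.

End SurfaceGroup.

Section Hamming.
Variables (R : realType) (N M : nat) (le_NM : (N <= M)%N).
Local Open Scope ring_scope.

Lemma hamming_extend (s : 'S_N) (t : 'S_M) : (0 < N)%N ->
  hamming R (extend_perm le_NM s) t <=
  (#|[set x : 'I_N | t (widen_ord le_NM x) != widen_ord le_NM (s x)]%SET| + (M - N))%N%:R / N%:R.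
Proof.
move=> N0; have M0 : (0 < M)%N := leq_trans N0 le_NM.
rewrite /hamming; set B := [set x : 'I_N | t (widen_ord le_NM x) != _]%SET.
apply: (@le_trans _ _ ((#|B| + (M - N))%N%:R / M%:R)); last first.
  by rewrite ler_wpM2l // lef_pV2 ?posrE ?ltr0n // ler_nat.
rewrite ler_wpM2r ?invr_ge0 // ler_nat.
have winj : injective (widen_ord le_NM).
  by move=> x y /(congr1 val) /= xy; apply: val_inj.
have cW : #|~: (widen_ord le_NM @: [set: 'I_N])%SET| = (M - N)%N.
  by rewrite cardsCs finset.setCK card_ord card_imset // cardsT card_ord.
rewrite -(card_imset _ winj) -cW; apply: leq_trans (leq_card_setU _ _).
apply: subset_leq_card; apply/fintype.subsetP => j; rewrite !inE.
move=> ne; case: (boolP (j \in widen_ord le_NM @: [set: 'I_N]%SET)); last by rewrite orbT.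
move=> /imsetP[x _ jE]; rewrite orbF; rewrite {}jE in ne *.
apply: imset_f; rewrite inE eq_sym; apply: contra ne => /eqP <-.
rewrite permE /extend_fun /= insubT //= => lt.
by apply/eqP; congr (widen_ord _ (s _)); apply: val_inj.
Qed.

End Hamming.

Local Open Scope ring_scope.

Lemma ler_of_eq (R : realType) (x y : R) : x = y -> x <= y.
Proof. by move=> ->. Qed.

(** From [delta = eta ^+ 2] one gets [k <= n * eta ^+ 2 * N], hence at most [2 * k + 16 * sqrt (k *
    n * N) <= 18 * n * eta * N] cuts. The points added, [4 * n * m], are at most
    [72 * n ^+ 2 * eta * N], and each generator moves by at most [(m + 4 * n * m) / N <= 5 * n * m /
    N <= 90 * n ^+ 2 * eta]; [C] collects both. *)
Lemma surface_group_stable (R : realType) (h : nat) (G : groupType)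
    (p : {multiplicative free_group (surface_gen h.+1) -> G}) : (0 < h)%N ->
  is_presentation [set` [:: surface_rel h.+1]] p -> flexibly_stable R G.
Proof.
move=> h0 pres; set g := h.+1; set n := (4 * g)%N.
exists (surface_gen g), [:: surface_rel g], p; split=> // eps eps0.
pose C : R := (n * n * 72 + #|surface_gen g| * (n * n * 90))%N%:R.
have CE : C = n%:R * n%:R * 72 + #|surface_gen g|%:R * (n%:R * n%:R * 90).
  by rewrite /C natrD !natrM.
have C0 : 0 <= C by rewrite ler0n.
pose eta := Num.min 1 (eps / (C + 1)).
have C1 : 0 < C + 1 by lra.
have eta0 : 0 < eta by rewrite lt_min ltr01 divr_gt0.
have eta1 : eta <= 1 by rewrite ge_min lexx.
have Ceta : C * eta < eps.
  have : eta <= eps / (C + 1) by rewrite ge_min lexx orbT.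
  rewrite ler_pdivlMr // mulrDr mulr1 mulrC => H; lra.
exists (eta ^+ 2); first by rewrite exprn_gt0.
move=> N rho N0 small.
pose a i := rho (gen_a (inord i : 'I_g)); pose b i := rho (gen_b (inord i : 'I_g)).
have rel_rho : rho (surface_rel g) = relator h a b.
  rewrite hom_surface_rel /relator big_mkord; apply: eq_bigr => i _.
  by rewrite /a /b inord_val.
have {small}small : hamming R (relator h a b) 1%g < eta ^+ 2.
  by rewrite -rel_rho; apply: small; rewrite inE.
have [U [iota [A [B [m [iinj cU AB rel1 mle]]]]]] := combinatorial_stability h0 a b.
set k := (n * #|[set x | relator h a b x != x]|)%N in mle.
have kN : k%:R <= n%:R * (eta ^+ 2 * N%:R) :> R.
  rewrite /k natrM ler_wpM2l //; move: small; rewrite /hamming ltr_pdivrMr ?ltr0n //.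
  move/ltW; congr (_%:R <= _); apply: eq_card => x; by rewrite !inE perm1.
have kle : (k <= #|'I_N| * n)%N.
  by rewrite /k mulnC leq_mul2r max_card orbT.
have mle' : m%:R <= 18 * n%:R * eta * N%:R :> R.
  have mR : m%:R <= (2 * k + cut_cost (#|'I_N| * n)%N k)%N%:R :> R by rewrite ler_nat.
  apply: le_trans mR _; rewrite natrD natrM.
  have := cut_cost_sqrt R kle; rewrite -sqrtrM // card_ord natrM => cle.
  have sle : Num.sqrt (k%:R * (N%:R * n%:R)) <= n%:R * eta * N%:R :> R.
    rewrite -[leRHS]ger0_norm ?mulr_ge0 ?(ltW eta0) // -sqrtr_sqr ler_wsqrtr //.
    apply: le_trans (_ : n%:R * (eta ^+ 2 * N%:R) * (N%:R * n%:R) <= _).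
      by rewrite ler_wpM2r // mulr_ge0.
    by rewrite !exprMn !expr2; apply: ler_of_eq; move: (n%:R : R) => ?; ring.
  have e2 : eta ^+ 2 <= eta by rewrite expr2 ler_piMl // ltW.
  have kle2 : k%:R <= n%:R * eta * N%:R :> R.
    by apply: le_trans kN _; rewrite mulrA ler_wpM2r // ler_wpM2l.
  lra.
have NU : (N <= #|U|)%N by rewrite -[N]card_ord -(card_imset _ iinj) max_card.
have [f [f' [fK f'K fi]]] := extend_bijection NU iinj erefl.
pose rho0 := fg_lift (fun s : surface_gen g => transport fK f'K (if s.2 then B s.1 else A s.1)).
pose rho' : {multiplicative free_group (surface_gen g) -> 'S_#|U|} := rho0.
have cUR : #|U|%:R <= N%:R + 4 * n%:R * m%:R :> R.
  by rewrite -!natrM -natrD ler_nat; move: cU; rewrite card_ord.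
exists #|U|, NU, rho'; split.
- apply: le_trans cUR _; rewrite [leRHS]mulrDl mul1r lerD2l.
  apply: le_trans (_ : C * eta * N%:R <= _); last by rewrite ler_wpM2r // ltW.
  apply: le_trans (_ : 4 * n%:R * (18 * n%:R * eta * N%:R) <= _).
    by rewrite ler_wpM2l // mulr_ge0.
  rewrite CE; set c := #|surface_gen g|%:R.
  have : 0 <= c * (n%:R * n%:R * 90) * eta * N%:R :> R by rewrite !mulr_ge0 // ltW.
  move=> H; rewrite -subr_ge0; apply: le_trans H _; apply: ler_of_eq; move: (n%:R : R) => ?; ring.
- apply: presentation_factor pres _ => r /=; rewrite inE => /eqP ->.
  rewrite hom_surface_rel /=.
  have := congr1 (transport fK f'K) rel1; rewrite big_mkord multiplicative1 => relT.
  apply: etrans relT.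
  rewrite (big_morph (transport fK f'K) (transportM fK f'K) (multiplicative1 _)).
  by apply: eq_bigr => i _; rewrite hom_comm !fg_lift_generator.
- apply: le_lt_trans Ceta; rewrite /hom_dist.
  apply: le_trans (_ : \sum_(s : surface_gen g) ((m + (4 * n * m))%N%:R / N%:R) <= _).
    apply: ler_sum => s _; apply: le_trans (hamming_extend _ _ _ _ N0) _.
    rewrite ler_wpM2r ?invr_ge0 // ler_nat leq_add //; last first.
      by rewrite leq_subLR; move: cU; rewrite card_ord.
    have [cA cB] := AB s.1 (ltn_ord _).
    rewrite /rho' /= fg_lift_generator.
    case: s cA cB => i [] /= cA cB.
      apply: leq_trans cB; apply: subset_leq_card; apply/fintype.subsetP => x.
      rewrite !inE -fi transportE; apply: contra => /eqP ->.
      by rewrite /b inord_val fi.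
    apply: leq_trans cA; apply: subset_leq_card; apply/fintype.subsetP => x.
    rewrite !inE -fi transportE; apply: contra => /eqP ->.
    by rewrite /a inord_val fi.
  rewrite sumr_const -[leLHS]mulr_natl.
  have -> : #|(xpredT : pred (surface_gen g))| = #|surface_gen g| by apply: eq_card.
  have NR : 0 < N%:R :> R by rewrite ltr0n.
  have mE : (m + 4 * n * m)%N%:R = m%:R + 4 * n%:R * m%:R :> R by rewrite natrD !natrM.
  rewrite mulrA ler_pdivrMr // CE mE.
  set c := #|surface_gen g|%:R.
  have n1 : 1 <= n%:R :> R by rewrite ler1n.
  have c0 : 0 <= c by rewrite ler0n.
  have H1 : m%:R + 4 * n%:R * m%:R <= n%:R * (5 * (18 * n%:R * eta * N%:R)) :> R.
    have : m%:R <= n%:R * m%:R :> R by rewrite ler_peMl.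
    have : n%:R * m%:R <= n%:R * (18 * n%:R * eta * N%:R) :> R by rewrite ler_wpM2l.
    lra.
  apply: le_trans (_ : c * (n%:R * (5 * (18 * n%:R * eta * N%:R))) <= _).
    by rewrite ler_wpM2l.
  have : 0 <= n%:R * n%:R * 72 * eta * N%:R :> R by rewrite !mulr_ge0 // ltW.
  move=> H; rewrite -subr_ge0; apply: le_trans H _; apply: ler_of_eq; move: (n%:R : R) => ?; ring.
Qed.

(** * Homotopies of paths *)

Import numFieldNormedType.Exports.
Local Open Scope classical_set_scope.
Local Open Scope ring_scope.
Local Open Scope quotient_scope.

Section Paths.
Variables (R : realType) (X : topologicalType).
Implicit Types f g h p : R -> X.

(** Paths and homotopies live on the whole line and plane, so no subspace types occur; only the
    parameters 0 and 1 are held fixed. *)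
Definition ph f g := exists H : R * R -> X,
  [/\ continuous H, forall s, H (s, 0) = f s, forall s, H (s, 1) = g s,
      forall u, H (0, u) = f 0 & forall u, H (1, u) = f 1].

Definition pcat f g (s : R) : X := if s <= 2^-1 then f (2 * s) else g (2 * s - 1).
Definition prev_path f (s : R) : X := f (1 - s).

Lemma fst_cont : continuous (fst : R * R -> R).
Proof. by move=> ?; exact: cvg_fst. Qed.

Lemma id_cont : continuous (id : R -> R).
Proof. by move=> s A. Qed.

Lemma two1B1 : 2 * 1 - 1 = 1 :> R.
Proof. by lra. Qed.

Lemma snd_cont : continuous (snd : R * R -> R).
Proof. by move=> ?; exact: cvg_snd. Qed.

(** Straight-line homotopy between the parameters; associativity, units and inverses are
    instances. *)
Lemma ph_reparam p (phi psi : R -> R) f g :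
  continuous p -> continuous phi -> continuous psi -> phi 0 = psi 0 -> phi 1 = psi 1 ->
  (forall s, f s = p (phi s)) -> (forall s, g s = p (psi s)) -> ph f g.
Proof.
move=> pc phic psic e0 e1 fE gE.
exists (fun su => p ((1 - su.2) * phi su.1 + su.2 * psi su.1)); split=> /= [|s|s|u|u].
- apply: comp_continuous => // su; apply: cvgD; apply: cvgM.
  + by apply: cvgB; [exact: cvg_cst|exact: snd_cont].
  + exact: (comp_continuous phic fst_cont).
  + exact: snd_cont.
  + exact: (comp_continuous psic fst_cont).
- by rewrite subr0 mul1r mul0r addr0 fE.
- by rewrite subrr mul1r mul0r add0r gE.
- by rewrite -e0 -mulrDl subrK mul1r fE.
- by rewrite -e1 -mulrDl subrK mul1r fE.
Qed.

Lemma ph_ext f g : continuous f -> f =1 g -> ph f g.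
Proof.
by move=> fc fg; exact: (ph_reparam fc id_cont id_cont).
Qed.

Lemma ph_refl f : continuous f -> ph f f.
Proof. by move=> fc; exact: ph_ext. Qed.

Lemma ph_ends f g : ph f g -> g 0 = f 0 /\ g 1 = f 1.
Proof. by move=> [H [_ _ Hg H0 H1]]; rewrite -!Hg H0 H1. Qed.

Lemma ph_cont f g : ph f g -> continuous f /\ continuous g.
Proof.
move=> [H [Hc Hf Hg _ _]]; split.
  rewrite (_ : f = (fun s => H (s, 0))); last by apply/funext => s; rewrite Hf.
  by apply: comp_continuous => //; apply: (pair_continuous id_cont); exact: cst_continuous.
rewrite (_ : g = (fun s => H (s, 1))); last by apply/funext => s; rewrite Hg.
by apply: comp_continuous => //; apply: (pair_continuous id_cont); exact: cst_continuous.
Qed.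

Lemma ph_sym f g : ph f g -> ph g f.
Proof.
move=> fg; have [g0 g1] := ph_ends fg; case: fg => [H [Hc Hf Hg H0 H1]].
exists (fun su => H (su.1, 1 - su.2)); split=> /= [|s|s|u|u].
- apply: comp_continuous => //; apply: pair_continuous; first exact: fst_cont.
  exact/opp1_continuous/snd_cont.
- by rewrite subr0.
- by rewrite subrr.
- by rewrite H0.
- by rewrite H1.
Qed.

Lemma ph_trans f g h : ph f g -> ph g h -> ph f h.
Proof.
move=> fg; have [g0 g1] := ph_ends fg.
case: fg => [H [Hc Hf Hg H0 H1]] [K [Kc Kg Kh K0 K1]].
exists (fun su => if su.2 <= 2^-1 then H (su.1, 2 * su.2) else K (su.1, 2 * su.2 - 1)).
split=> /= [|s|s|u|u]; rewrite ?H0 ?K0 ?H1 ?K1 ?g0 ?g1 ?if_same //.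
- apply: continuous_if_le; first exact: snd_cont.
  + apply: comp_continuous => //; apply: pair_continuous; first exact: fst_cont.
    exact/scale_continuous/snd_cont.
  + apply: comp_continuous => //; apply: pair_continuous; first exact: fst_cont.
    exact/affine_continuous/snd_cont.
  + by move=> su ->; rewrite mulfV // subrr Hg Kg.
- by rewrite ifT ?mulr0 ?Hf //; lra.
- by rewrite ifF ?two1B1 ?Kh //; apply/negbTE; rewrite -ltNge; lra.
Qed.

Lemma pcat_cont f g : continuous f -> continuous g -> f 1 = g 0 -> continuous (pcat f g).
Proof.
move=> fc gc fg; apply: (@continuous_if_le _ _ _ id) => //.
- exact: id_cont.
- by apply: comp_continuous => //; apply: scale_continuous; exact: id_cont.
- by apply: comp_continuous => //; apply: affine_continuous; exact: id_cont.
- by move=> s ->; rewrite mulfV // subrr fg.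
Qed.

Lemma pcat0 f g : pcat f g 0 = f 0.
Proof. by rewrite /pcat ifT ?mulr0 //; lra. Qed.

Lemma pcat1 f g : pcat f g 1 = g 1.
Proof. by rewrite /pcat ifF; [congr g; lra|lra]. Qed.

Lemma prev_path_cont f : continuous f -> continuous (prev_path f).
Proof.
by move=> fc; apply: comp_continuous => //; apply: opp1_continuous; exact: id_cont.
Qed.

Lemma ph_pcat f f' g g' : ph f f' -> ph g g' -> f 1 = g 0 -> ph (pcat f g) (pcat f' g').
Proof.
move=> [H [Hc Hf Hg H0 H1]] [K [Kc Kf Kg K0 K1]] fg.
exists (fun su => if su.1 <= 2^-1 then H (2 * su.1, su.2) else K (2 * su.1 - 1, su.2)).
split=> /= [|s|s|u|u].
- apply: continuous_if_le; first exact: fst_cont.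
  + apply: comp_continuous => //; apply: pair_continuous; last exact: snd_cont.
    exact/scale_continuous/fst_cont.
  + apply: comp_continuous => //; apply: pair_continuous; last exact: snd_cont.
    exact/affine_continuous/fst_cont.
  + by move=> su ->; rewrite mulfV // subrr H1 K0.
- by rewrite /pcat Hf Kf.
- by rewrite /pcat Hg Kg.
- by rewrite pcat0 ifT ?mulr0 ?H0 //; lra.
- by rewrite pcat1 ifF ?two1B1 ?K1 //; apply/negbTE; rewrite -ltNge; lra.
Qed.

Lemma ph_assoc f g h : continuous f -> continuous g -> continuous h ->
  f 1 = g 0 -> g 1 = h 0 -> ph (pcat f (pcat g h)) (pcat (pcat f g) h).
Proof.
move=> fc gc hc fg gh.
pose phi (s : R) : R := Num.max (s / 2) (Num.max (s - 4^-1) (2 * s - 1)).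
apply: (@ph_reparam (pcat (pcat f g) h) phi id).
- by do 2?apply: pcat_cont; rewrite ?pcat1.
- apply: maxr_continuous; last apply: maxr_continuous.
  + by move=> s; apply: cvgM; [exact: id_cont|exact: cvg_cst].
  + by move=> s; apply: cvgB; [exact: id_cont|exact: cvg_cst].
  + by apply: affine_continuous; exact: id_cont.
- exact: id_cont.
- by rewrite /phi mul0r !sub0r mulr0 sub0r max_l // ge_max; lra.
- by rewrite /phi max_r // ?max_r; lra.
- move=> s; rewrite /pcat.
  have [s2|s2] := leP s 2^-1.
    have -> : phi s = s / 2 by rewrite /phi max_l // ge_max; lra.
    have -> : 2 * (s / 2) = s by lra.
    by rewrite s2 ifT //; lra.
  have [s3|s3] := leP (2 * s - 1) 2^-1.
    have -> : phi s = s - 4^-1 by rewrite /phi max_r ?max_l //; lra.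
    rewrite ifT; last by lra.
    by rewrite ifF; [congr g; lra|lra].
  have -> : phi s = 2 * s - 1.
    by rewrite /phi [X in Num.max _ X]max_r ?max_r //; lra.
  by rewrite ifF //; apply/negbTE; rewrite -ltNge.
- by [].
Qed.

Lemma ph_1cat f : continuous f -> ph (pcat (cst (f 0)) f) f.
Proof.
move=> fc; apply: (@ph_reparam f (fun s => Num.max 0 (2 * s - 1)) id) => //.
- apply: maxr_continuous; first exact: cst_continuous.
  by apply: affine_continuous; exact: id_cont.
- exact: id_cont.
- by rewrite max_l //; lra.
- by rewrite max_r //; lra.
- move=> s; rewrite /pcat; have [s2|s2] := leP s 2^-1; last by rewrite max_r //; lra.
  by rewrite max_l //; lra.
Qed.

Lemma ph_cat1 f : continuous f -> ph (pcat f (cst (f 1))) f.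
Proof.
move=> fc; apply: (@ph_reparam f (fun s => Num.min 1 (2 * s)) id) => //.
- apply: minr_continuous; first exact: cst_continuous.
  by apply: scale_continuous; exact: id_cont.
- exact: id_cont.
- by rewrite min_r //; lra.
- by rewrite min_l //; lra.
- move=> s; rewrite /pcat; have [s2|s2] := leP s 2^-1; first by rewrite min_r //; lra.
  by rewrite min_l //; lra.
Qed.

Lemma ph_revcat f : continuous f -> ph (pcat (prev_path f) f) (cst (f 1)).
Proof.
move=> fc; apply: (@ph_reparam f (fun s => Num.max (1 - 2 * s) (2 * s - 1)) (cst 1)) => //.
- apply: maxr_continuous; last by apply: affine_continuous; exact: id_cont.
  by apply/opp1_continuous/scale_continuous; exact: id_cont.
- exact: cst_continuous.
- by rewrite /cst max_l //; lra.
- by rewrite /cst max_r //; lra.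
- move=> s; rewrite /pcat /prev_path; have [s2|s2] := leP s 2^-1.
    by rewrite max_l //; lra.
  by rewrite max_r //; lra.
Qed.

End Paths.
Arguments fst_cont {R}.
Arguments snd_cont {R}.
Arguments id_cont {R}.

(** * Classes of paths in the fundamental group *)

Section PathClass.
Variables (R : realType) (X : topologicalType) (x0 : X).
Local Notation I := (unit_interval R).
Implicit Types f g : R -> X.

Definition based f := [/\ continuous f, f 0 = x0 & f 1 = x0].

Lemma based_loop f : based f -> exists c : loop R x0, forall s, c s = f (val s).
Proof.
move=> [fc f0 f1].
have cc : continuous (fun s : I => f (val s)).
  by apply: comp_continuous => //; exact: val_I_continuous.
have c0 : f (val (zero : I)) = x0 by rewrite val_zero.
have c1 : f (val (one : I)) = x0 by rewrite val_one.
by exists (mk_path cc c0 c1).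
Qed.

(** The constant loop is a default for paths not based at [x0]; it makes [cls] total. *)
Definition loopify f : loop R x0 :=
  if pselect (based f) is left bf then sval (cid (based_loop bf)) else cst_loop R x0.

Lemma loopifyE f : based f -> forall s, loopify f s = f (val s).
Proof.
by move=> bf s; rewrite /loopify; case: pselect => // bf'; case: (cid (based_loop bf')).
Qed.

Definition cls f : pi1 R x0 := \pi_(pi1 R x0) (loopify f).

Lemma cls_ph f g : ph f g -> based f -> cls f = cls g.
Proof.
move=> fg bf; have [fc gc] := ph_cont fg; have [g0 g1] := ph_ends fg.
have bg : based g by case: bf => _ f0 f1; split; rewrite ?g0 ?g1.
case: (bf) => _ f0 f1; case: fg => H [Hc Hf Hg H0 H1].
apply/eq_pi1; exists (fun su : I * I => H (val su.1, val su.2)); split.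
- apply: comp_continuous => //; apply: pair_continuous.
    exact: fst_val_continuous.
  exact: snd_val_continuous.
- by move=> s; rewrite loopifyE // -Hf; congr (H (_, _)); exact: val_zero.
- by move=> s; rewrite loopifyE // -Hg; congr (H (_, _)); exact: val_one.
- by move=> s; rewrite -f0 -(H0 (val s)); congr (H (_, _)); exact: val_zero.
- by move=> s; rewrite -f1 -(H1 (val s)); congr (H (_, _)); exact: val_one.
Qed.

Lemma loop_homotopic_ext (c d : loop R x0) : (forall s, c s = d s) -> loop_homotopic c d.
Proof.
move=> cd; have [H [Hc H0 H1 ? ?]] := loop_homotopic_refl c.
by exists H; split=> // s; rewrite H1.
Qed.

Lemma cls_pcat f g : based f -> based g -> cls (pcat f g) = (cls f * cls g)%g.
Proof.
move=> bf bg; rewrite /cls -[RHS]/(pi1_mul _ _) pi1_mulE; apply/eq_pi1/loop_homotopic_ext.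
have bfg : based (pcat f g).
  case: bf bg => [fc f0 f1] [gc g0 g1].
  by split; [apply: pcat_cont; rewrite ?f1|rewrite pcat0|rewrite pcat1].
move=> s; rewrite loopifyE // cat_loopE; have /andP[s0 s1] := val_I_itv s.
rewrite /pcat; case: ifPn => s2; rewrite loopifyE // val_to_I //.
  by apply/andP; split; lra.
by rewrite -ltNge in s2; apply/andP; split; lra.
Qed.

Lemma cls_loop (c : loop R x0) : cls (fun s => c (to_I s)) = \pi_(pi1 R x0) c.
Proof.
apply/eq_pi1/loop_homotopic_ext => s; rewrite loopifyE ?to_I_val //; split.
- by apply: comp_continuous; [exact: loop_continuous|exact: to_I_continuous].
- by rewrite to_I0 ?path_zero.
- by rewrite to_I1 ?path_one.
Qed.

Lemma cls_surj (a : pi1 R x0) : exists2 f, based f & cls f = a.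
Proof.
elim/quotW: a => c; exists (fun s => c (to_I s)); last exact: cls_loop.
split; first by apply: comp_continuous; [exact: loop_continuous|exact: to_I_continuous].
- by rewrite to_I0 ?path_zero.
- by rewrite to_I1 ?path_one.
Qed.

Section Tails.
Variable tail : X -> R -> X.
Hypotheses (tail_cont : forall y, continuous (tail y)) (tail0 : forall y, tail y 0 = x0)
  (tail1 : forall y, tail y 1 = y) (tail_x0 : tail x0 = cst x0).

(** Closing up with chosen tails extends the class of a loop to all paths: [path_class] is a functor
    from the fundamental groupoid to the group at [x0]. *)
Definition tailed f := pcat (tail (f 0)) (pcat f (prev_path (tail (f 1)))).
Definition path_class f : pi1 R x0 := cls (tailed f).

Let rev0 y : prev_path (tail y) 0 = y. Proof. by rewrite /prev_path subr0. Qed.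
Let rev1 y : prev_path (tail y) 1 = x0. Proof. by rewrite /prev_path subrr. Qed.
Let revc y : continuous (prev_path (tail y)). Proof. exact: prev_path_cont. Qed.

Lemma tailed_based f : continuous f -> based (tailed f).
Proof.
move=> fc; split; rewrite /tailed ?pcat0 ?pcat1 ?tail0 ?rev1 //.
by apply: pcat_cont; rewrite ?pcat0 ?tail1 //; apply: pcat_cont; rewrite ?rev0.
Qed.

Lemma cl_ph f g : ph f g -> path_class f = path_class g.
Proof.
move=> fg; have [fc gc] := ph_cont fg; have [g0 g1] := ph_ends fg.
apply: cls_ph; last exact: tailed_based.
rewrite /tailed g0 g1; apply: ph_pcat; [exact: ph_refl| |by rewrite pcat0 tail1].
by apply: ph_pcat; [|exact: ph_refl|rewrite rev0].
Qed.

Lemma cl_pcat f g : continuous f -> continuous g -> f 1 = g 0 ->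
  path_class (pcat f g) = (path_class f * path_class g)%g.
Proof.
move=> fc gc fg; rewrite /path_class -cls_pcat; try exact: tailed_based.
apply/esym/cls_ph; last first.
  have [c1 c10 c11] := tailed_based fc; have [c2 c20 c21] := tailed_based gc.
  by split; [apply: pcat_cont; rewrite ?c11|rewrite pcat0|rewrite pcat1].
rewrite /tailed pcat0 pcat1 fg.
set T0 := tail (f 0); set T := tail (g 0); set T1 := prev_path (tail (g 1)).
have T0c : continuous T0 by exact: tail_cont.
have Tc : continuous T by exact: tail_cont.
have rTc : continuous (prev_path T) by exact: revc.
have T1c : continuous T1 by exact: revc.
have T00 : T0 0 = x0 by exact: tail0.
have T01 : T0 1 = f 0 by exact: tail1.
have TE0 : T 0 = x0 by exact: tail0.
have TE1 : T 1 = g 0 by exact: tail1.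
have T10 : T1 0 = g 1 by exact: rev0.
have rT0 : prev_path T 0 = g 0 by exact: rev0.
have rT1 : prev_path T 1 = x0 by exact: rev1.
clearbody T0 T T1.
have gT1c : continuous (pcat g T1) by apply: pcat_cont.
have TgT1c : continuous (pcat T (pcat g T1)) by apply: pcat_cont; rewrite ?pcat0.
have fTc : continuous (pcat f (prev_path T)) by apply: pcat_cont; rewrite ?rT0.
apply: ph_trans (ph_sym (ph_assoc _ _ _ _ _)) _; rewrite ?pcat0 ?pcat1 ?T01 ?rT1 //.
apply: ph_pcat; [exact: ph_refl| |by rewrite !pcat0].
apply: ph_trans (ph_sym (ph_assoc _ _ _ _ _)) _; rewrite ?pcat0 ?pcat1 ?rT0 ?rT1 ?TE0 //.
apply: (@ph_trans _ _ _ (pcat f (pcat g T1))); last by apply: ph_assoc; rewrite ?T10.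
apply: ph_pcat; [exact: ph_refl| |by rewrite pcat0 rT0].
apply: ph_trans (ph_assoc _ _ _ _ _) _; rewrite ?pcat0 ?rT1 ?TE0 ?TE1 //.
apply: ph_trans (ph_pcat (ph_revcat Tc) (ph_refl gT1c) _) _.
  by rewrite pcat0 pcat1.
by rewrite TE1 -(pcat0 g T1); exact: ph_1cat.
Qed.

Lemma cl_based f : based f -> path_class f = cls f.
Proof.
move=> [fc f0 f1]; apply: cls_ph; last exact: tailed_based.
rewrite /tailed f0 f1 tail_x0.
have -> : prev_path (cst x0) = cst x0 by [].
have xc : continuous (cst x0 : R -> X) by exact: cst_continuous.
apply: ph_trans (ph_pcat (ph_refl xc) (ph_pcat (ph_refl fc) (ph_refl xc) _) _) _ => //.
  by rewrite pcat0.
apply: ph_trans (ph_pcat (ph_refl xc) (g' := f) _ _) _; rewrite ?pcat0 //.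
  by rewrite -[X in cst X]f1; exact: ph_cat1.
by rewrite -[X in cst X]f0; exact: ph_1cat.
Qed.

Lemma cl_cst y : path_class (cst y) = 1%g.
Proof.
have yc : continuous (cst y : R -> X) by exact: cst_continuous.
apply: (mulgI (path_class (cst y))); rewrite mulg1 -cl_pcat //; apply: cl_ph.
by apply: (ph_ext (pcat_cont yc yc _)) => // s; rewrite /pcat if_same.
Qed.

Lemma cl_plane (K : R * R -> X) (r r' : R -> R * R) :
  continuous K -> continuous r -> continuous r' -> r 0 = r' 0 -> r 1 = r' 1 ->
  path_class (K \o r) = path_class (K \o r').
Proof.
move=> Kc rc r'c e0 e1; apply: cl_ph.
exists (fun su => K ((1 - su.2) * (r su.1).1 + su.2 * (r' su.1).1,
                     (1 - su.2) * (r su.1).2 + su.2 * (r' su.1).2)).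
have r1c : continuous (fun su : R * R => (r su.1).1).
  exact: (comp_continuous fst_cont (comp_continuous rc fst_cont)).
have r2c : continuous (fun su : R * R => (r su.1).2).
  exact: (comp_continuous snd_cont (comp_continuous rc fst_cont)).
have r'1c : continuous (fun su : R * R => (r' su.1).1).
  by apply: comp_continuous fst_cont _; apply: comp_continuous r'c fst_cont.
have r'2c : continuous (fun su : R * R => (r' su.1).2).
  by apply: comp_continuous snd_cont _; apply: comp_continuous r'c fst_cont.
have cmb (A B : R * R -> R) : continuous A -> continuous B ->
    continuous (fun su : R * R => (1 - su.2) * A su + su.2 * B su).
  move=> Ac Bc su; apply: cvgD; apply: cvgM; try exact: snd_cont.
  - by apply: cvgB; [exact: cvg_cst|exact: snd_cont].
  - exact: Ac.
  - exact: Bc.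
split=> /= [|s|s|u|u].
- by apply: comp_continuous => //; apply: pair_continuous; exact: cmb.
- by rewrite subr0 !mul1r !mul0r !addr0 -surjective_pairing.
- by rewrite subrr !mul1r !mul0r !add0r -surjective_pairing.
- by rewrite -e0 -!mulrDl subrK !mul1r -surjective_pairing.
- by rewrite -e1 -!mulrDl subrK !mul1r -surjective_pairing.
Qed.

End Tails.
End PathClass.

(** * The polygon and its gluing *)

Section Clamp.
Variable R : realType.
Implicit Type x : R.

Lemma clamp_itv x : 0 <= clamp x <= 1.
Proof. by have := clamp_in x; rewrite inE /= in_itv. Qed.

Lemma clamp_continuous : continuous (@clamp R).
Proof.
apply: maxr_continuous; first exact: cst_continuous.
by apply: minr_continuous; [exact: id_cont|exact: cst_continuous].
Qed.

Lemma clampK x : clamp (clamp x) = clamp x.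
Proof. exact: clamp_id (clamp_itv x). Qed.

Lemma clamp_eq0 x : (clamp x == 0) = (x <= 0).
Proof. by rewrite /clamp eq_maxl ge_min ler10 orbF. Qed.

Lemma clamp_eq1 x : (clamp x == 1) = (1 <= x).
Proof.
rewrite /clamp; apply/eqP/idP => [|x1]; last by rewrite min_r // max_r.
by case: (leP x 1) => x1; case: (leP 0 _) => ?; lra.
Qed.

End Clamp.

Section Angles.
Variable R : realType.
Implicit Types a b x : R.

Lemma periodic_int (T : Type) (f : R -> T) (p : R) : (forall x, f (x + p) = f x) ->
  forall (k : int) x, f (x + p * k%:~R) = f x.
Proof.
move=> fp; have fn (m : nat) x : f (x + p * m%:R) = f x.
  elim: m x => [|m IHm] x; first by rewrite mulr0 addr0.
  by rewrite -[m.+1]addn1 natrD mulrDr mulr1 addrA fp.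
move=> [m|m] x; first exact: fn.
by rewrite NegzE mulrNz mulrN -[LHS](fn m.+1) subrK.
Qed.

Lemma cos_eq1 x : cos x = 1 -> exists k : int, x = pi *+ 2 * k%:~R.
Proof.
have pi0 := pi_gt0 R; have p2 : 0 < (pi : R) *+ 2 by rewrite mulrn_wgt0.
pose k := Num.floor (x / (pi *+ 2)); pose y := x - pi *+ 2 * k%:~R.
move=> cx; exists k; apply/eqP; rewrite -subr_eq0 -/y; apply/eqP.
have y0 : 0 <= y.
  by rewrite subr_ge0 mulrC -ler_pdivlMr // Num.Theory.floor_le.
have y2 : y < pi *+ 2.
  rewrite ltrBlDr -[X in X + _]mulr1 -mulrDr mulrC -ltr_pdivrMr //.
  by rewrite addrC -[1]/(1%:~R) -intrD Num.Theory.floorD1_gt.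
have cy : cos y = 1.
  by rewrite -(periodic_int (@cosD2pi R) k) subrK.
have in0 : (0 : R) \in `[0, pi] by rewrite in_itv /= lexx ltW.
have [yp|yp] := leP y pi.
  by apply: (cos_inj _ in0); rewrite ?cos0 // in_itv /= y0.
have : pi *+ 2 - y = 0.
  apply: (cos_inj _ in0); last by rewrite cos0 -cy -[RHS]cosN addrC cosD2pi.
  by rewrite in_itv /=; lra.
lra.
Qed.

Lemma cos_sin_eq a b : cos a = cos b -> sin a = sin b ->
  exists k : int, a = b + pi *+ 2 * k%:~R.
Proof.
move=> cab sab; have [k kE] : exists k : int, a - b = pi *+ 2 * k%:~R.
  by apply: cos_eq1; rewrite cosB cab sab -!expr2 cos2Dsin2.
by exists k; rewrite -kE addrC subrK.
Qed.

Lemma circle_angle (x y : R) : x ^+ 2 + y ^+ 2 = 1 ->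
  exists2 a, 0 <= a <= pi *+ 2 & cos a = x /\ sin a = y.
Proof.
move=> xy; have pi0 := pi_gt0 R.
have x1 : -1 <= x <= 1.
  have y2 := sqr_ge0 y; have : x ^+ 2 <= 1 by lra.
  by rewrite -ler_norml -[`|x|](sqrtr_sqr) => ?; rewrite -sqrtr1 ler_wsqrtr.
have a0 := acos_ge0 x1; have ap := acos_lepi x1.
have ca : cos (acos x) = x by apply: acosK; rewrite in_itv.
have sa : sin (acos x) = `|y| by rewrite sin_acos // -sqrtr_sqr; congr Num.sqrt; lra.
have [y0|y0] := leP 0 y.
  by exists (acos x); [lra|rewrite ca sa ger0_norm].
exists (pi *+ 2 - acos x); first by lra.
by rewrite addrC cosD2pi sinD2pi cosN sinN ca sa ltr0_norm // opprK.
Qed.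

End Angles.

Section Polar.
Variables (R : realType) (g : nat).
Hypothesis g0 : (0 < g)%N.
Local Notation n := ((4 * g)%N%:R : R).
Implicit Type r : R * R.

Lemma n_gt0 : 0 < n.
Proof. by rewrite ltr0n muln_gt0. Qed.

Lemma polar_subproof r : (clamp r.1 * cos (angle g r.2), clamp r.1 * sin (angle g r.2)) \in
  [set z : R * R | z.1 ^+ 2 + z.2 ^+ 2 <= 1].
Proof.
rewrite inE /= !exprMn -mulrDr cos2Dsin2 mulr1.
by have /andP[c0 c1] := clamp_itv r.1; rewrite expr_le1.
Qed.

Definition polar r : disk R :=
  exist _ (clamp r.1 * cos (angle g r.2), clamp r.1 * sin (angle g r.2)) (polar_subproof r).

Lemma angle_continuous : continuous (@angle R g).
Proof.
rewrite (_ : angle g = (fun t : R => (2 * pi / n) * t)).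
  by apply: scale_continuous; exact: id_cont.
by apply/funext => t; rewrite /angle mulrAC.
Qed.

Lemma polar_continuous : continuous polar.
Proof.
apply: continuous_comp_initial.
have -> : set_val \o polar =
  (fun r => (clamp r.1 * cos (angle g r.2), clamp r.1 * sin (angle g r.2))) by [].
have cc : continuous (fun r => clamp r.1) := comp_continuous (@clamp_continuous R) fst_cont.
have ac : continuous (fun r => angle g r.2) := comp_continuous angle_continuous snd_cont.
apply: pair_continuous => r; apply: cvgM; try exact: cc.
  exact: (comp_continuous (@continuous_cos R) ac).
exact: (comp_continuous (@continuous_sin R) ac).
Qed.

Lemma polar1 t : polar (1, t) = boundary_point g t.
Proof. by apply: val_inj; rewrite /= clamp1 !mul1r. Qed.

Lemma disk_eq (z w : disk R) : val z = val w -> z = w.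
Proof. exact: val_inj. Qed.

Lemma polar_surj (w : disk R) :
  exists r, [/\ 0 <= r.1 <= 1, 0 <= r.2 <= n & polar r = w].
Proof.
have w1 : (val w).1 ^+ 2 + (val w).2 ^+ 2 <= 1 by have := valP w; rewrite inE.
move: w1; set x := (val w).1; set y := (val w).2 => w1.
have ww : val w = (x, y) by rewrite /x /y; case: (val w).
pose rho := Num.sqrt (x ^+ 2 + y ^+ 2).
have s0 : 0 <= x ^+ 2 + y ^+ 2 by rewrite addr_ge0 ?sqr_ge0.
have rho2 : rho ^+ 2 = x ^+ 2 + y ^+ 2 by rewrite sqr_sqrtr.
have rho0 : 0 <= rho by rewrite sqrtr_ge0.
have rho1 : rho <= 1 by rewrite -[leRHS]sqrtr1 ler_wsqrtr.
have [a a2 [ca sa]] : exists2 a : R, 0 <= a <= pi *+ 2 & rho * cos a = x /\ rho * sin a = y.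
  have [r0|r0] := eqVneq rho 0.
    exists 0; first by rewrite lexx mulrn_wge0 // pi_ge0.
    have : x ^+ 2 + y ^+ 2 = 0 by rewrite -rho2 r0 expr0n.
    move/eqP; rewrite paddr_eq0 ?sqr_ge0 // !sqrf_eq0 => /andP[/eqP -> /eqP ->].
    by rewrite r0 !mul0r.
  have [|a a2 [ca sa]] := @circle_angle R (x / rho) (y / rho).
    by rewrite !expr_div_n -mulrDl rho2 divff // -rho2 sqrf_eq0.
  by exists a => //; rewrite ca sa ![rho * _]mulrC !divfK.
have pi0 := pi_gt0 R; have n0 := n_gt0.
exists (rho, a * n / (pi *+ 2)); split=> /=.
- by rewrite rho0.
- move/andP: a2 => [a0 a2]; have p2 : 0 < (pi : R) *+ 2 by rewrite mulrn_wgt0.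
  rewrite divr_ge0 ?mulr_ge0 ?(ltW p2) //= ler_pdivrMr // mulrC.
  by rewrite ler_wpM2l.
- apply: disk_eq; rewrite ww /= clamp_id ?rho0 //.
  have -> : angle g (a * n / (pi *+ 2)) = a.
    rewrite /angle -[pi *+ 2]mulr_natl; move: (n) (pi : R) n0 pi0 => m q m0 q0; field.
    by rewrite !gt_eqF.
  by rewrite ca sa.
Qed.

(** Two points with the same image have the same clamped radius, and either this is 0 or their
    angular coordinates differ by a multiple of the period. *)
Lemma polar_fiber (Z : Type) (Phi : R * R -> Z) :
  (forall r, Phi r = Phi (clamp r.1, r.2)) -> (forall t t', Phi (0, t) = Phi (0, t')) ->
  (forall rho t, Phi (rho, t + n) = Phi (rho, t)) ->
  forall r r', polar r = polar r' -> Phi r = Phi r'.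
Proof.
move=> Phic Phi0 Phin [rho t] [rho' t'] /(congr1 val) [/= cc ss].
rewrite Phic [RHS]Phic /=.
have rr : clamp rho = clamp rho'.
  have /andP[c0 _] := clamp_itv rho; have /andP[c0' _] := clamp_itv rho'.
  apply/eqP; rewrite -(@eqrXn2 _ 2) // -[X in X == _]mulr1 -[X in _ == X]mulr1.
  by rewrite -{1}(cos2Dsin2 (angle g t)) -(cos2Dsin2 (angle g t')) !mulrDr -!exprMn cc ss.
rewrite -rr in cc ss *; have [c0|c0] := eqVneq (clamp rho) 0; first by rewrite c0.
have [k kE] := cos_sin_eq (mulfI c0 cc) (mulfI c0 ss).
have n0 := n_gt0; have pi0 := pi_gt0 R.
have -> : t = t' + n * k%:~R.
  move: kE; rewrite /angle -[pi *+ 2]mulr_natl; move: (n) (pi : R) n0 pi0 => m q m0 q0 /(congr1 (fun x => x * m / (2 * q))).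
  set K := k%:~R => E.
  have -> : t = 2 * q * t / m * m / (2 * q) by field; rewrite !gt_eqF.
  by rewrite E; field; rewrite !gt_eqF.
exact: (periodic_int (f := fun t => Phi (clamp rho, t))).
Qed.

Lemma disk_hausdorff : hausdorff_space (disk R).
Proof.
have RR : hausdorff_space (R * R)%type.
  exact: norm_hausdorff.
move=> z w zw; apply: disk_eq; apply: RR => A B Az Bw.
have vc : continuous (val : disk R -> R * R) by exact: initial_continuous.
have [v [vA vB]] := zw _ _ (vc _ _ Az) (vc _ _ Bw).
by exists (val v).
Qed.

(** [polar] already maps a compact rectangle onto the Hausdorff disk, so the complement of [C] is a
    compact, hence closed, image. *)
Lemma polar_open (C : set (disk R)) : open (polar @^-1` C) -> open C.
Proof.
move=> oC; rewrite -[C]setCK openC.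
pose D := `[0, 1] `*` `[0, n] : set (R * R).
have cD : compact D by apply: compact_setX; exact: segment_compact.
have -> : ~` C = polar @` (D `&` polar @^-1` (~` C)).
  apply/seteqP; split=> [w Cw|_ [r [_ rC] <-] //].
  by have [r [r1 r2 rw]] := polar_surj w; exists r => //; split; rewrite /= ?rw // /D /= !in_itv.
apply: compact_closed disk_hausdorff _; apply: continuous_compact.
  exact/continuous_subspaceT/polar_continuous.
by apply: compact_closedI => //; rewrite preimage_setC; exact: open_closedC.
Qed.

End Polar.

Section Gluing.
Variables (R : realType) (g : nat).
Local Notation n := ((4 * g)%N%:R : R).

Definition side_invariant (Z : Type) (Phi : R * R -> Z) : Prop :=
  [/\ forall r, Phi r = Phi (clamp r.1, r.2), forall t t', Phi (0, t) = Phi (0, t'),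
      forall rho t, Phi (rho, t + n) = Phi (rho, t)
    & forall i (s : R), (i < g)%N -> 0 <= s <= 1 ->
      Phi (1, (4 * i)%N%:R + s) = Phi (1, (4 * i)%N%:R + 3 - s) /\
      Phi (1, (4 * i)%N%:R + 1 + s) = Phi (1, (4 * i)%N%:R + 4 - s)].

(* [Q (rho, t)] is the point of the surface with radius [clamp rho] and angular
   coordinate [t], which increases by 1 along each side; [Q] is a quotient map
   whose fibers are generated by the side pairings. *)
Definition polygonal (S : topologicalType) (Q : R * R -> S) : Prop :=
  [/\ continuous Q, forall z, exists r, Q r = z,
      forall A : set S, open (Q @^-1` A) -> open A,
      side_invariant Q
    & forall (Z : Type) (Phi : R * R -> Z), side_invariant Phi ->
      forall r r', Q r = Q r' -> Phi r = Phi r'].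

Lemma surface_polygonal (S : topologicalType) : (0 < g)%N ->
  is_closed_orientable_surface R g S -> exists Q : R * R -> S, polygonal Q.
Proof.
move=> g0 [f [h [fc hc fK hK]]].
pose q : disk R -> genus_surface R g := \pi_{eq_quot side_gluing R g}.
have qc : continuous q by exact: pi_continuous.
have pc := @polar_continuous R g.
have qP z w : (q z = q w) <-> clos_refl_sym_trans (disk R) (side_pairing g) z w.
  split=> [/eqmodP /asboolP //|zw]; by apply/eqmodP/asboolP.
exists (fun r => h (q (polar g r))); split.
- exact: (comp_continuous hc (comp_continuous qc pc)).
- move=> z; have [w wz] : exists w, q w = f z by exists (repr (f z)); exact: reprK.
  by have [r [_ _ rw]] := polar_surj g0 w; exists r; rewrite rw wz fK.
- move=> A oA; have -> : A = f @^-1` (h @^-1` A).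
    by apply/seteqP; split=> z /=; rewrite fK.
  apply: open_comp; first by move=> z _; exact: fc.
  rewrite -[open _]/(open (q @^-1` (h @^-1` A))).
  by apply: (polar_open g0).
- split=> [r|t t'|rho t|i s ig s1].
  + by congr (h (q _)); apply: disk_eq; rewrite /= clampK.
  + by congr (h (q _)); apply: disk_eq; rewrite /= clamp0 !mul0r.
  + congr (h (q _)); apply: disk_eq; rewrite /=.
    have -> : angle g (t + n) = angle g t + pi *+ 2.
      have n0 := n_gt0 R g0; have pi0 := pi_gt0 R.
      rewrite /angle -[pi *+ 2]mulr_natl; move: (n) (pi : R) n0 pi0 => m p m0 p0.
      by field; rewrite gt_eqF.
    by rewrite cosD2pi sinD2pi.
  + by rewrite !polar1; split; congr h; apply/qP/rst_step; exists i, s; split=> //; [left|right].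
- move=> Z Phi [Phic Phi0 Phin Phig].
  have psurj (w : disk R) : exists r, polar g r = w.
    by have [r [_ _ rw]] := polar_surj g0 w; exists r.
  have [pol polK] := boolp.choice psurj.
  have PhiE r : Phi (pol (polar g r)) = Phi r.
    exact: (polar_fiber g0 Phic Phi0 Phin).
  move=> r r' /(can_inj hK) /qP rr'; rewrite -(PhiE r) -(PhiE r').
  elim: rr' => [z w|//|z w _ -> //|z w v _ -> _ -> //].
  case=> i [s [ig s1 zw]]; have [e1 e2] := Phig i s ig s1.
  by case: zw => -[-> ->]; rewrite -!polar1 !PhiE.
Qed.

End Gluing.

(** * Charts *)

(** Cousin's lemma: an additive property of intervals that holds locally holds globally. It stands
    in for subdivisions and Lebesgue numbers below; the supremum of the [t] with [P A t] is [B]. *)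
Lemma cousin (R : realType) (A B : R) (P : R -> R -> Prop) : A <= B ->
  (forall a b c, A <= a <= b -> b <= c <= B -> P a b -> P b c -> P a c) ->
  (forall x, A <= x <= B -> exists2 e, 0 < e & forall a b,
     A <= a <= x -> x <= b <= B -> x - e < a -> b < x + e -> P a b) ->
  P A B.
Proof.
move=> AB Padd Ploc; pose E := [set t | A <= t <= B /\ P A t].
have PAA : P A A.
  by have [|e e0 Pe] := Ploc A; [rewrite lexx|apply: Pe; rewrite ?lexx //; lra].
have EA : E A by split; rewrite ?lexx.
have Esup : has_sup E by split; [exists A|exists B => t [/andP[_ ?]]].
have Eub : has_ubound E by case: Esup.
set s := sup E; have sA : A <= s by apply: (ub_le_sup Eub).
have sB : s <= B by apply: ge_sup; [exists A|move=> t [/andP[_ ?]]].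
have [|e e0 Pe] := Ploc s; first by rewrite sA.
have [t [/andP[tA tB] Pt] ts] := sup_adherent e0 Esup.
have tles : t <= s by apply: (ub_le_sup Eub); split=> //; rewrite tA.
have Ps s' : s <= s' <= B -> s' < s + e -> P A s'.
  move=> /andP[s1 s2] s3; apply: (Padd _ t); rewrite ?lexx ?tA ?(le_trans tles s1) //.
  by apply: Pe => //; rewrite ?tA ?tles ?s1.
have [Bs|Bs] := ltP B (s + e); first by apply: Ps; rewrite ?sB ?lexx.
have /(ub_le_sup Eub) : E (s + e / 2).
  by split; [apply/andP; split; lra|apply: Ps; [apply/andP; split|]; lra].
by rewrite -/s; lra.
Qed.

Section Invariant.
Variables (R : realType) (g : nat).
Local Notation n := ((4 * g)%N%:R : R).

Definition paired (k k' : nat) : Prop := exists i, (i < g)%N /\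
  (k = (4 * i)%N /\ k' = (4 * i + 2)%N \/ k = (4 * i + 1)%N /\ k' = (4 * i + 3)%N).

Lemma side_invariantP (Z : Type) (Phi : R * R -> Z) :
  side_invariant g Phi <->
  [/\ forall r, Phi r = Phi (clamp r.1, r.2), forall t t', Phi (0, t) = Phi (0, t'),
      forall rho t, Phi (rho, t + n) = Phi (rho, t)
    & forall k k' (s : R), paired k k' -> 0 <= s <= 1 ->
      Phi (1, k%:R + s) = Phi (1, k'%:R + 1 - s)].
Proof.
split=> -[? ? ? H]; split=> //.
  move=> k k' s [i [ig kk]] s1; have [e1 e2] := H i s ig s1.
  case: kk => -[-> ->].
    by rewrite e1; congr (Phi (_, _)); rewrite natrD; lra.
  by rewrite natrD e2; congr (Phi (_, _)); rewrite natrD; lra.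
move=> i s ig s1; split.
  rewrite (H (4 * i)%N (4 * i + 2)%N) //; last by exists i; split=> //; left.
  by congr (Phi (_, _)); rewrite natrD; lra.
rewrite -(natrD _ _ 1) (H (4 * i + 1)%N (4 * i + 3)%N) //; last by exists i; split=> //; right.
by congr (Phi (_, _)); rewrite natrD; lra.
Qed.

End Invariant.

Section Charts.
Variables (R : realType) (g : nat).
Local Notation n := ((4 * g)%N%:R : R).

Inductive chart := Inner | Edge | Vertex.

Definition fractional (t : R) : bool := (Num.floor t)%:~R != t.

(** [Edge] and [Vertex] are unions of open sectors without the centre, over the sides and around the
    vertices respectively, the latter bounded by midpoints of sides; [idx] numbers the sectors. *)
Definition dom (c : chart) (r : R * R) : bool :=
  match c with
  | Inner => r.1 < 1
  | Edge => (0 < r.1) && fractional r.2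
  | Vertex => (0 < r.1) && fractional (r.2 + 2^-1)
  end.

Definition idx (c : chart) (r : R * R) : int :=
  match c with
  | Inner => 0
  | Edge => Num.floor r.2
  | Vertex => Num.floor (r.2 + 2^-1)
  end.

Definition slide (c : chart) (m : int) (ru : (R * R) * R) : R * R :=
  let u := clamp ru.2 in
  let rho := clamp ru.1.1 in
  match c with
  | Inner => ((1 - u) * rho, ru.1.2)
  | Edge => ((1 - u) * rho + u, (1 - u) * ru.1.2 + u * (m%:~R + 2^-1))
  | Vertex => ((1 - u) * rho + u, (1 - u) * ru.1.2 + u * m%:~R)
  end.

Lemma floorP (m : int) (t : R) : m%:~R <= t < m%:~R + 1 -> Num.floor t = m.
Proof. by move=> mt; apply: Num.Theory.floor_def; rewrite intrD. Qed.

Lemma floor_gap (t : R) : (Num.floor t)%:~R <= t < (Num.floor t)%:~R + 1.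
Proof. by have := Num.Theory.floor_itv t; rewrite intrD. Qed.

Lemma fractionalP (t : R) : fractional t ->
  (Num.floor t)%:~R < t < (Num.floor t)%:~R + 1.
Proof. by rewrite /fractional => ft; have /andP[le ->] := floor_gap t; rewrite lt_neqAle ft le. Qed.

Lemma fractional_in (m : int) (t : R) : m%:~R < t < m%:~R + 1 ->
  Num.floor t = m /\ fractional t.
Proof.
move=> /andP[mt tm]; have fm : Num.floor t = m by apply: floorP; rewrite (ltW mt).
by rewrite /fractional fm lt_eqF.
Qed.

Lemma fractional_int (m : int) : fractional (m%:~R : R) = false.
Proof. by rewrite /fractional (@floorP m) ?eqxx // lexx ltrDl ltr01. Qed.

Lemma fractional_near (h : R * R -> R) (r : R * R) : continuous h -> fractional (h r) ->
  \forall r' \near r, fractional (h r') /\ Num.floor (h r') = Num.floor (h r).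
Proof.
move=> hc /fractionalP/andP[lo hi].
have nh : nbhs r (h @^-1` ([set y | (Num.floor (h r))%:~R < y] `&`
    [set y | y < (Num.floor (h r))%:~R + 1])).
  by apply: hc; apply: open_nbhs_nbhs; split=> //; apply: openI; [exact: open_gt|exact: open_lt].
apply: filterS nh => r' [/= lo' hi'].
by have [] := @fractional_in (Num.floor (h r)) (h r'); rewrite ?lo'.
Qed.

Lemma fst_gt0_near (r : R * R) : 0 < r.1 -> \forall r' \near r, 0 < r'.1.
Proof.
by move=> r0; exact: fst_cont r _ (open_nbhs_nbhs (conj (@open_gt R 0) r0)).
Qed.

Lemma dom_near c (r : R * R) : dom c r ->
  \forall r' \near r, dom c r' /\ idx c r' = idx c r.
Proof.
case: c => /=.
- move=> r1; have nr : nbhs r (fst @^-1` [set y : R | y < 1]).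
    exact: fst_cont r _ (open_nbhs_nbhs (conj (@open_lt R 1) r1)).
  by apply: filterS nr.
- move=> /andP[r0 fr]; apply: filterS2 (fst_gt0_near r0) (fractional_near snd_cont fr).
  by move=> r' -> [-> ->].
- move=> /andP[r0 fr].
  have hc : continuous (fun r : R * R => r.2 + 2^-1).
    by move=> x; apply: cvgD; [exact: snd_cont|exact: cvg_cst].
  by apply: filterS2 (fst_gt0_near r0) (fractional_near hc fr) => r' -> [-> ->].
Qed.

Lemma dom_cover (r : R * R) : exists c, dom c r.
Proof.
have [r1|r1] := ltP r.1 1; first by exists Inner.
have r0 : 0 < r.1 by lra.
have [f|/negPn/eqP f] := boolP (fractional r.2); first by exists Edge; rewrite /= r0.
exists Vertex; rewrite /= r0 /=.
by have [] := @fractional_in (Num.floor r.2) (r.2 + 2^-1); rewrite // f; apply/andP; split; lra.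
Qed.

Lemma slide_continuous c m : continuous (slide c m).
Proof.
have uc : continuous (fun ru : (R * R) * R => clamp ru.2).
  by apply: (comp_continuous (@clamp_continuous R)) => ru; exact: cvg_snd.
have fc : continuous (fst : (R * R) * R -> R * R) by move=> ru; exact: cvg_fst.
have rc : continuous (fun ru : (R * R) * R => clamp ru.1.1).
  exact: (comp_continuous (@clamp_continuous R) (comp_continuous fst_cont fc)).
have tc : continuous (fun ru : (R * R) * R => ru.1.2) := comp_continuous snd_cont fc.
have vc := opp1_continuous uc.
have cM (a b : (R * R) * R -> R) : continuous a -> continuous b -> continuous (fun x => a x * b x).
  by move=> ac bc x; apply: cvgM; [exact: ac|exact: bc].
have cD (a b : (R * R) * R -> R) : continuous a -> continuous b -> continuous (fun x => a x + b x).
  by move=> ac bc x; apply: cvgD; [exact: ac|exact: bc].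
have kc (k : R) : continuous (cst k : (R * R) * R -> R) by exact: cst_continuous.
case: c; apply: pair_continuous => //.
- exact: cM.
- exact: cD _ _ (cM _ _ vc rc) uc.
- exact: cD _ _ (cM _ _ vc tc) (cM _ _ uc (kc _)).
- exact: cD _ _ (cM _ _ vc rc) uc.
- exact: cD _ _ (cM _ _ vc tc) (cM _ _ uc (kc _)).
Qed.

Lemma clamp_lt1 (x : R) : (clamp x < 1) = (x < 1).
Proof. by rewrite lt_neqAle clamp_eq1 (andP (clamp_itv x)).2 andbT -ltNge. Qed.

Lemma clamp_gt0 (x : R) : (0 < clamp x) = (0 < x).
Proof. by rewrite lt_neqAle eq_sym clamp_eq0 (andP (clamp_itv x)).1 andbT -ltNge. Qed.

Lemma dom_clamp c (r : R * R) : dom c (clamp r.1, r.2) = dom c r.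
Proof. by case: c; rewrite /= ?clamp_lt1 ?clamp_gt0. Qed.

Lemma floorDn (t : R) (k : nat) : Num.floor (t + k%:R) = Num.floor t + k%:Z.
Proof.
apply: floorP; have /andP[lo hi] := floor_gap t.
by rewrite intrD -pmulrn; apply/andP; split; lra.
Qed.

Lemma fractionalDn (t : R) (k : nat) : fractional (t + k%:R) = fractional t.
Proof. by rewrite /fractional floorDn intrD -pmulrn (inj_eq (addIr _)). Qed.

Lemma dom_period c (rho t : R) (k : nat) : dom c (rho, t + k%:R) = dom c (rho, t).
Proof. by case: c; rewrite /= ?(addrAC t k%:R 2^-1) ?fractionalDn. Qed.

Lemma idx_period c (rho t : R) (k : nat) :
  idx c (rho, t + k%:R) = if c is Inner then 0 else idx c (rho, t) + k%:Z.
Proof. by case: c; rewrite /= ?(addrAC t k%:R 2^-1) ?floorDn. Qed.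

(* Glued boundary points [k + s] and [k' + 1 - s] lie in the same charts; their
   indices are [k] and [k'] along the sides, and [k], [k' + 1] or [k + 1], [k']
   around the vertices. *)
Lemma edge_pair (k k' : nat) (s : R) : 0 <= s <= 1 ->
  (dom Edge (1, k%:R + s) = false /\ dom Edge (1, k'%:R + 1 - s) = false) \/
  [/\ dom Edge (1, k%:R + s), dom Edge (1, k'%:R + 1 - s), idx Edge (1, k%:R + s) = k%:Z
    & idx Edge (1, k'%:R + 1 - s) = k'%:Z].
Proof.
move=> /andP[s0 s1]; rewrite /= ltr01 /=.
have [->|sn0] := eqVneq s 0.
  by left; rewrite addr0 subr0 -(natrD _ _ 1) !pmulrn !fractional_int.
have [->|sn1] := eqVneq s 1.
  by left; rewrite addrK -(natrD _ _ 1) !pmulrn !fractional_int.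
have {}s0 : 0 < s by rewrite lt_neqAle eq_sym sn0.
have {}s1 : s < 1 by rewrite lt_neqAle sn1.
have [|fk ek] := @fractional_in k%:Z (k%:R + s).
  by rewrite -pmulrn; apply/andP; split; lra.
have [|fk' ek'] := @fractional_in k'%:Z (k'%:R + 1 - s).
  by rewrite -pmulrn; apply/andP; split; lra.
by right.
Qed.

Lemma vertex_pair (k k' : nat) (s : R) : 0 <= s <= 1 ->
  [\/ dom Vertex (1, k%:R + s) = false /\ dom Vertex (1, k'%:R + 1 - s) = false,
   [/\ dom Vertex (1, k%:R + s), dom Vertex (1, k'%:R + 1 - s),
       idx Vertex (1, k%:R + s) = k%:Z & idx Vertex (1, k'%:R + 1 - s) = k'.+1%:Z] |
   [/\ dom Vertex (1, k%:R + s), dom Vertex (1, k'%:R + 1 - s),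
       idx Vertex (1, k%:R + s) = k.+1%:Z & idx Vertex (1, k'%:R + 1 - s) = k'%:Z]].
Proof.
move=> /andP[s0 s1]; rewrite /= ltr01 /=.
have [s2|s2|->] := ltgtP s 2^-1.
- have [|fk ek] := @fractional_in k%:Z (k%:R + s + 2^-1).
    by rewrite -pmulrn; apply/andP; split; lra.
  have [|fk' ek'] := @fractional_in k'.+1%:Z (k'%:R + 1 - s + 2^-1).
    by rewrite -pmulrn -[k'.+1%:R]natr1; apply/andP; split; lra.
  by apply: Or32.
- have [|fk ek] := @fractional_in k.+1%:Z (k%:R + s + 2^-1).
    by rewrite -pmulrn -[k.+1%:R]natr1; apply/andP; split; lra.
  have [|fk' ek'] := @fractional_in k'%:Z (k'%:R + 1 - s + 2^-1).
    by rewrite -pmulrn; apply/andP; split; lra.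
  by apply: Or33.
- apply: Or31.
  have -> : k%:R + 2^-1 + 2^-1 = k.+1%:R :> R by rewrite -[k.+1%:R]natr1; lra.
  have -> : k'%:R + 1 - 2^-1 + 2^-1 = k'.+1%:R :> R by rewrite -[k'.+1%:R]natr1; lra.
  by rewrite !pmulrn !fractional_int.
Qed.

Lemma dom_invariant c : side_invariant g (dom c).
Proof.
apply/side_invariantP; split=> [r|t t'|rho t|k k' s kk s1].
- by rewrite dom_clamp.
- by case: c; rewrite /= ?ltxx.
- exact: dom_period.
- case: c; first by rewrite /= !ltxx.
    by case: (edge_pair k k' s1) => [[-> ->] //|[-> -> _ _]].
  by case: (vertex_pair k k' s1) => [[-> ->] //|[-> -> _ _] //|[-> -> _ _]].
Qed.

(** At each time the slide takes glued boundary points to glued points, so it descends to the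
    surface. The option type turns a function on one chart into a total one. *)
Lemma slide_invariant (X : Type) (Q : R * R -> X) c u : side_invariant g Q ->
  side_invariant g (fun r => if dom c r then Some (Q (slide c (idx c r) (r, u))) else None).
Proof.
move=> /side_invariantP[Qc Q0 Qn Qk]; apply/side_invariantP.
have /andP[u0 u1] := clamp_itv u.
split=> [r|t t'|rho t|k k' s kk s1].
- by rewrite dom_clamp; case: c; rewrite /= clampK.
- by case: c; rewrite /= ?ltxx // ltr01 clamp0 mulr0; congr Some.
- rewrite dom_period idx_period; case: ifP => // _; congr Some; case: c => /=.
  + exact: Qn.
  + by rewrite -[RHS]Qn; congr (Q (_, _)); rewrite intrD -pmulrn; ring.
  + by rewrite -[RHS]Qn; congr (Q (_, _)); rewrite intrD -pmulrn; ring.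
- have /andP[s0 s1'] := s1; case: c => /=; rewrite ?ltxx //.
  + case: (edge_pair k k' s1) => [[/= -> ->] //|[/= -> -> -> ->]].
    rewrite clamp1 mulr1 subrK; congr Some.
    have -> : (1 - clamp u) * (k%:R + s) + clamp u * (k%:~R + 2^-1) =
        k%:R + ((1 - clamp u) * s + clamp u * 2^-1) by rewrite -pmulrn; ring.
    rewrite (Qk k k') //; first by congr (Q (_, _)); rewrite -pmulrn; field.
    by apply/andP; split; nra.
  + case: (vertex_pair k k' s1) => [[/= -> ->] //|[/= -> -> -> ->]|[/= -> -> -> ->]];
      rewrite clamp1 mulr1 subrK; congr Some.
    * have -> : (1 - clamp u) * (k%:R + s) + clamp u * k%:~R =
          k%:R + (1 - clamp u) * s by rewrite -pmulrn; ring.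
      rewrite (Qk k k') //; first by congr (Q (_, _)); rewrite -pmulrn -[k'.+1%:R]natr1; ring.
      by apply/andP; split; nra.
    * have -> : (1 - clamp u) * (k%:R + s) + clamp u * k.+1%:~R =
          k%:R + ((1 - clamp u) * s + clamp u) by rewrite -pmulrn -[k.+1%:R]natr1; ring.
      rewrite (Qk k k') //; first by congr (Q (_, _)); rewrite -pmulrn; ring.
      by apply/andP; split; nra.
Qed.

End Charts.

(** * Holonomy *)

Section Holonomy.
Variables (R : realType) (g : nat) (S : topologicalType) (Q : R * R -> S).
Hypothesis Qpoly : polygonal g Q.
Variables (rep : S -> R * R) (H : groupType) (e f : int -> H).
Hypotheses (repK : forall z, Q (rep z) = z)
  (e_period : forall m, e (m + (4 * g)%N%:Z) = e m)
  (f_period : forall m, f (m + (4 * g)%N%:Z) = f m)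
  (ef : forall k k' : nat, paired g k k' ->
    ((e k%:Z)^-1 * f k%:Z = (e k'%:Z)^-1 * f k'.+1%:Z /\
     (e k%:Z)^-1 * f k.+1%:Z = (e k'%:Z)^-1 * f k'%:Z)%g).

(** On the plane the cocycle is the coboundary of these labels. The labels themselves do not descend
    to the surface, but their quotients do: this is what [ef] and the two periodicities express. *)
Definition lab (c : chart) (r : R * R) : H :=
  match c with Inner => 1%g | Edge => e (idx Edge r) | Vertex => f (idx Vertex r) end.

Definition transition c c' r : option H :=
  if dom c r && dom c' r then Some ((lab c r)^-1 * lab c' r)%g else None.

Lemma transitionV c c' r :
  transition c' c r = if transition c c' r is Some x then Some x^-1%g else None.
Proof. by rewrite /transition andbC; case: ifP => // _; rewrite invMg invgK. Qed.

Lemma transition_invariant c c' : side_invariant g (transition c c').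
Proof.
suff H0 c1 c2 : (c1 = c2 \/ c1 = Inner \/ (c1 = Edge /\ c2 = Vertex)) ->
    side_invariant g (transition c1 c2).
  have sym : side_invariant g (transition c' c) -> side_invariant g (transition c c').
    case=> [i1 i2 i3 i4]; split=> [r|t t'|rho t|i s ig s1]; rewrite ![transition c c' _]transitionV.
    - by rewrite -i1.
    - by rewrite (i2 t t').
    - by rewrite i3.
    - by have [-> ->] := i4 i s ig s1.
  case: c c' sym => -[] sym; try by apply: H0; tauto.
  - by apply/sym/H0; tauto.
  - by apply/sym/H0; tauto.
  - by apply/sym/H0; tauto.
move=> cc; apply/side_invariantP; split=> [r|t t'|rho t|k k' s kk s1].
- by rewrite /transition !dom_clamp; case: c1 c2 {cc} => -[].
- rewrite /transition; case: c1 c2 cc => -[] /=; rewrite ?ltxx ?ltr01 //.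
- rewrite /transition !dom_period /lab.
  by case: ifP => // _; rewrite !idx_period; case: c1 c2 {cc} => -[]; rewrite ?e_period ?f_period.
- case: cc => [<-|[->|[-> ->]]]; rewrite /transition.
  + have /side_invariantP[_ _ _ dk] := dom_invariant R g c1.
    by rewrite (dk k k') //; case: ifP => // _; rewrite !mulVg.
  + by rewrite /= !ltxx.
  + have [ef1 ef2] := ef kk.
    case: (edge_pair k k' s1) => [[-> ->] //|[-> -> ie ie']].
    case: (vertex_pair k k' s1) => [[-> ->] //|[-> -> iv iv']|[-> -> iv iv']];
      by rewrite /lab ie ie' iv iv' /= ?ef1 ?ef2.
Qed.

Lemma dom_Q c r r' : Q r = Q r' -> dom c r = dom c r'.
Proof. by case: Qpoly => _ _ _ _; apply; exact: dom_invariant. Qed.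

Lemma transition_Q c c' r r' : Q r = Q r' -> transition c c' r = transition c c' r'.
Proof. by case: Qpoly => _ _ _ _; apply; exact: transition_invariant. Qed.

Lemma lab_near c r : dom c r -> \forall r' \near r, dom c r' /\ lab c r' = lab c r.
Proof.
move=> /dom_near; apply: filterS => r' [-> ix]; split=> //.
by case: c ix => //= ->.
Qed.

Lemma open_near (T : topologicalType) (A : set T) :
  (forall x, A x -> \forall y \near x, A y) -> open A.
Proof. by move=> Anear; rewrite openE => x /Anear. Qed.

Lemma transition_near c c' z x : transition c c' (rep z) = Some x ->
  \forall z' \near z, transition c c' (rep z') = Some x.
Proof.
move=> zx; pose A := [set z' | transition c c' (rep z') = Some x].
suff oA : open A by exact: open_nbhs_nbhs.
case: Qpoly => _ _ Qo _ _; apply/Qo/open_near => r.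
rewrite /A /= (@transition_Q _ _ _ r) // /transition; case: ifP => // /andP[d d'] [rx].
apply: filterS2 (lab_near d) (lab_near d') => r' [dr lr] [dr' lr'].
by rewrite /= -/(transition c c' (rep (Q r'))) (@transition_Q _ _ _ r') // /transition dr dr' lr lr' rx.
Qed.

(* [L] is a flat section along [gam] of the principal [H]-bundle on the surface
   with the locally constant transition functions [transition]. *)
Definition lift (T : topologicalType) (gam : T -> S) (A : set T) (L : T -> H) : Prop :=
  forall x, A x -> forall c, dom c (rep (gam x)) ->
    \forall y \near x, A y ->
      dom c (rep (gam y)) /\ (L y * lab c (rep (gam y)) = L x * lab c (rep (gam x)))%g.

Section Lift.
Variable T : topologicalType.
Implicit Types (gam : T -> S) (A B : set T) (L : T -> H).

(** One chart per point suffices, because the transition to any other chart is constant near that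
    point. *)
Lemma liftP gam A L : continuous gam ->
  (forall x, A x -> exists2 c, dom c (rep (gam x)) & \forall y \near x, A y ->
      dom c (rep (gam y)) /\ (L y * lab c (rep (gam y)) = L x * lab c (rep (gam x)))%g) ->
  lift gam A L.
Proof.
move=> gc ex x Ax c' dc'; have [c dc near_c] := ex x Ax.
have tx : transition c c' (rep (gam x)) =
    Some ((lab c (rep (gam x)))^-1 * lab c' (rep (gam x)))%g.
  by rewrite /transition dc dc'.
have := gc x _ (transition_near tx); apply: filterS2 near_c => y ny /= ty Ay.
have [dy Ly] := ny Ay; move: ty; rewrite /transition.
case: ifP => // /andP[_ ->] [ty]; split=> //.
by rewrite -[lab c' (rep (gam y))](mulVKg (lab c (rep (gam y)))) ty mulgA Ly -mulgA mulVKg.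
Qed.

Lemma lift_sub gam A B L : B `<=` A -> lift gam A L -> lift gam B L.
Proof.
by move=> BA LA x Bx c dc; apply: filterS (LA x (BA _ Bx) c dc) => y ny /BA /ny.
Qed.

Lemma lift_mul gam A L h : lift gam A L -> lift gam A (fun x => h * L x)%g.
Proof.
move=> LA x Ax c dc; apply: filterS (LA x Ax c dc) => y ny Ay.
by have [? Ly] := ny Ay; split=> //; rewrite -!mulgA Ly.
Qed.

Lemma lift_ext gam gam' A L : (forall x, A x -> gam x = gam' x) ->
  lift gam A L -> lift gam' A L.
Proof.
move=> gg LA x Ax c; rewrite -gg // => dc; apply: filterS (LA x Ax c dc) => y ny Ay.
by rewrite -gg //; exact: ny.
Qed.

Lemma lift_unique_near gam A L L' x : lift gam A L -> lift gam A L' -> A x ->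
  \forall y \near x, A y -> (L' y * (L y)^-1 = L' x * (L x)^-1)%g.
Proof.
move=> LA L'A Ax; have [c dc] := dom_cover (rep (gam x)).
apply: filterS2 (LA x Ax c dc) (L'A x Ax c dc) => y ny ny' Ay.
have [_ Ly] := ny Ay; have [_ L'y] := ny' Ay.
have D (a b l : H) : (a * b^-1 = (a * l) * (b * l)^-1)%g.
  by rewrite invMg mulgA mulgK.
by rewrite (D _ _ (lab c (rep (gam y)))) Ly L'y -D.
Qed.

End Lift.

Lemma lift_comp (T U : topologicalType) (gam : U -> S) (h : T -> U) A L :
  continuous h -> lift gam A L -> lift (gam \o h) (h @^-1` A) (L \o h).
Proof. by move=> hc LA x Ax c dc; exact: hc x _ (LA (h x) Ax c dc). Qed.

Lemma lift_segment_unique (gam : R -> S) (A B : R) L L' : A <= B ->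
  lift gam `[A, B] L -> lift gam `[A, B] L' ->
  (L' A * (L A)^-1 = L' B * (L B)^-1)%g.
Proof.
move=> AB LA L'A; apply: (cousin (P := fun a b => (L' a * (L a)^-1 = L' b * (L b)^-1)%g)) AB _ _.
  by move=> a b c _ _ -> ->.
move=> x xAB; have xin : [set` `[A, B]] x by rewrite /= in_itv.
have [eps /= eps0 near_x] := lift_unique_near LA L'A xin.
exists eps => // a b /andP[Aa ax] /andP[xb bB] ea eb; have /andP[Ax xB] := xAB.
rewrite (near_x a) ?(near_x b) //.
- by rewrite /ball_ /= ler0_norm; lra.
- by rewrite /= in_itv /= bB (le_trans Ax).
- by rewrite /ball_ /= ger0_norm; lra.
- by rewrite /= in_itv /= Aa (le_trans ax).
Qed.

Definition rect (a b c d : R) : set (R * R) :=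
  [set p | a <= p.1 <= b /\ c <= p.2 <= d].

Lemma pair_cst_continuous (T : topologicalType) (a : T) : continuous (fun u : R => (a, u)).
Proof. by apply: pair_continuous; [exact: cst_continuous|exact: id_cont]. Qed.

Lemma swap_continuous : continuous (fun p : R * R => (p.2, p.1)).
Proof. by apply: pair_continuous; [exact: snd_cont|exact: fst_cont]. Qed.

(** Left translation by [k] makes the second lift agree with the first at one point of the common
    side, hence on all of it by uniqueness. *)
Lemma glue_horizontal (gam : R * R -> S) a b d c c' : continuous gam ->
  a <= b -> b <= d -> c <= c' ->
  (exists L, lift gam (rect a b c c') L) -> (exists L, lift gam (rect b d c c') L) ->
  exists L, lift gam (rect a d c c') L.
Proof.
move=> gc ab bd cc' [L1 L1l] [L2 L2l].
have bc := @pair_cst_continuous _ b.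
pose k := (L1 (b, c) * (L2 (b, c))^-1)%g.
have kE u : c <= u <= c' -> L1 (b, u) = (k * L2 (b, u))%g.
  move=> /andP[cu uc']; have := lift_segment_unique cu.
  move=> /(_ (gam \o (fun u => (b, u))) (L2 \o (fun u => (b, u))) (L1 \o (fun u => (b, u)))).
  rewrite /= -/k => ->; first by rewrite mulgKV.
    apply: lift_sub (lift_comp bc L2l) => v /=; rewrite in_itv /= => /andP[cv vu].
    by rewrite /rect /= lexx bd cv (le_trans vu).
  apply: lift_sub (lift_comp bc L1l) => v /=; rewrite in_itv /= => /andP[cv vu].
  by rewrite /rect /= lexx ab cv (le_trans vu).
exists (fun p => if p.1 <= b then L1 p else k * L2 p)%g.
have L2l' := lift_mul k L2l.
move=> x [/andP[ax xd] xc] h dh; have [xb|xb|xb] := ltgtP x.1 b.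
- have nb : \forall y \near x, y.1 < b := fst_cont x _ (open_nbhs_nbhs (conj (@open_lt R b) xb)).
  have xr : rect a b c c' x by split; rewrite // ax ltW.
  apply: filterS2 nb (L1l x xr h dh) => y yb ny [/andP[ay yd] yc].
  by rewrite (ltW yb); apply: ny; split; rewrite // ay ltW.
- have nb : \forall y \near x, b < y.1 := fst_cont x _ (open_nbhs_nbhs (conj (@open_gt R b) xb)).
  have xr : rect b d c c' x by split; rewrite // xd ltW.
  apply: filterS2 nb (L2l' x xr h dh) => y yb ny [/andP[ay yd] yc].
  by rewrite leNgt yb; apply: ny; split; rewrite // yd ltW.
- have xr : rect a b c c' x by split; rewrite // xb ab lexx.
  have xr' : rect b d c c' x by split; rewrite // xb bd lexx.
  apply: filterS2 (L1l x xr h dh) (L2l' x xr' h dh) => y n1 n2 [/andP[ay yd] yc].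
  have [yb|yb] := leP y.1 b; first by apply: n1; split; rewrite // ay.
  have [|? ->] := n2; first by split; rewrite // yd ltW.
  split=> //; congr (_ * _)%g.
  by rewrite [x]surjective_pairing xb -kE.
Qed.

Lemma glue_vertical (gam : R * R -> S) a b d c c' : continuous gam ->
  a <= b -> b <= d -> c <= c' ->
  (exists L, lift gam (rect c c' a b) L) -> (exists L, lift gam (rect c c' b d) L) ->
  exists L, lift gam (rect c c' a d) L.
Proof.
move=> gc ab bd cc' [L1 L1l] [L2 L2l]; have sc := swap_continuous.
have [||L Ll] := glue_horizontal (comp_continuous gc sc) ab bd cc'.
- by eexists; apply: lift_sub (lift_comp sc L1l) => p [].
- by eexists; apply: lift_sub (lift_comp sc L2l) => p [].
exists (L \o (fun p => (p.2, p.1))).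
apply: (@lift_ext _ ((fun p => gam (p.2, p.1)) \o (fun p => (p.2, p.1)))).
  by move=> x _; rewrite /= -surjective_pairing.
by apply: lift_sub (lift_comp sc Ll) => p [].
Qed.

Lemma lift_box (gam : R * R -> S) s u : continuous gam ->
  exists2 eps : R, 0 < eps & forall A, A `<=` [set p | `|p.1 - s| < eps /\ `|p.2 - u| < eps] ->
    exists L, lift gam A L.
Proof.
move=> gc; have [c dc] := dom_cover (rep (gam (s, u))).
have tr : transition c c (rep (gam (s, u))) = Some 1%g.
  by rewrite /transition dc /= mulVg.
have /nbhs_ballP[eps /= eps0 sub] := gc (s, u) _ (transition_near tr).
exists eps => // A Asub; have dA p : A p -> dom c (rep (gam p)).
  move=> /Asub[p1 p2]; have /sub : ball (s, u) eps p.
    by split; rewrite /ball /= distrC.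
  by rewrite /= /transition; case: (dom c _).
exists (fun p => (lab c (rep (gam p)))^-1)%g; apply: liftP => // x Ax.
exists c; first exact: dA.
apply: (@filterE _ (nbhs x)) => y Ay.
by split; [exact: dA|rewrite !mulVg].
Qed.

(** Boxes inside one chart are stacked into thin vertical strips, and the strips are joined side by
    side; both are uses of [cousin]. *)
Lemma rect_lift (gam : R * R -> S) a b c d : continuous gam -> a <= b -> c <= d ->
  exists L, lift gam (rect a b c d) L.
Proof.
move=> gc ab cd.
have strip s : exists2 eps : R, 0 < eps & exists L, lift gam (rect (s - eps) (s + eps) c d) L.
  apply: (cousin (P := fun c d => exists2 eps : R, 0 < eps &
    exists L, lift gam (rect (s - eps) (s + eps) c d) L)) cd _ _.
    move=> x y z /andP[_ xy] /andP[yz _] [e1 e10 [L1 L1l]] [e2 e20 [L2 L2l]].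
    pose m := Num.min e1 e2; have m0 : 0 < m by rewrite lt_min e10.
    have m1 : m <= e1 by rewrite ge_min lexx.
    have m2 : m <= e2 by rewrite ge_min lexx orbT.
    exists m => //; apply: (glue_vertical gc xy yz); first by lra.
      by exists L1; apply: lift_sub L1l => p [/andP[p1 p2] p3]; split=> //; apply/andP; split; lra.
    by exists L2; apply: lift_sub L2l => p [/andP[p1 p2] p3]; split=> //; apply/andP; split; lra.
  move=> u _; have [eps eps0 box] := lift_box s u gc.
  exists eps => // x y /andP[_ xu] /andP[uy _] ex ey.
  exists (eps / 2); first by rewrite divr_gt0.
  apply: box => p [/andP[p1 p2] /andP[p3 p4]] /=.
  by split; rewrite ltr_norml; apply/andP; split; lra.
apply: (cousin (P := fun a b => exists L, lift gam (rect a b c d) L)) ab _ _.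
  by move=> x y z /andP[_ xy] /andP[yz _]; exact: glue_horizontal.
move=> s _; have [eps eps0 [L Ll]] := strip s; exists eps => // x y /andP[_ xs] /andP[sy _] ex ey.
by exists L; apply: lift_sub Ll => p [/andP[p1 p2] p3]; split=> //; apply/andP; split; lra.
Qed.

Lemma path_lift (c : R -> S) : continuous c -> exists L, lift c `[0, 1] L.
Proof.
move=> cc; have gc := comp_continuous cc (@fst_cont R).
have [L Ll] := @rect_lift _ 0 1 0 0 gc ler01 (lexx 0).
have hc : continuous (fun s : R => (s, 0 : R)).
  by apply: pair_continuous; [exact: id_cont|exact: cst_continuous].
eexists; apply: lift_sub (lift_comp hc Ll) => s /=.
by rewrite in_itv /rect /= lexx.
Qed.

Definition hol (c : R -> S) : H :=
  if pselect (exists L, lift c `[0, 1] L) is left cL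
  then let L := sval (cid cL) in ((L 0%R)^-1 * L 1%R)%g else 1%g.

Lemma holE (c : R -> S) L : lift c `[0, 1] L -> hol c = ((L 0%R)^-1 * L 1%R)%g.
Proof.
move=> Ll; rewrite /hol; case: pselect => [cL|[]]; last by exists L.
case: (cid cL) => L' /= L'l; have E := lift_segment_unique ler01 Ll L'l.
by apply: (mulgI (L' 0)); rewrite mulVKg mulgA E mulgKV.
Qed.

Lemma hol_ext (c c' : R -> S) : continuous c -> (forall s, 0 <= s <= 1 -> c s = c' s) ->
  hol c' = hol c.
Proof.
move=> cc cE; have [L Ll] := path_lift cc; rewrite (holE Ll); apply: holE.
by apply: lift_ext Ll => s; rewrite /= in_itv; exact: cE.
Qed.

Lemma hol_cst z : hol (cst z) = 1%g.
Proof.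
have cc : continuous (cst z : R -> S) by exact: cst_continuous.
have [L Ll] := path_lift cc.
have Kl : lift (cst z : R -> S) `[0, 1] (cst 1%g).
  by move=> x _ c dc; apply: (@filterE _ (nbhs x)).
by rewrite (holE Kl) invg1 mulg1.
Qed.

(** A lift over the whole square takes equal values at the two ends of each vertical side, because
    that side is mapped to a constant path. *)
Lemma hol_ph (c c' : R -> S) : ph c c' -> hol c = hol c'.
Proof.
move=> [K [Kc Kf Kg K0 K1]].
have [L Ll] := rect_lift Kc (@ler01 R) (@ler01 R).
have hside a : 0 <= a <= 1 -> lift (fun u => K (a, u)) `[0, 1] (fun u => L (a, u)).
  move=> a1; apply: lift_sub (lift_comp (@pair_cst_continuous _ a) Ll) => u /=.
  by rewrite in_itv.
have hbase a : 0 <= a <= 1 -> lift (fun s => K (s, a)) `[0, 1] (fun s => L (s, a)).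
  move=> a1; have hc : continuous (fun s : R => (s, a)).
    by apply: pair_continuous; [exact: id_cont|exact: cst_continuous].
  by apply: lift_sub (lift_comp hc Ll) => u /=; rewrite in_itv.
have end_cst a z : 0 <= a <= 1 -> (forall u, K (a, u) = z) -> L (a, 0) = L (a, 1).
  move=> a1 Kz; have := holE (hside a a1).
  have -> : (fun u => K (a, u)) = cst z by apply/funext => u; rewrite Kz.
  by rewrite hol_cst => /(congr1 (mulg (L (a, 0)))); rewrite mulg1 mulVKg.
have in0 : 0 <= (0 : R) <= 1 by rewrite lexx ler01.
have in1 : 0 <= (1 : R) <= 1 by rewrite lexx ler01.
have -> : c = (fun s => K (s, 0)) by apply/funext.
have -> : c' = (fun s => K (s, 1)) by apply/funext.
rewrite (holE (hbase 0 in0)) (holE (hbase 1 in1)).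
by rewrite (end_cst 0 _ in0 K0) (end_cst 1 _ in1 K1).
Qed.

Lemma hol_pcat (c c' : R -> S) : continuous c -> continuous c' -> c 1 = c' 0 ->
  hol (pcat c c') = (hol c * hol c')%g.
Proof.
move=> cc c'c cE; have [L Ll] := path_lift (pcat_cont cc c'c cE).
have h1 : continuous (fun s : R => s / 2).
  by move=> s; apply: cvgM; [exact: id_cont|exact: cvg_cst].
have h2 : continuous (fun s : R => (s + 1) / 2).
  by move=> s; apply: cvgM; [apply: cvgD; [exact: id_cont|exact: cvg_cst]|exact: cvg_cst].
have l1 : lift c `[0, 1] (fun s => L (s / 2)).
  apply: (@lift_ext _ (pcat c c' \o (fun s => s / 2))).
    move=> s; rewrite /= in_itv /= => /andP[s0 s1]; rewrite /pcat ifT; last by lra.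
    by congr c; lra.
  apply: lift_sub (lift_comp h1 Ll) => s /=; rewrite !in_itv /= => /andP[s0 s1].
  by apply/andP; split; lra.
have l2 : lift c' `[0, 1] (fun s => L ((s + 1) / 2)).
  apply: (@lift_ext _ (pcat c c' \o (fun s => (s + 1) / 2))).
    move=> s; rewrite /= in_itv /= => /andP[s0 s1]; rewrite /pcat.
    have -> : 2 * ((s + 1) / 2) = s + 1 by lra.
    case: ifPn => s2; last by congr c'; lra.
    by have -> : s = 0 by [lra]; rewrite add0r cE.
  apply: lift_sub (lift_comp h2 Ll) => s /=; rewrite !in_itv /= => /andP[s0 s1].
  by apply/andP; split; lra.
rewrite (holE Ll) (holE l1) (holE l2) mul0r add0r.
have -> : (1 + 1) / 2 = 1 :> R by lra.
by rewrite -mulgA mulVKg.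
Qed.

(** The labels at [r] against those at the chosen representative of the same point of the surface;
    by invariance of the transitions the chart does not matter. It is a flat section along [Q],
    which gives [hol_Q]. *)
Definition delta (r : R * R) : H :=
  let c := sval (cid (dom_cover r)) in (lab c r * (lab c (rep (Q r)))^-1)%g.

Lemma deltaE c r : dom c r -> delta r = (lab c r * (lab c (rep (Q r)))^-1)%g.
Proof.
move=> dc; rewrite /delta; case: (cid (dom_cover r)) => c' /= dc'.
have := @transition_Q c c' r (rep (Q r)); rewrite repK => /(_ erefl).
have Qr : Q r = Q (rep (Q r)) by rewrite repK.
rewrite /transition -!(dom_Q _ Qr) dc dc' /= => -[E].
apply: (mulgI (lab c r)^-1%g); rewrite mulKg !mulgA E.
by rewrite mulgK.
Qed.

Lemma delta_rep z : delta (rep z) = 1%g.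
Proof. by have [c dc] := dom_cover (rep z); rewrite (deltaE dc) repK mulgV. Qed.

Lemma delta_inner rho t : rho < 1 -> delta (rho, t) = 1%g.
Proof. by move=> r1; rewrite (@deltaE Inner) //= invg1 mulg1. Qed.

Lemma delta_vertex (k l : nat) : Q (1, k%:R) = Q (1, l%:R) ->
  (delta (1%R, k%:R) * (delta (1%R, l%:R))^-1 = f k%:Z * (f l%:Z)^-1)%g.
Proof.
have half (m : nat) : dom Vertex (1 : R, m%:R : R) /\ idx Vertex (1 : R, m%:R : R) = m%:Z.
  have [|fm dm] := @fractional_in R m%:Z (m%:R + 2^-1); last by rewrite /= ltr01.
  by rewrite -pmulrn; apply/andP; split; lra.
have [dk ik] := half k; have [dl il] := half l => Qkl.
rewrite (deltaE dk) (deltaE dl) Qkl /lab ik il.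
by rewrite invMg invgK !mulgA mulgKV.
Qed.

Lemma hol_Q (r : R -> R * R) : continuous r ->
  hol (Q \o r) = ((delta (r 0%R))^-1 * delta (r 1%R))%g.
Proof.
move=> rc; apply: (@holE _ (delta \o r)).
apply: liftP; first by case: Qpoly => Qc _ _ _ _; exact: comp_continuous.
move=> s _; have [c dc] := dom_cover (r s).
have Qr u : Q (r u) = Q (rep (Q (r u))) by rewrite repK.
exists c; first by rewrite /= -(dom_Q _ (Qr s)).
have near_s : \forall u \near s, dom c (r u) /\ lab c (r u) = lab c (r s) := rc s _ (lab_near dc).
apply: filterS near_s => u /= [du lu] _.
by rewrite -(dom_Q _ (Qr u)) (deltaE du) (deltaE dc) !mulgKV lu.
Qed.

End Holonomy.

(** * The homomorphism from the free group *)

Lemma loop_homotopic_ph (R : realType) (X : topologicalType) (x0 : X) (c d : loop R x0) :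
  loop_homotopic c d -> ph (fun s => c (to_I s)) (fun s => d (to_I s)).
Proof.
move=> [K [Kc Kf Kg K0 K1]].
have e0 : to_I 0 = zero :> unit_interval R by rewrite to_I0.
have e1 : to_I 1 = one :> unit_interval R by rewrite to_I1.
exists (fun su => K (to_I su.1, to_I su.2)); split=> /= [|s|s|u|u].
- apply: comp_continuous => //; apply: pair_continuous.
    exact: comp_continuous (@to_I_continuous R) fst_cont.
  exact: comp_continuous (@to_I_continuous R) snd_cont.
- by rewrite e0 Kf.
- by rewrite e1 Kg.
- by rewrite e0 K0 path_zero.
- by rewrite e1 K1 path_one.
Qed.

Section Basepoint.
Variables (R : realType) (g : nat) (S : topologicalType) (Q : R * R -> S).
Hypothesis Qpoly : polygonal g Q.
Variables (rep : S -> R * R) (x0 : S).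
Hypothesis repK : forall z, Q (rep z) = z.

Definition segment (r r' : R * R) (s : R) : R * R :=
  ((1 - s) * r.1 + s * r'.1, (1 - s) * r.2 + s * r'.2).

Lemma segment_continuous r r' : continuous (segment r r').
Proof.
have c1 : continuous (fun s : R => 1 - s) by exact: opp1_continuous id_cont.
apply: pair_continuous => s; apply: cvgD; apply: cvgM;
  by [exact: c1|exact: cvg_cst|exact: id_cont].
Qed.

Lemma segment0 r r' : segment r r' 0 = r.
Proof. by rewrite /segment subr0 !mul1r !mul0r !addr0; case: r. Qed.

Lemma segment1 r r' : segment r r' 1 = r'.
Proof. by rewrite /segment subrr !mul1r !mul0r !add0r; case: r'. Qed.

Lemma Q_cont : continuous Q. Proof. by case: Qpoly. Qed.

Lemma Q_clamp r : Q r = Q (clamp r.1, r.2).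
Proof. by case: Qpoly => _ _ _ [-> _ _ _] _. Qed.

Lemma Q_center t t' : Q (0, t) = Q (0, t').
Proof. by case: Qpoly => _ _ _ [_ Q0 _ _] _; exact: Q0. Qed.

Lemma Q_path (r : R -> R * R) : continuous r -> continuous (Q \o r).
Proof. exact: comp_continuous Q_cont. Qed.

Definition tail (y : S) : R -> S := Q \o segment (rep x0) (rep y).

Lemma tail_continuous y : continuous (tail y).
Proof. exact/Q_path/segment_continuous. Qed.

Lemma tail0 y : tail y 0 = x0. Proof. by rewrite /tail /= segment0. Qed.
Lemma tail1 y : tail y 1 = y. Proof. by rewrite /tail /= segment1. Qed.

Lemma tail_x0 : tail x0 = cst x0.
Proof.
apply/funext => s; rewrite /tail /segment /= -!mulrDl subrK !mul1r.
by rewrite -surjective_pairing.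
Qed.

Local Notation cl := (path_class x0 tail).

Definition ray (r : R * R) (u : R) : R * R := ((1 - u) * clamp r.1, r.2).

Definition ray_class (r : R * R) : pi1 R x0 := cl (Q \o ray r).

Lemma ray_continuous r : continuous (ray r).
Proof.
apply: pair_continuous; last exact: cst_continuous.
have c1 : continuous (fun s : R => 1 - s) by exact: opp1_continuous id_cont.
by move=> u; apply: cvgM; [exact: c1|exact: cvg_cst].
Qed.

Lemma pcat_comp (X Y : topologicalType) (h : X -> Y) (f f' : R -> X) :
  h \o pcat f f' = pcat (h \o f) (h \o f').
Proof. by apply/funext => s; rewrite /pcat /=; case: ifP. Qed.

Lemma cl_cat (c c' : R -> S) : continuous c -> continuous c' -> c 1 = c' 0 ->
  cl (pcat c c') = (cl c * cl c')%g.
Proof. by apply: cl_pcat; [exact: tail_continuous|exact: tail0|exact: tail1]. Qed.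

Lemma cl_const y : cl (cst y) = 1%g.
Proof. by apply: cl_cst; [exact: tail_continuous|exact: tail0|exact: tail1]. Qed.

Lemma cl_square (K : R * R -> S) (r r' : R -> R * R) : continuous K ->
  continuous r -> continuous r' -> r 0 = r' 0 -> r 1 = r' 1 -> cl (K \o r) = cl (K \o r').
Proof. by apply: cl_plane; [exact: tail_continuous|exact: tail0|exact: tail1]. Qed.

(** The plane being simply connected, going along [r] and then down the last ray amounts to going
    down the first ray and along radius 0, which [Q] collapses to a point. *)
Lemma cl_Q (r : R -> R * R) : continuous r -> cl (Q \o r) = (ray_class (r 0%R) * (ray_class (r 1%R))^-1)%g.
Proof.
move=> rc; pose r' s := (clamp (r s).1, (r s).2).
have r'c : continuous r'.
  apply: pair_continuous; last exact: comp_continuous snd_cont rc.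
  exact: comp_continuous (@clamp_continuous R) (comp_continuous fst_cont rc).
have -> : Q \o r = Q \o r' by apply/funext => s; rewrite /= Q_clamp.
have rays z : ray z 0 = (clamp z.1, z.2) by rewrite /ray subr0 mul1r.
have raye z : ray z 1 = (0, z.2) by rewrite /ray subrr mul0r.
apply: (mulIg (ray_class (r 1))); rewrite mulgKV.
pose q := segment (0, (r 0).2) (0, (r 1).2).
have qc : continuous q by exact: segment_continuous.
have Qq : Q \o q = cst (Q (0, 0)).
  by apply/funext => s; rewrite /q /segment /= !mulr0 addr0 (Q_center _ 0).
have c0 := @ray_continuous (r 0); have c1 := @ray_continuous (r 1).
have j1 : r' 1 = ray (r 1) 0 by rewrite rays.
have j2 : ray (r 0) 1 = q 0 by rewrite raye /q segment0.
rewrite /ray_class -cl_cat; [|exact: Q_path|exact: Q_path|by rewrite /= j1].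
have -> : cl (Q \o ray (r 0)) = cl (Q \o pcat (ray (r 0)) q).
  rewrite pcat_comp cl_cat; try exact: Q_path; last by rewrite /= j2.
  by rewrite Qq cl_const mulg1.
rewrite -pcat_comp; apply: cl_square; [exact: Q_cont|exact: pcat_cont|exact: pcat_cont| |].
- by rewrite !pcat0 rays.
- by rewrite !pcat1 raye /q segment1.
Qed.

Local Notation mu k := (ray_class (1%R, k%:R)).

Lemma Q_paired k k' (s : R) : paired g k k' -> 0 <= s <= 1 ->
  Q (1, k%:R + s) = Q (1, k'%:R + 1 - s).
Proof. by case: Qpoly => _ _ _ /side_invariantP[_ _ _ Qk] _; exact: Qk. Qed.

(** The paths along the two glued sides, from the vertices [k] and [k'.+1], have the same image in
    the surface; [cl_Q] computes its class in two ways. *)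
Lemma nu_paired k k' (s : R) : paired g k k' -> 0 <= s <= 1 ->
  ((ray_class (1, k%:R + s)%R)^-1 * ray_class (1, k'%:R + 1 - s)%R = (mu k)^-1 * mu k'.+1)%g.
Proof.
move=> kk /andP[s0 s1]; pose r (u : R) : R * R := (1, k%:R + s * clamp u).
pose r' (u : R) : R * R := (1, k'%:R + 1 - s * clamp u).
have cc : continuous (fun u : R => s * clamp u).
  by apply: scale_continuous; exact: clamp_continuous.
have rc : continuous r.
  apply: pair_continuous; first exact: cst_continuous.
  by move=> u; apply: cvgD; [exact: cvg_cst|exact: cc].
have r'c : continuous r'.
  apply: pair_continuous; first exact: cst_continuous.
  by move=> u; apply: cvgB; [exact: cvg_cst|exact: cc].
have : cl (Q \o r) = cl (Q \o r').
  congr path_class; apply/funext => u; apply: Q_paired kk _.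
  by have /andP[u0 u1] := clamp_itv u; rewrite mulr_ge0 // mulr_ile1.
rewrite (cl_Q rc) (cl_Q r'c) /r /r' clamp0 clamp1 mulr0 addr0 subr0 mulr1 natr1.
move=> E; apply: (mulgI (mu k)); rewrite mulVKg mulgA E.
by rewrite mulgKV.
Qed.

Lemma mu_paired k k' : paired g k k' ->
  ((mu k)^-1 * mu k'.+1 = (mu k.+1)^-1 * mu k')%g.
Proof.
move=> kk; have in1 : 0 <= (1 : R) <= 1 by rewrite lexx ler01.
by rewrite -(nu_paired kk in1) addrK natr1.
Qed.

Lemma mu_period : ray_class (1, (4 * g)%N%:R) = ray_class (1, 0).
Proof.
congr path_class; apply/funext => u; rewrite /ray /= -[X in Q (_, X)]add0r.
by case: Qpoly => _ _ _ [_ _ -> _] _.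
Qed.

(** From [x0] to the centre, out to vertex [k], in again from vertex [l], and back. For [k = 4 * i]
    and [l = 4 * i + 3] such a loop crosses the glued sides [4 * i] and [4 * i + 2], at an end
    point. *)
Definition side (k l : nat) : pi1 R x0 :=
  (ray_class (rep x0) * ((mu k)^-1 * mu l) * (ray_class (rep x0))^-1)%g.

Definition surface_hom : free_group (surface_gen g) -> pi1 R x0 :=
  fg_lift (fun s : surface_gen g =>
    if s.2 then side (4 * s.1 + 3) (4 * s.1 + 2) else side (4 * s.1) (4 * s.1 + 3)).

HB.instance Definition _ := Multiplicative.copy surface_hom
  (fg_lift (fun s : surface_gen g =>
    if s.2 then side (4 * s.1 + 3) (4 * s.1 + 2) else side (4 * s.1) (4 * s.1 + 3))).

Lemma paired_a i : (i < g)%N -> paired g (4 * i) (4 * i + 2).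
Proof. by move=> ig; exists i; split=> //; left. Qed.

Lemma paired_b i : (i < g)%N -> paired g (4 * i + 1) (4 * i + 3).
Proof. by move=> ig; exists i; split=> //; right. Qed.

(** By [mu_paired] the quotients coming from the inverses can be rewritten so that the product
    telescopes. Over all handles this leaves [side 0 (4 * g)], which is trivial because the vertices
    0 and [4 * g] coincide. *)
Lemma side_comm i : (i < g)%N ->
  comm (side (4 * i) (4 * i + 3)) (side (4 * i + 3) (4 * i + 2)) = side (4 * i) (4 * i.+1).
Proof.
move=> ig; have := mu_paired (paired_a ig); have := mu_paired (paired_b ig).
have -> : (4 * i + 3).+1 = (4 * i.+1)%N by lia.
have -> : (4 * i + 1).+1 = (4 * i + 2)%N by lia.
have -> : (4 * i + 2).+1 = (4 * i + 3)%N by lia.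
have -> : (4 * i).+1 = (4 * i + 1)%N by lia.
rewrite /comm /side; set m0 := mu (4 * i)%N; set m4 := mu (4 * i.+1)%N.
set m1 := mu (4 * i + 1); set m2 := mu (4 * i + 2); set m3 := mu (4 * i + 3).
set c := ray_class (rep x0) => Eb Ea.
have {}Ea : (m3^-1 * m0 = m2^-1 * m1)%g.
  by have /(congr1 (fun x => x^-1)%g) := Ea; rewrite !invMg !invgK.
transitivity (c * (m0^-1 * m3 * (m3^-1 * m2) * (m3^-1 * m0 * (m2^-1 * m3))) * c^-1)%g.
  by rewrite !invMg !invgK !mulgA !mulgKV.
by rewrite Ea -Eb !mulgA !mulgK.
Qed.

Lemma surface_hom_rel : surface_hom (surface_rel g) = 1%g.
Proof.
rewrite (hom_surface_rel surface_hom).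
have prodE m : (m <= g)%N -> (\prod_(i < m) side (4 * i) (4 * i.+1) = side 0 (4 * m))%g.
  elim: m => [|m IHm] mg; first by rewrite big_ord0 /side muln0 mulVg mulg1 mulgV.
  by rewrite big_ord_recr /= IHm ?(ltnW mg) // /side !mulgA mulgKV mulgK.
transitivity (\prod_(i < g) side (4 * i) (4 * i.+1))%g.
  apply: eq_bigr => i _; rewrite -side_comm ?ltn_ord //.
  by congr (comm _ _); exact: fg_lift_generator.
by rewrite prodE // /side mu_period mulVg mulg1 mulgV.
Qed.

End Basepoint.

(** * Holonomy as a homomorphism on the fundamental group *)

Section Detect.
Variables (R : realType) (g : nat) (S : topologicalType) (Q : R * R -> S).
Hypothesis Qpoly : polygonal g Q.
Variables (rep : S -> R * R) (x0 : S) (H : groupType) (e f : int -> H).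
Hypotheses (repK : forall z, Q (rep z) = z)
  (e_period : forall m, e (m + (4 * g)%N%:Z) = e m)
  (f_period : forall m, f (m + (4 * g)%N%:Z) = f m)
  (ef : forall k k' : nat, paired g k k' ->
    ((e k%:Z)^-1 * f k%:Z = (e k'%:Z)^-1 * f k'.+1%:Z /\
     (e k%:Z)^-1 * f k.+1%:Z = (e k'%:Z)^-1 * f k'%:Z)%g).
Local Notation hol := (hol rep e f).
Local Notation delta := (delta Q rep e f).
Local Notation cl := (path_class x0 (tail Q rep x0)).

Definition detect (a : pi1 R x0) : H := hol (fun s => repr a (to_I s)).

Lemma detect_cls c : based x0 c -> detect (cls x0 c) = hol c.
Proof.
move=> bc; have [cc _ _] := bc; rewrite /detect /cls.
have hom := loop_homotopic_ph (repr_pi1 (loopify x0 c)).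
rewrite (hol_ph Qpoly repK e_period f_period ef hom).
apply: (hol_ext Qpoly repK e_period f_period ef cc) => s s1.
by rewrite loopifyE // val_to_I.
Qed.

Lemma detectM : {morph detect : a b / (a * b)%g}.
Proof.
move=> a b; have [c bc <-] := cls_surj a; have [d bd <-] := cls_surj b.
rewrite -cls_pcat // !detect_cls //; last first.
  by case: bc bd => [cc c0 c1] [dc d0 d1]; split; rewrite ?pcat0 ?pcat1 //; apply: pcat_cont; rewrite ?c1.
case: bc bd => [cc c0 c1] [dc d0 d1].
by apply: (hol_pcat Qpoly repK e_period f_period ef); rewrite ?c1.
Qed.

Definition detect_hom : {multiplicative pi1 R x0 -> H} :=
  HB.pack_for {multiplicative pi1 R x0 -> H} detect
    (isMultiplicative.Build (pi1 R x0) H detect detectM).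

Lemma detect_cl (c : R -> S) : continuous c -> detect (cl c) = hol c.
Proof.
move=> cc; have tc y : continuous (tail Q rep x0 y) by exact/(Q_path Qpoly)/segment_continuous.
have t0 y : tail Q rep x0 y 0 = x0 by exact: tail0.
have t1 y : tail Q rep x0 y 1 = y by exact: tail1.
rewrite /path_class detect_cls; last exact: tailed_based.
rewrite /tailed; set t := tail _ _ _ _; set t' := tail _ _ _ _.
have t'c : continuous (prev_path t') by apply: prev_path_cont; exact: tc.
have t'0 : prev_path t' 0 = c 1 by rewrite /prev_path subr0; exact: t1.
have holP := hol_pcat Qpoly repK e_period f_period ef.
have h1 y : hol (tail Q rep x0 y) = 1%g.
  rewrite /tail (hol_Q Qpoly repK e_period f_period ef); last exact: segment_continuous.
  by rewrite segment0 segment1 !(delta_rep Qpoly repK e_period f_period ef) invg1 mulg1.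
have h2 y : hol (prev_path (tail Q rep x0 y)) = 1%g.
  have -> : prev_path (tail Q rep x0 y) = Q \o prev_path (segment (rep x0) (rep y)) by [].
  rewrite (hol_Q Qpoly repK e_period f_period ef); last exact/prev_path_cont/segment_continuous.
  by rewrite /prev_path subr0 subrr segment0 segment1 !(delta_rep Qpoly repK e_period f_period ef) invg1 mulg1.
rewrite holP; [|exact: tc|by apply: pcat_cont|by rewrite pcat0; exact: t1].
by rewrite holP // h1 h2 mul1g mulg1.
Qed.

Lemma delta_clamp r : delta (clamp r.1, r.2) = delta r.
Proof.
have [c dc] := dom_cover r; have dc' := dc; rewrite -dom_clamp in dc'.
rewrite (deltaE Qpoly repK e_period f_period ef dc).
rewrite (deltaE Qpoly repK e_period f_period ef dc') -(Q_clamp Qpoly).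
by case: c {dc dc'}.
Qed.

Lemma detect_nu r : detect (ray_class Q rep x0 r) = (delta r)^-1%g.
Proof.
rewrite /ray_class detect_cl; last exact/(Q_path Qpoly)/ray_continuous.
rewrite (hol_Q Qpoly repK e_period f_period ef); last exact: ray_continuous.
rewrite /ray subrr mul0r subr0 mul1r delta_clamp.
by rewrite (@delta_inner _ _ _ _ Qpoly _ _ _ _ repK e_period f_period ef) ?mulg1.
Qed.

(** Rays end at the centre, where [delta] is trivial, so each ray contributes only [delta] at its
    start; at [rep x0] this is trivial as well. *)
Lemma detect_side k l : Q (1, k%:R) = Q (1, l%:R) ->
  detect (side Q rep x0 k l) = (f k%:Z * (f l%:Z)^-1)%g.
Proof.
have detectV a : detect a^-1%g = (detect a)^-1%g by exact: (multiplicativeV detect_hom).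
move=> Qkl; rewrite /side !detectM !detectV !detect_nu.
rewrite (delta_rep Qpoly repK e_period f_period ef) !invg1 mul1g mulg1 invgK.
exact: (delta_vertex Qpoly repK e_period f_period ef Qkl).
Qed.

End Detect.

(** * Surjectivity *)

Section Surjectivity.
Variables (R : realType) (g : nat) (S : topologicalType) (Q : R * R -> S).
Hypothesis Qpoly : polygonal g Q.
Variables (rep : S -> R * R) (x0 : S).
Hypothesis repK : forall z, Q (rep z) = z.

Local Notation cl := (path_class x0 (tail Q rep x0)).
Local Notation nu := (ray_class Q rep x0).
Local Notation phi := (@surface_hom R g S Q rep x0).

Let phiM x y : phi (x * y)%g = (phi x * phi y)%g. Proof. exact: fg_liftM. Qed.
Let phiV x : phi x^-1%g = (phi x)^-1%g. Proof. exact: (multiplicativeV phi). Qed.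
Let phi1 : phi 1%g = 1%g. Proof. exact: (multiplicative1 phi). Qed.

(** Here [x] is thought of as a loop at the centre; conjugation by the ray from [x0] moves its base
    point. *)
Definition attained (x : pi1 R x0) : Prop :=
  exists w, phi w = (nu (rep x0) * x * (nu (rep x0))^-1)%g.

Lemma attainedM x y : attained x -> attained y -> attained (x * y)%g.
Proof.
move=> [w ww] [v vv]; exists (w * v)%g.
by rewrite phiM ww vv !mulgA mulgKV.
Qed.

Lemma attainedV x : attained x -> attained x^-1%g.
Proof.
move=> [w ww]; exists w^-1%g.
by rewrite phiV ww !invMg invgK !mulgA.
Qed.

Lemma attained1 : attained 1%g.
Proof. by exists 1%g; rewrite phi1 mulg1 mulgV. Qed.

Lemma attained_paired k k' : paired g k k' ->
  attained ((nu (1%R, k%:R))^-1 * nu (1%R, k'.+1%:R))%g.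
Proof.
case=> i [ig [[-> ->]|[-> ->]]].
  have -> : (4 * i + 2).+1 = (4 * i + 3)%N by lia.
  exists (generator (Ordinal ig, false)); exact: fg_lift_generator.
rewrite (mu_paired Qpoly x0 repK (paired_b ig)) -[X in attained X]invgK; apply: attainedV.
have -> : (4 * i + 1).+1 = (4 * i + 2)%N by lia.
rewrite invMg invgK.
exists (generator (Ordinal ig, true)); exact: fg_lift_generator.
Qed.

Lemma attained_Q r r' : Q r = Q r' -> attained ((nu r)^-1 * nu r')%g.
Proof.
(* The fibers of [Q] are accessible only through side-invariant functions, so the relation to be
   proved is encoded as an invariant with values in sets. *)
pose Phi (r : R * R) : set (pi1 R x0) := [set x | attained ((nu r)^-1 * x)%g].
suff Phi_inv : side_invariant g Phi.
  case: Qpoly => _ _ _ _ Qf /(Qf _ _ Phi_inv) Phi_eq.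
  suff : Phi r (nu r') by [].
  by rewrite Phi_eq /Phi /= mulVg; exact: attained1.
apply/side_invariantP; split=> [z|t t'|rho t|k k' s kk s1].
- by rewrite /Phi /ray_class /ray /= clampK.
- rewrite /Phi; suff -> : nu (0, t) = nu (0, t') by [].
  congr path_class; apply/funext => u; rewrite /ray /= clamp0 mulr0; exact: Q_center Qpoly _ _.
- rewrite /Phi; suff -> : nu (rho, t + (4 * g)%N%:R) = nu (rho, t) by [].
  by congr path_class; apply/funext => u; rewrite /ray /=; case: Qpoly => _ _ _ [_ _ -> _] _.
- have red : attained ((nu (1, k%:R + s)%R)^-1 * nu (1, k'%:R + 1 - s)%R)%g.
    by rewrite (nu_paired Qpoly x0 repK kk s1); exact: attained_paired.
  apply/seteqP; split=> x; rewrite /Phi /= => xr.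
    rewrite -[X in attained X](mulKg ((nu (1, k%:R + s)%R)^-1 * nu (1, k'%:R + 1 - s)%R)%g).
    apply: attainedM; first exact: attainedV.
    by rewrite mulgA mulgK.
  have -> : ((nu (1, k%:R + s)%R)^-1 * x = (nu (1, k%:R + s)%R)^-1 *
      nu (1, k'%:R + 1 - s)%R * ((nu (1, k'%:R + 1 - s)%R)^-1 * x))%g.
    by rewrite mulgA mulgK.
  exact: attainedM.
Qed.

(* In the chart [c], the point [z] slides to the centre of its cell as [u] runs
   from 0 to 1. *)
Definition contract (c : chart) (zu : S * R) : S :=
  Q (slide c (idx c (rep zu.1)) (rep zu.1, zu.2)).

Lemma contract_Q c r u : dom c r -> contract c (Q r, u) = Q (slide c (idx c r) (r, u)).
Proof.
move=> dr; have Qr : Q (rep (Q r)) = Q r by rewrite repK.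
have dr' : dom c (rep (Q r)) by rewrite (dom_Q Qpoly c Qr).
case: Qpoly => _ _ _ Qi Qf.
have := Qf _ _ (slide_invariant c u Qi) _ _ Qr.
by rewrite dr dr' => -[].
Qed.

Lemma open_saturated (A : set S) (P : R * R -> Prop) :
  (forall r, A (Q r) <-> P r) -> (forall r, P r -> \forall r' \near r, P r') -> open A.
Proof.
move=> AP Pn; case: Qpoly => _ _ Qo _ _; apply/Qo/open_near => r /AP /Pn.
by apply: filterS => r' /AP.
Qed.

(** The product of a quotient map with an interval is not known to be a quotient map. Instead, the
    times are restricted to a compact [J]; by the tube lemma the points that stay in [V] throughout
    [J] form an open set, which is tested on the plane. *)
Lemma contract_continuous c z u : dom c (rep z) -> {for (z, u), continuous (contract c)}.
Proof.
move=> dz W /=; rewrite nbhsE => -[V [oV VK] VW].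
have Qs m : continuous (fun ru => Q (slide c m ru)).
  exact: comp_continuous (Q_cont Qpoly) (@slide_continuous R c m).
have uc : continuous (fun u => contract c (z, u)).
  exact: (comp_continuous (Qs (idx c (rep z))) (@pair_cst_continuous R _ (rep z))).
have /nbhs_ballP[eps /= eps0 sub] : nbhs u [set u | V (contract c (z, u))].
  by apply: uc; apply: open_nbhs_nbhs.
pose J := [set` `[u - eps / 2, u + eps / 2]].
have JV v : J v -> V (contract c (z, v)).
  rewrite /J /= in_itv /= => /andP[v1 v2]; apply: sub.
  by rewrite /ball /= ltr_norml; apply/andP; split; lra.
pose A := [set z | dom c (rep z) /\ forall v, J v -> V (contract c (z, v))].
have oA : open A.
  apply: (open_saturated (P := fun r => dom c r /\
      forall v, J v -> V (Q (slide c (idx c r) (r, v))))).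
    move=> r; have Qr : Q (rep (Q r)) = Q r by rewrite repK.
    rewrite /A /= (dom_Q Qpoly c Qr); split=> -[d Jr]; split=> // v Jv.
      by rewrite -contract_Q //; exact: Jr.
    by rewrite contract_Q //; exact: Jr.
  move=> r [d Jr].
  have tube : \forall r' \near r, J `<=` (fun v => V (Q (slide c (idx c r) (r', v)))).
    have /compact_near_coveringP cover : compact J by exact: segment_compact.
    apply: (cover _ (nbhs r) (fun r' v => V (Q (slide c (idx c r) (r', v))))) => v Jv.
    have : nbhs (r, v) [set rv | V (Q (slide c (idx c r) rv))].
      by apply: Qs; apply: open_nbhs_nbhs; split=> //; exact: Jr.
    case=> -[B1 B2] [/= nB1 nB2] sub'; exists (B2, B1) => //= -[v' r'] [/= Bv Br].
    exact: (sub' (r', v')).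
  by apply: filterS2 tube (dom_near d) => r' Jr' [-> ->].
have nz : nbhs z A by apply: open_nbhs_nbhs.
have nu' : nbhs u J.
  apply: filterS (nbhsx_ballx u (eps / 2) _); last by rewrite divr_gt0.
  by move=> v; rewrite /ball /= ltr_norml /J /= in_itv /= => /andP[v1 v2]; apply/andP; split; lra.
exists (A, J) => // -[z' v] [/= [_ Az] Jv].
by apply: VW; exact: Az.
Qed.

Lemma slide1 c m r r' : Q (slide c m (r, 1)) = Q (slide c m (r', 1)).
Proof.
case: c => /=; rewrite clamp1 subrr !mul0r ?add0r //.
exact: Q_center Qpoly _ _.
Qed.

Lemma contract1_near c z : dom c (rep z) ->
  \forall z' \near z, dom c (rep z') /\ contract c (z', 1) = contract c (z, 1).
Proof.
move=> dz; suff oA : open [set z' | dom c (rep z') /\ contract c (z', 1) = contract c (z, 1)].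
  exact: open_nbhs_nbhs.
apply: (open_saturated (P := fun r => dom c r /\
    Q (slide c (idx c r) (r, 1)) = contract c (z, 1))).
  move=> r; have Qr : Q (rep (Q r)) = Q r by rewrite repK.
  rewrite /= (dom_Q Qpoly c Qr); split=> -[d E]; split=> //.
    by rewrite -contract_Q.
  by rewrite contract_Q.
move=> r [d E]; apply: filterS (dom_near d) => r' [-> ->]; split=> //.
by rewrite -E; exact: slide1.
Qed.

Lemma contract0 c z : contract c (z, 0) = z.
Proof.
rewrite -[RHS]repK (Q_clamp Qpoly (rep z)) /contract.
by case: c; rewrite /= clamp0 subr0 !mul1r ?mul0r ?addr0.
Qed.

Lemma nu_slide0 c m r : nu (slide c m (r, 0)) = nu r.
Proof.
congr path_class; apply/funext => u.
by case: c; rewrite /ray /= clamp0 subr0 !mul1r ?mul0r ?addr0 clampK.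
Qed.

Definition piece (c : R -> S) (a b : R) (s : R) : S := c (a + clamp s * (b - a)).

Lemma cl_contract i z : cl (fun u => contract i (z, u)) =
  (nu (rep z) * (nu (slide i (idx i (rep z)) (rep z, 1%R)))^-1)%g.
Proof.
set m := idx i (rep z).
have -> : (fun u => contract i (z, u)) = Q \o (fun u => slide i m (rep z, u)) by [].
rewrite (cl_Q Qpoly x0 repK) ?nu_slide0 //.
exact: (comp_continuous (@slide_continuous R i m) (@pair_cst_continuous R _ (rep z))).
Qed.

Lemma piece_continuous (c : R -> S) (a b : R) : continuous c -> continuous (piece c a b).
Proof.
move=> cc; apply: (comp_continuous cc) => s; apply: cvgD; first exact: cvg_cst.
by apply: cvgM; [exact: clamp_continuous|exact: cvg_cst].
Qed.

Lemma piece0 c a b : piece c a b 0 = c a.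
Proof. by rewrite /piece clamp0 mul0r addr0. Qed.

Lemma piece1 c a b : piece c a b 1 = c b.
Proof. by rewrite /piece clamp1 mul1r addrC subrK. Qed.

(** The contraction sweeps out a square with the piece on one side and a constant path on the
    opposite one. The other two sides reduce the class to [(nu ma)^-1 * nu mb], where [ma] and [mb]
    have the same image [p]. *)
Lemma attained_piece_local (c : R -> S) (a b : R) i p : continuous c -> a <= b ->
  (forall s, a <= s <= b -> dom i (rep (c s)) /\ contract i (c s, 1) = p) ->
  attained ((nu (rep (c a)))^-1 * cl (piece c a b) * nu (rep (c b)))%g.
Proof.
move=> cc ab ip; have pc : continuous (piece c a b) by exact: piece_continuous.
have pin s : a <= a + clamp s * (b - a) <= b.
  by have /andP[s0 s1] := clamp_itv s; apply/andP; split; nra.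
pose K (su : R * R) := contract i (piece c a b su.1, su.2).
have Kc : continuous K.
  move=> su; apply: (@continuous_comp _ _ _ (fun su : R * R => (piece c a b su.1, su.2))).
    apply: pair_continuous; last exact: snd_cont.
    exact: comp_continuous pc fst_cont.
  by apply: contract_continuous; case: (ip _ (pin su.1)).
have sc s : continuous (segment (s, 0) (s, 1) : R -> R * R) by exact: segment_continuous.
have bc u : continuous (segment (0, u) (1, u) : R -> R * R) by exact: segment_continuous.
have seg1 s u : segment (s, 0) (s, 1) u = (s, u) :> R * R.
  by rewrite /segment /= mulr0 mulr1 add0r -mulrDl subrK mul1r.
have seg2 u s : segment (0, u) (1, u) s = (s, u) :> R * R.
  by rewrite /segment /= mulr0 mulr1 add0r -mulrDl subrK mul1r.
have KE (r : R -> R * R) : continuous r -> continuous (K \o r) by exact: comp_continuous Kc.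
have side01 s : K \o segment (s, 0) (s, 1) = (fun u => contract i (piece c a b s, u)).
  by apply/funext => u; rewrite /= seg1.
have : cl (K \o pcat (segment (0, 0) (1, 0)) (segment (1, 0) (1, 1))) =
       cl (K \o pcat (segment (0, 0) (0, 1)) (segment (0, 1) (1, 1))).
  apply: (cl_square Qpoly x0 repK) => //; [apply: pcat_cont..| |] => //;
    by rewrite ?pcat0 ?pcat1 ?segment0 ?segment1.
rewrite !pcat_comp !(cl_cat Qpoly x0 repK) ?segment0 ?segment1 //=; try exact: KE; try by rewrite segment0 segment1.
rewrite !side01 !cl_contract piece0 piece1.
have -> : K \o segment (0, 0) (1, 0) = piece c a b.
  by apply/funext => s; rewrite /= seg2 /K contract0.
have -> : K \o segment (0, 1) (1, 1) = cst p.
  by apply/funext => s; rewrite /= seg2 /K; case: (ip _ (pin s)).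
rewrite (cl_const Qpoly x0 repK) mulg1.
set mb := slide _ _ _; set ma := slide _ _ _ => E.
have -> : ((nu (rep (c a)))^-1 * cl (piece c a b) * nu (rep (c b)) = (nu ma)^-1 * nu mb)%g.
  set na := nu (rep (c a)) in E *; set nb := nu (rep (c b)) in E *.
  have -> : cl (piece c a b) = (na * (nu ma)^-1 * (nb * (nu mb)^-1)^-1)%g by rewrite -E mulgK.
  by rewrite invMg invgK !mulgA mulVg mul1g mulgKV.
apply: attained_Q.
have [|_ Ea] := ip a; first by rewrite lexx.
have [|_ Eb] := ip b; first by rewrite lexx ab.
by rewrite -[LHS]/(contract i (c a, 1)) -[RHS]/(contract i (c b, 1)) Ea Eb.
Qed.

Lemma cl_piece_add (c : R -> S) (a b d : R) : continuous c ->
  cl (piece c a d) = (cl (piece c a b) * cl (piece c b d))%g.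
Proof.
move=> cc; pose K (su : R * R) := c su.1.
have Kc : continuous K by exact: comp_continuous cc fst_cont.
pose r a b (s : R) : R * R := (a + clamp s * (b - a), 0).
have rc a' b' : continuous (r a' b').
  apply: pair_continuous; last exact: cst_continuous.
  move=> s; apply: cvgD; first exact: cvg_cst.
  by apply: cvgM; [exact: clamp_continuous|exact: cvg_cst].
have r0 a' b' : r a' b' 0 = (a', 0) by rewrite /r clamp0 mul0r addr0.
have r1 a' b' : r a' b' 1 = (b', 0) by rewrite /r clamp1 mul1r addrC subrK.
rewrite -(cl_cat Qpoly x0 repK); [|exact: piece_continuous|exact: piece_continuous|by rewrite piece0 piece1].
rewrite -[piece c a d]/(K \o r a d) -[piece c a b]/(K \o r a b) -[piece c b d]/(K \o r b d).
rewrite -pcat_comp; apply: (cl_square Qpoly x0 repK) => //.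
- by apply: pcat_cont => //; rewrite r0 r1.
- by rewrite pcat0 !r0.
- by rewrite pcat1 !r1.
Qed.

Lemma attained_piece (c : R -> S) : continuous c ->
  attained ((nu (rep (c 0%R)))^-1 * cl (piece c 0 1) * nu (rep (c 1%R)))%g.
Proof.
move=> cc; apply: (cousin (P := fun a b =>
  attained ((nu (rep (c a)))^-1 * cl (piece c a b) * nu (rep (c b)))%g)) ler01 _ _.
  move=> a b d _ _ Pab Pbd; have := attainedM Pab Pbd.
  by rewrite (cl_piece_add a b d cc) !mulgA mulgK.
move=> x _; have [i di] := dom_cover (rep (c x)).
have near_x : \forall s \near x, dom i (rep (c s)) /\ contract i (c s, 1) = contract i (c x, 1) :=
  cc x _ (contract1_near di).
have /nbhs_ballP[eps /= eps0 sub] := near_x.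
exists eps => // a b /andP[_ ax] /andP[xb _] ea eb.
apply: (@attained_piece_local _ _ _ i (contract i (c x, 1))) => //; first exact: le_trans ax xb.
move=> s /andP[as_ sb]; apply: sub; rewrite /ball /= ltr_norml; apply/andP; split; lra.
Qed.

Lemma surface_hom_surj a : exists w, phi w = a.
Proof.
have [c bc <-] := cls_surj a; have [cc c0 c1] := bc.
have tx0 := tail_x0 x0 repK.
have tc y : continuous (tail Q rep x0 y) by exact/(Q_path Qpoly)/segment_continuous.
have t0 y : tail Q rep x0 y 0 = x0 by exact: tail0.
have t1 y : tail Q rep x0 y 1 = y by exact: tail1.
rewrite -(cl_based tc t0 t1 tx0 bc).
have -> : cl c = cl (piece c 0 1).
  apply: (cl_ph tc t0 t1); apply: (@ph_reparam _ _ c id (@clamp R)) => //.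
  - exact: id_cont.
  - exact: clamp_continuous.
  - by rewrite clamp0.
  - by rewrite clamp1.
  - by move=> s; rewrite /piece add0r subr0 mulr1.
have [w ww] := attained_piece cc; exists w; rewrite ww c0 c1.
by rewrite -!mulgA mulVKg mulgV mulg1.
Qed.

End Surjectivity.

(** * The presentation *)

Section QuotientGroup.
Variables (F : groupType) (N : set F).
Hypothesis N_normal : normal_subgroup N.
Local Open Scope group_scope.

Let N1 : N 1. Proof. by case: N_normal. Qed.
Let NM x y : N x -> N y -> N (x * y). Proof. by case: N_normal => _ + _ _; exact. Qed.
Let NV x : N x -> N x^-1. Proof. by case: N_normal => _ _ + _; exact. Qed.
Let NJ x y : N x -> N (x ^ y). Proof. by case: N_normal => _ _ _; exact. Qed.

Definition coset_eq (x y : F) : bool := `[< N (x^-1 * y) >].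

Lemma coset_eq_refl : reflexive coset_eq.
Proof. by move=> x; apply/asboolP; rewrite mulVg. Qed.

Lemma coset_eq_sym : symmetric coset_eq.
Proof.
by move=> x y; apply/asboolP/asboolP => /NV; rewrite invMg invgK.
Qed.

Lemma coset_eq_trans : transitive coset_eq.
Proof.
move=> y x z /asboolP xy /asboolP yz; apply/asboolP.
by have := NM xy yz; rewrite mulgA mulgK.
Qed.

Definition coset_equiv : equiv_rel F :=
  EquivRel coset_eq coset_eq_refl coset_eq_sym coset_eq_trans.

Definition quotient_group : Type := {eq_quot coset_equiv}.

HB.instance Definition _ := Choice.on quotient_group.
HB.instance Definition _ := EqQuotient.on quotient_group.

Definition quotient_proj (x : F) : quotient_group := \pi_quotient_group x.

Lemma quotient_projP x y : quotient_proj x = quotient_proj y <-> N (x^-1 * y).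
Proof. by split=> [/eqmodP /asboolP //|xy]; apply/eqmodP/asboolP. Qed.

Lemma repr_proj x : N (x^-1 * repr (quotient_proj x)).
Proof. by apply/quotient_projP; rewrite /quotient_proj reprK. Qed.

Definition quotient_mul (a b : quotient_group) := quotient_proj (repr a * repr b).
Definition quotient_inv (a : quotient_group) := quotient_proj (repr a)^-1.

Lemma quotient_mulE x y :
  quotient_mul (quotient_proj x) (quotient_proj y) = quotient_proj (x * y).
Proof.
apply/esym/quotient_projP; set x' := repr _; set y' := repr _.
have -> : (x * y)^-1 * (x' * y') = (x^-1 * x') ^ y * (y^-1 * y').
  by rewrite conjgE invMg !mulgA mulgK.
by apply: NM; [apply: NJ|]; exact: repr_proj.
Qed.

Lemma quotient_invE x : quotient_inv (quotient_proj x) = quotient_proj x^-1.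
Proof.
apply/quotient_projP; set x' := repr _; rewrite invgK.
have -> : x' * x^-1 = (x^-1 * x') ^ x^-1 by rewrite conjgE invgK !mulgA mulgV mul1g.
by apply: NJ; exact: repr_proj.
Qed.

Lemma quotient_ind (P : quotient_group -> Prop) :
  (forall x, P (quotient_proj x)) -> forall a, P a.
Proof. by move=> Pproj; elim/quotW. Qed.

Lemma quotient_mulA : associative quotient_mul.
Proof.
elim/quotient_ind=> x; elim/quotient_ind=> y; elim/quotient_ind=> z.
by rewrite !quotient_mulE mulgA.
Qed.

Lemma quotient_mul1 : left_id (quotient_proj 1) quotient_mul.
Proof. by elim/quotient_ind=> x; rewrite quotient_mulE mul1g. Qed.

Lemma quotient_mulr1 : right_id (quotient_proj 1) quotient_mul.
Proof. by elim/quotient_ind=> x; rewrite quotient_mulE mulg1. Qed.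

Lemma quotient_mulV : left_inverse (quotient_proj 1) quotient_inv quotient_mul.
Proof. by elim/quotient_ind=> x; rewrite quotient_invE quotient_mulE mulVg. Qed.

Lemma quotient_mulrV : right_inverse (quotient_proj 1) quotient_inv quotient_mul.
Proof. by elim/quotient_ind=> x; rewrite quotient_invE quotient_mulE mulgV. Qed.

HB.instance Definition _ := isGroup.Build quotient_group
  quotient_mulA quotient_mul1 quotient_mulr1 quotient_mulV quotient_mulrV.

Lemma quotient_projM : {morph quotient_proj : x y / x * y}.
Proof. by move=> x y; rewrite -quotient_mulE. Qed.

HB.instance Definition _ :=
  isMultiplicative.Build F quotient_group quotient_proj quotient_projM.

Lemma quotient_proj_ker x : quotient_proj x = 1 -> N x.
Proof. by move=> /esym /quotient_projP; rewrite invg1 mul1g. Qed.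

Lemma quotient_proj1 x : N x -> quotient_proj x = 1.
Proof. by move=> Nx; apply/esym/quotient_projP; rewrite invg1 mul1g. Qed.

End QuotientGroup.

Lemma normal_closure_normal (F : groupType) (B : set F) :
  normal_subgroup (normal_closure B).
Proof.
split=> [|x y Nx Ny|x Nx|x y Nx] A AB; have [[A1 AM AV AJ] _] := AB => //.
- by apply: AM; [exact: Nx|exact: Ny].
- by apply: AV; exact: Nx.
- by apply: AJ; exact: Nx.
Qed.

Lemma div4 i r : (r < 4)%N -> ((4 * i + r) %/ 4 = i)%N.
Proof. by move=> r4; lia. Qed.
Lemma mod4 i r : (r < 4)%N -> ((4 * i + r) %% 4 = r)%N.
Proof. by move=> r4; lia. Qed.

(** * Chart labels from a solution of the surface relation *)

Section Labels.
Variables (g : nat) (H : groupType) (a b : nat -> H).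
Hypothesis g0 : (0 < g)%N.
Hypothesis ab : (\prod_(i < g) comm (a i) (b i) = 1)%g.
Local Open Scope group_scope.

Definition edge_label (k : nat) : H :=
  match (k %% 4)%N with 0 => a (k %/ 4)%N | 3 => b (k %/ 4)%N | _ => 1 end.

(** With [edge_label] given and [P] at vertex [4 * i], the gluing equations can be solved in turn:
    they give the vertices [4 * i + 3], [4 * i + 2], [4 * i + 1] and finally [comm (b i) (a i) * P]
    at [4 * i + 4], the inverse of the next partial product. *)
Definition vertex_label (k : nat) : H :=
  let i := (k %/ 4)%N in
  let P := (\prod_(j < i) comm (a j) (b j))^-1 in
  match (k %% 4)%N with
  | 0 => P
  | 1 => a i * (b i)^-1 * (a i)^-1 * P
  | 2 => (b i)^-1 * (a i)^-1 * P
  | _ => (a i)^-1 * P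
  end.

Definition int_label (l : nat -> H) (m : int) : H := l `|(m %% (4 * g)%N%:Z)%Z|%N.

Lemma int_label_period l m : int_label l (m + (4 * g)%N%:Z)%R = int_label l m.
Proof. by rewrite /int_label modzDr. Qed.

Lemma int_label_lt l (k : nat) : (k < 4 * g)%N -> int_label l k%:Z = l k.
Proof. by move=> kg; rewrite /int_label modz_nat modn_small. Qed.

Lemma edge_labels i : [/\ edge_label (4 * i) = a i, edge_label (4 * i + 1) = 1,
  edge_label (4 * i + 2) = 1 & edge_label (4 * i + 3) = b i].
Proof. by rewrite /edge_label !mod4 // !div4 // -[(4 * i)%N]addn0 mod4 // div4. Qed.

Lemma vertex_labels i : let P := (\prod_(j < i) comm (a j) (b j))^-1 in
  [/\ vertex_label (4 * i) = P, vertex_label (4 * i + 1) = a i * (b i)^-1 * (a i)^-1 * P,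
  vertex_label (4 * i + 2) = (b i)^-1 * (a i)^-1 * P & vertex_label (4 * i + 3) = (a i)^-1 * P].
Proof. by rewrite /vertex_label !mod4 // !div4 // -[(4 * i)%N]addn0 mod4 // div4. Qed.

Lemma labels_paired (k k' : nat) : paired g k k' ->
  let e := int_label edge_label in let f := int_label vertex_label in
  (e k%:Z)^-1 * f k%:Z = (e k'%:Z)^-1 * f k'.+1%:Z /\
  (e k%:Z)^-1 * f k.+1%:Z = (e k'%:Z)^-1 * f k'%:Z.
Proof.
case=> i [ig kk] e f; have [e0 e1 e2 e3] := edge_labels i.
have [f0 f1 f2 f3] := vertex_labels i; set P := _^-1 in f0 f1 f2 f3.
(* In the last block, vertex [4 * g] carries by periodicity the label of vertex 0; this is where the
   surface relation is used. *)
have f4 : f (4 * i + 4)%N%:Z = comm (b i) (a i) * P.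
  have -> : comm (b i) (a i) * P = (\prod_(j < i.+1) comm (a j) (b j))^-1.
    by rewrite big_ord_recr /= invMg /comm !invMg !invgK !mulgA.
  have [ig1|ne] := eqVneq i.+1 g.
    have -> : (4 * i + 4)%N%:Z = (0 + (4 * g)%N%:Z)%R.
      by rewrite add0r -ig1; congr Posz; lia.
    rewrite ig1 ab /f int_label_period (@int_label_lt _ 0%N); last by lia.
    by have [+ _ _ _] := vertex_labels 0; rewrite muln0 big_ord0 => ->.
  rewrite /f int_label_lt; last by lia.
  have -> : (4 * i + 4 = 4 * i.+1)%N by lia.
  by have [-> _ _ _] := vertex_labels i.+1.
have lt r : (r < 4)%N -> (4 * i + r < 4 * g)%N by move=> r4; lia.
have eE r : (r < 4)%N -> e (4 * i + r)%N%:Z = edge_label (4 * i + r).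
  by move=> r4; apply/int_label_lt/lt.
have fE r : (r < 4)%N -> f (4 * i + r)%N%:Z = vertex_label (4 * i + r).
  by move=> r4; apply/int_label_lt/lt.
have e0' := eE 0%N isT; have f0' := fE 0%N isT; rewrite addn0 in e0' f0'.
case: kk => -[-> ->]; rewrite -?[(4 * i + _).+1]addnS -?[(4 * i).+1]addn1.
  rewrite e0' f0' !eE // !fE // e0 e2 f0 f1 f2 f3 invg1 !mul1g.
  by rewrite !mulgA mulVg mul1g.
rewrite !eE // f4 !fE // e1 e3 f1 f2 f3 invg1 !mul1g /comm.
by rewrite !mulgA mulVg mul1g.
Qed.

End Labels.

Theorem theorem1p1 (R : realType) (g : nat) (hg : (2 <= g)%N)
    (S : topologicalType) (hS : is_closed_orientable_surface R g S) (x0 : S) :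
  flexibly_stable R (pi1 R x0).
Proof.
case: g hg hS => [|h] // hg hS; set g := h.+1.
have [Q Qpoly] := surface_polygonal (ltn0Sn h) hS.
have [rep repK] : exists rep : S -> R * R, forall z, Q (rep z) = z.
  have Qsurj z : exists r, Q r = z by case: Qpoly.
  by have [rep repK] := boolp.choice Qsurj; exists rep.
pose phi : {multiplicative free_group (surface_gen g) -> pi1 R x0} :=
  @surface_hom R g S Q rep x0.
apply: (@surface_group_stable R h _ phi) => //; split; first exact: surface_hom_surj.
set rels := [set` [:: surface_rel g]].
have phi_rel : phi (surface_rel g) = 1%g := surface_hom_rel Qpoly x0 repK.
apply/seteqP; split=> [w /= w1|w].
  pose N_normal := normal_closure_normal rels.
  pose q : {multiplicative free_group (surface_gen g) -> quotient_group N_normal} :=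
    quotient_proj N_normal.
  pose a (i : nat) := q (gen_a (inord i : 'I_g)).
  pose b (i : nat) := q (gen_b (inord i : 'I_g)).
  have ab : (\prod_(i < g) comm (a i) (b i) = 1)%g.
    transitivity (q (surface_rel g)).
      rewrite (hom_surface_rel q).
      by apply: eq_bigr => i _; rewrite /a /b inord_val.
    by apply: quotient_proj1 => A [_]; apply; rewrite /rels /= inE.
  have g0 : (0 < g)%N by [].
  have ef := labels_paired g0 ab.
  set e := int_label g (edge_label a b) in ef; set f := int_label g (vertex_label a b) in ef.
  have eper := int_label_period g (edge_label a b).
  have fper := int_label_period g (vertex_label a b).
  pose D : {multiplicative pi1 R x0 -> quotient_group N_normal} :=
    @detect_hom R g S Q Qpoly rep x0 _ e f repK eper fper ef.
  (* On generators, the vertex labels at [4 * i] and [4 * i + 3] have quotient [a i], and those at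
     [4 * i + 3] and [4 * i + 2] have quotient [b i]. A word killed by [phi] is therefore killed by
     [q]. *)
  have dq : (D \o phi) =1 q.
    apply: eq_fg_hom => -[i []] /=.
      have Qi : Q (1, (4 * i + 3)%N%:R) = Q (1, (4 * i + 2)%N%:R).
        have in1 : 0 <= (1 : R) <= 1 by rewrite lexx ler01.
        have := Q_paired Qpoly (paired_b (ltn_ord i)) in1.
        by rewrite addrK natr1 -addnS => ->.
      transitivity (D (side Q rep x0 (4 * i + 3) (4 * i + 2))).
        by congr (D _); exact: fg_lift_generator.
      rewrite [LHS](detect_side Qpoly x0 repK eper fper ef Qi) /f !int_label_lt; try by have := ltn_ord i; lia.
      have [_ _ -> ->] := vertex_labels a b i.
      by rewrite !invMg !invgK !mulgA mulgKV mulVg mul1g /b inord_val.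
    have Qi : Q (1, (4 * i)%N%:R) = Q (1, (4 * i + 3)%N%:R).
      have in0 : 0 <= (0 : R) <= 1 by rewrite lexx ler01.
      have := Q_paired Qpoly (paired_a (ltn_ord i)) in0.
      by rewrite addr0 subr0 natr1 -addnS => ->.
    transitivity (D (side Q rep x0 (4 * i) (4 * i + 3))).
      by congr (D _); exact: fg_lift_generator.
    rewrite [LHS](detect_side Qpoly x0 repK eper fper ef Qi) /f !int_label_lt; try by have := ltn_ord i; lia.
    have [-> _ _ ->] := vertex_labels a b i.
    by rewrite !invMg !invgK !mulgA mulVg mul1g /a inord_val.
  apply: (@quotient_proj_ker _ _ N_normal); rewrite -[LHS]/(q w) -dq /= w1.
  exact: (multiplicative1 D).
move=> Nw; have := Nw [set x | phi x = 1%g]; apply; split.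
  have phiM x y : phi (x * y)%g = (phi x * phi y)%g by exact: gmulfM.
  have phiV x : phi x^-1%g = (phi x)^-1%g by exact: multiplicativeV.
  split=> [|x y fx fy|x fx|x y fx].
  - exact: (multiplicative1 phi).
  - by apply: etrans (phiM x y) _; rewrite [phi x]fx [phi y]fy mulg1.
  - by apply: etrans (phiV x) _; rewrite [phi x]fx invg1.
  - by apply: etrans (phiM _ _) _; rewrite phiM [phi x]fx mul1g phiV mulVg.
by move=> r; rewrite /rels /= inE => /eqP ->.
Qed.
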